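(* Let $n,w,e$ be integers with $1\le w\le n-1$ and $e\ge 1$. If there exists a nontrivial $e$-perfect code in the Johnson scheme $J(n,w)$, then $e\in\{1,2,4,9,10,12,16\}$.
   Context: The Johnson scheme (Johnson graph) $J(n,w)$ has as elements all $w$-subsets of $[n]=\{1,\dots,n\}$, with distance $d(X,Y)=|X\setminus Y|=|Y\setminus X|$. The $e$-ball centred at a $w$-subset $X$ is the set of all $w$-subsets at distance at most $e$ from $X$. An $e$-perfect code in $J(n,w)$ is a set $\mathcal C$ of $w$-subsets of $[n]$ such that the $e$-balls centred at the elements of $\mathcal C$ form a partition of the set of all $w$-subsets of $[n]$. An $e$-perfect code is trivial if $e=0$ (the code is the whole space), or it consists of a single codeword, or $n=2w$ with $w=2e+1$ and the code consists of a $w$-subset and its complement; otherwise it is nontrivial. *)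

(* Defs.v *)
From mathcomp Require Import all_boot.

Set Implicit Arguments.
Unset Strict Implicit.
Unset Printing Implicit Defensive.

(* The ground set [n] is encoded as 'I_n = {0, ..., n-1}. *)
Definition johnson (n w : nat) : {set {set 'I_n}} :=
  [set X : {set 'I_n} | #|X| == w].

(* On sets of equal cardinality this is symmetric: #|X :\: Y| = #|Y :\: X|. *)
Definition jdist (n : nat) (X Y : {set 'I_n}) : nat := #|X :\: Y|.

Definition jball (n w e : nat) (X : {set 'I_n}) : {set {set 'I_n}} :=
  [set Y in johnson n w | jdist X Y <= e].

(* The balls are a family indexed by the codewords: a partition [set B | ...]
   alone would identify equal balls with distinct centres (e.g. when e exceeds
   the diameter), hence the injectivity clause. *)
Definition perfect_code (n w e : nat) (C : {set {set 'I_n}}) : Prop :=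
  [/\ C \subset johnson n w,
      {in C &, injective (@jball n w e)} &
      partition [set jball w e X | X in C] (johnson n w)].

Definition trivial_code (n w e : nat) (C : {set {set 'I_n}}) : Prop :=
  [\/ e = 0,
      #|C| = 1 |
      [/\ n = 2 * w, w = 2 * e + 1 &
          exists2 X : {set 'I_n}, X \in johnson n w & C = [set X; ~: X]]].

(* Main.v *)
From HB Require Import structures.
From mathcomp Require Import all_boot all_order all_algebra all_fingroup.
From mathcomp Require Import zify ring lra.
Require Import Defs.

Set Implicit Arguments.
Unset Strict Implicit.
Unset Printing Implicit Defensive.

(** Put b = n - w and let Phi be the size of a ball of radius e. Taking complements
    of the codewords, one may assume w <= b.

    Lloyd's theorem. The sum over a ball is a polynomial of degree e in the adjacency
    operator of the Johnson graph, and all its e roots are eigenvalues theta t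
    ([lloyd_roots]). Its value at theta 0 gives the product formula
    prod t (n + 1 - t) = e!^2 Phi. Below the smallest root t0 the code is a design, so
    Phi divides many binomial coefficients ([design_dvd]). The recurrence of the dual
    Hahn polynomials excludes large roots ([lloyd_gt0]), hence T = n + 1 - t0 exceeds b
    by about 2 sqrt (b e) at most.

    Carries. Phi divides 'C(T, u) for every u between T - b and b. When u is a multiple of the
    largest power of p below b, a single carry is possible. So Phi is squarefree, and
    each of its prime factors has a power in the short interval (b, T] ([feas_carry_half]).

    Local counts. Counting how the vertices obtained from a given one by exchanging
    one, two or three points are covered gives divisibilities for w and b, essentially
    e + 1 %| w + 1 and e + 2 %| w + 2, and the same for b ([code_feasible]). Summation by
    parts turns them into e + 1 %| Phi and, up to a factor 2, e + 2 %| 6 Phi ([dvdn_ball],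
    [dvdn_ball2]). Squarefreeness then excludes e = 3, 5, 6, 7, 8, 11, 14, 15, 17
    ([feas_small]).

    The remaining radii, e = 13 and e >= 18, are excluded by size. The product of the roots t
    divides e!^2 times the product of the primes that have a power in (b, T]. There are few such
    primes ([support_sum]), whereas the product formula makes this product at least
    of order (b - e)^(2e) / T^e. The two bounds contradict each other unless ln b exceeds a
    multiple of e^4 ([analytic_range]). For such enormous b a prime factor p of e + 1 and a
    prime factor p' of e + 2 both have powers in (b, T], which makes two multiples of ln p and ln p'
    closer than the lower bound [two_log] allows ([upper_range]); that bound is proved with
    an interpolation determinant. *)

(** * Counting in the Johnson scheme *)

Definition ball_size (w b e : nat) : nat := \sum_(i < e.+1) 'C(w, i) * 'C(b, i).

Lemma ball_size_gt0 w b e : 0 < ball_size w b e.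
Proof. by rewrite /ball_size big_ord_recl !bin0. Qed.

(** Perfection in the form in which it is used: every vertex sees exactly one
    codeword within distance e. *)
Definition code_axiom (n w e : nat) (C : {set {set 'I_n}}) : Prop :=
  C \subset johnson n w /\
  forall Y, Y \in johnson n w -> #|[set c in C | (#|c :\: Y| <= e)%N]| = 1%N.

Section Counting.
Variable n : nat.
Implicit Types X Y Z P Q D : {set 'I_n}.

Lemma card_draws_meet (X D : {set 'I_n}) k m : m <= k ->
  #|[set P : {set 'I_n} | [&& P \subset X, #|P| == k & #|P :&: D| == m]]| =
  'C(#|X :&: D|, m) * 'C(#|X :\: D|, k - m).
Proof.
move=> le_mk; rewrite -!cards_draws -cardsX.
set S := [set _ | _]; set R := setX _ _.
have inj : {in R &, injective (fun u : {set 'I_n} * {set 'I_n} => u.1 :|: u.2)}.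
  move=> [A B] [A' B']; rewrite !inE /= => /andP[/andP[sA _] /andP[sB _]].
  move=> /andP[/andP[sA' _] /andP[sB' _]] /= e.
  have split (U V : {set 'I_n}) : U \subset X :&: D -> V \subset X :\: D ->
      U = (U :|: V) :&: D /\ V = (U :|: V) :\: D.
    move=> /subsetP sU /subsetP sV; split; apply/setP=> x; rewrite !inE.
      case xU: (x \in U) => /=; first by have := sU x xU; rewrite !inE => /andP[_ ->].
      case xV: (x \in V) => //=; have := sV x xV; rewrite !inE.
      by case: (x \in D).
    case xU: (x \in U) => /=.
      have := sU x xU; rewrite !inE => /andP[_ xD]; rewrite xD /=.
      by apply/negP => /sV; rewrite !inE xD.
    case xV: (x \in V); rewrite ?andbF //=; have := sV x xV; rewrite !inE andbT.
    by case: (x \in D).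
  have [eA eB] := split _ _ sA sB; have [eA' eB'] := split _ _ sA' sB'.
  by congr (_, _); [rewrite eA eA' e | rewrite eB eB' e].
rewrite -(card_in_imset inj); apply: eq_card => P; rewrite [LHS]inE.
apply/idP/imsetP => [/and3P[sP /eqP cP /eqP cD]|[[A B]]].
  exists (P :&: D, P :\: D) => /=; last by rewrite setID.
  rewrite !inE /= setSI // cD eqxx setSD //=.
  by rewrite -cP -(cardsID D P) cD addKn.
rewrite !inE /= => /andP[/andP[sA /eqP cA] /andP[sB /eqP cB]] ->.
have dis : [disjoint A & B].
  rewrite -setI_eq0 -subset0; apply/subsetP => x; rewrite !inE => /andP[xA xB].
  have := subsetP sA x xA; have := subsetP sB x xB; rewrite !inE.
  by case: (x \in D); rewrite /= ?andbF.
have AD : (A :|: B) :&: D = A.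
  apply/setP => x; rewrite !inE; case xA: (x \in A) => /=.
    by have := subsetP sA x xA; rewrite !inE => /andP[].
  case xB: (x \in B) => //=; have := subsetP sB x xB; rewrite !inE.
  by case: (x \in D).
rewrite AD cA eqxx andbT subUset (subset_trans sA (subsetIl _ _)) (subset_trans sB (subsetDl _ _)) /=.
move: dis; rewrite -setI_eq0 -cards_eq0 => /eqP dis.
by rewrite cardsU dis subn0 cA cB subnKC.
Qed.

Lemma cardsD_swap X Y : #|X| = #|Y| -> #|X :\: Y| = #|Y :\: X|.
Proof.
move=> e; apply/eqP; rewrite -(eqn_add2l #|X :&: Y|) cardsID setIC cardsID.
by rewrite e.
Qed.

Lemma card_exchange X P Q : P \subset X -> Q \subset ~: X -> #|P| = #|Q| ->
  #|(X :\: P) :|: Q| = #|X|.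
Proof.
move=> sP sQ e; rewrite cardsU (_ : (X :\: P) :&: Q = set0) ?cards0 ?subn0.
  by rewrite -e -[in RHS](cardsID P X) addnC (setIidPr sP).
apply/setP => x; rewrite !inE; apply/negP => /andP[/andP[_ xX] xQ].
by have := subsetP sQ x xQ; rewrite inE xX.
Qed.

Lemma card_exchangeD X P Q Z : P \subset X -> Q \subset ~: X ->
  #|((X :\: P) :|: Q) :\: Z| + #|P :\: Z| = #|X :\: Z| + #|Q :\: Z|.
Proof.
move=> /subsetP sP /subsetP sQ.
have -> : ((X :\: P) :|: Q) :\: Z = ((X :\: Z) :\: (P :\: Z)) :|: (Q :\: Z).
  apply/setP => x; rewrite !inE; case: (x \in Z); rewrite ?andbF //=.
rewrite cardsU (_ : _ :&: _ = set0) ?cards0 ?subn0; last first.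
  apply/setP => x; rewrite !inE; apply/negP => /andP[/andP[_ /andP[_ xX]] /andP[_ xQ]].
  by have := sQ x xQ; rewrite inE xX.
rewrite addnAC; congr addn; rewrite -[in RHS](cardsID (P :\: Z) (X :\: Z)) addnC; congr addn.
apply: eq_card => x; rewrite !inE; case xP: (x \in P); rewrite ?andbF // (sP x xP).
by case: (x \in Z).
Qed.

Lemma exchangeK X P Q : P \subset X -> Q \subset ~: X ->
  X :\: ((X :\: P) :|: Q) = P /\ ((X :\: P) :|: Q) :\: X = Q.
Proof.
move=> /subsetP sP /subsetP sQ; split; apply/setP => x; rewrite !inE.
  case xQ: (x \in Q).
    have /negbTE nX : x \notin X by have := sQ x xQ; rewrite inE.
    by rewrite nX orbT /=; case xP: (x \in P) => //; rewrite (sP _ xP) in nX.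
  by case xP: (x \in P) => /=; [rewrite (sP x xP) | case: (x \in X)].
case xX: (x \in X); case xQ: (x \in Q); rewrite ?andbF ?orbT //=.
by have := sQ x xQ; rewrite inE xX.
Qed.

Lemma sum_sphere (R : Type) (idx : R) (op : Monoid.com_law idx) (w k : nat) X
    (F : {set 'I_n} -> R) : #|X| = w ->
  \big[op/idx]_(Y in johnson n w | #|X :\: Y| == k) F Y =
  \big[op/idx]_(P : {set 'I_n} | (P \subset X) && (#|P| == k))
    \big[op/idx]_(Q : {set 'I_n} | (Q \subset ~: X) && (#|Q| == k)) F ((X :\: P) :|: Q).
Proof.
move=> cX; rewrite pair_big_dep /=.
rewrite (reindex_onto (fun u : {set 'I_n} * {set 'I_n} => (X :\: u.1) :|: u.2)
          (fun Y => (X :\: Y, Y :\: X))) /=; last first.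
  move=> Y _; apply/setP => x; rewrite !inE.
  by case: (x \in X); case: (x \in Y).
apply: eq_bigl => -[P Q] /=; rewrite !inE xpair_eqE.
apply/idP/idP => [/andP[/andP[cY cP] /andP[/eqP eP /eqP eQ]]|].
  have sP : P \subset X by rewrite -eP subsetDl.
  have sQ : Q \subset ~: X by rewrite -eQ; apply/subsetP => x; rewrite !inE => /andP[].
  rewrite sP sQ /= -{1}eP cP /=.
  have -> : Q = ((X :\: P) :|: Q) :\: X by rewrite eQ.
  by rewrite -cardsD_swap // (eqP cY).
case/andP=> /andP[sP /eqP cP] /andP[sQ /eqP cQ].
have [-> ->] := exchangeK sP sQ.
by rewrite !eqxx cP card_exchange ?cP ?cQ // cX !eqxx.
Qed.

Lemma card_sphere w k X : #|X| = w ->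
  #|[set Y in johnson n w | #|X :\: Y| == k]| = 'C(w, k) * 'C(n - w, k).
Proof.
move=> cX; rewrite -sum1_card (eq_bigl (fun Y => (Y \in johnson n w) && (#|X :\: Y| == k))); last first.
  by move=> Y; rewrite inE.
rewrite sum_sphere // (eq_bigr (fun=> 'C(n - w, k))); last first.
  move=> P _; rewrite sum1_card -cardsE cards_draws cardsCs setCK card_ord.
  by rewrite cX.
rewrite big_const iter_addn_0 mulnC -cardsE.
by rewrite cards_draws cX.
Qed.

End Counting.

(** * Codes and their minimum distance *)

Lemma subset_of_card (T : finType) (A : {set T}) m : m <= #|A| ->
  exists2 B : {set T}, B \subset A & #|B| = m.
Proof.
rewrite -bin_gt0 -cards_draws => /card_gt0P[B]; rewrite inE => /andP[sB /eqP cB].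
by exists B.
Qed.

Section Local.
Variables n w e : nat.
Variable C : {set {set 'I_n}}.
Hypothesis codeC : code_axiom w e C.
Local Notation J := (johnson n w).
Implicit Types X Y P Q c : {set 'I_n}.

Lemma code_card c : c \in C -> #|c| = w.
Proof. by case: codeC => /subsetP sC _ /sC; rewrite inE => /eqP. Qed.

Lemma code_uniq Y c c' : Y \in J -> c \in C -> c' \in C ->
  #|Y :\: c| <= e -> #|Y :\: c'| <= e -> c = c'.
Proof.
move=> YJ cC cC' d d'; have [_ /(_ Y YJ) /eqP/cards1P[z ez]] := codeC.
have cY : #|Y| = w by move: YJ; rewrite inE => /eqP.
have : c \in [set z] by rewrite -ez inE cC cardsD_swap // (code_card cC).
have : c' \in [set z] by rewrite -ez inE cC' cardsD_swap // (code_card cC').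
by rewrite !inE => /eqP-> /eqP.
Qed.

(** Exchanging half of the points in which two codewords differ gives a vertex
    in the ball of the first; if they differ in at most 2e points, it also lies
    in the ball of the second. *)
Lemma code_dist c c' : c \in C -> c' \in C -> c != c' -> 2 * e < #|c :\: c'|.
Proof.
move=> cC cC' ne; rewrite ltnNge; apply/negP => led; case/eqP: ne.
have cc : #|c| = #|c'| by rewrite (code_card cC) (code_card cC').
have cs := cardsD_swap cc.
have [P sP cP] : exists2 P : {set 'I_n}, P \subset c :\: c' & #|P| = uphalf #|c :\: c'|.
  by apply: subset_of_card; lia.
have [Q sQ cQ] : exists2 P : {set 'I_n}, P \subset c' :\: c & #|P| = uphalf #|c :\: c'|.
  by apply: subset_of_card; rewrite -cs; lia.
have sP' : P \subset c by apply: subset_trans sP (subsetDl _ _).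
have sQ' : Q \subset ~: c by apply: subset_trans sQ _; rewrite setDE subsetIr.
have QD : #|Q :\: c| = #|Q|.
  by apply: eq_card => x; rewrite !inE; case xQ: (x \in Q); rewrite ?andbF // andbT; have := subsetP sQ' x xQ; rewrite inE.
have PD : #|P :\: c'| = #|P|.
  apply: eq_card => x; rewrite !inE; case xP: (x \in P); rewrite ?andbF // andbT.
  by have := subsetP sP x xP; rewrite inE => /andP[].
have PD0 : #|P :\: c| = 0 by apply/eqP; rewrite cards_eq0 setD_eq0.
have QD0 : #|Q :\: c'| = 0.
  by apply/eqP; rewrite cards_eq0 setD_eq0; apply: subset_trans sQ (subsetDl _ _).
have e1 := card_exchangeD c sP' sQ'; have e2 := card_exchangeD c' sP' sQ'.
rewrite setDv cards0 PD0 QD cQ in e1; rewrite PD QD0 cP in e2.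
have YJ : (c :\: P) :|: Q \in J by rewrite inE card_exchange ?cP ?cQ // (code_card cC).
by apply: (code_uniq YJ) => //; move: e1 e2 led; lia.
Qed.

(** Given X and a k-set Q outside X, the sets P for which the codeword c covers
    the vertex (X :\: P) :|: Q. *)
Definition covered X Q k c : {set {set 'I_n}} :=
  [set P : {set 'I_n} | [&& P \subset X, #|P| == k & #|X :\: c| + #|Q :\: c| <= e + #|P :\: c|]].

(** Each of the 'C(w, k) vertices obtained from X by trading a k-subset for Q is
    covered exactly once; the local counts below evaluate the right-hand side. *)
Lemma cover_count X Q k : X \in J -> Q \subset ~: X -> #|Q| = k ->
  'C(w, k) = \sum_(c in C) #|covered X Q k c|.
Proof.
move=> XJ sQ cQ; have cX : #|X| = w by move: XJ; rewrite inE => /eqP.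
transitivity (\sum_(P : {set 'I_n} | (P \subset X) && (#|P| == k)) 1).
  by rewrite sum1_card -cardsE cards_draws cX.
rewrite (eq_bigr (fun P => \sum_(c in C | #|X :\: c| + #|Q :\: c| <= e + #|P :\: c|) 1)).
  rewrite (exchange_big_dep (mem C)) /=; last by move=> P c _ /andP[].
  apply: eq_bigr => c cC; rewrite sum1_card -cardsE; apply: eq_card => P.
  by rewrite !inE cC /= andbA.
move=> P /andP[sP /eqP cP]; rewrite sum1_card -cardsE.
have YJ : (X :\: P) :|: Q \in J by rewrite inE card_exchange ?cP ?cQ ?cX.
have [_ /(_ _ YJ) <-] := codeC; apply: eq_card => c; rewrite !inE.
rewrite [in RHS]unfold_in /=; case cC: (c \in C) => //=.
have cY : #|(X :\: P) :|: Q| = #|c| by rewrite card_exchange ?cP ?cQ // cX (code_card cC).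
by rewrite -(cardsD_swap cY) -[LHS](leq_add2r #|P :\: c|) card_exchangeD.
Qed.

Lemma covered_full X Q k c : #|X :\: c| + #|Q :\: c| = e + k ->
  #|covered X Q k c| = 'C(#|X :\: c|, k).
Proof.
move=> e1; have := @card_draws_meet n X (~: c) k k (leqnn k).
rewrite subnn bin0 muln1 -setDE => <-; apply: eq_card => P; rewrite !inE e1 leq_add2l -setDE.
have [<-|_] := eqVneq #|P| k; rewrite ?andbF //=.
by rewrite eqn_leq (subset_leq_card (subsetDl P c)).
Qed.

Lemma covered_none X Q k c : e + k < #|X :\: c| + #|Q :\: c| -> #|covered X Q k c| = 0.
Proof.
move=> lt; apply: eq_card0 => P; rewrite !inE; apply/negP => /and3P[_ /eqP cP le].
by have := subset_leq_card (subsetDl P c); lia.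
Qed.

(** Here P is admissible exactly when it is not contained in c. *)
Lemma covered_one X Q k c : #|X :\: c| + #|Q :\: c| = e + 1 ->
  #|covered X Q k c| + 'C(#|X :&: c|, k) = 'C(#|X|, k).
Proof.
move=> e1; have := @card_draws_meet n X (~: c) k 0 isT.
rewrite bin0 mul1n subn0 [X :\: ~: c]setDE setCK => <-.
rewrite -cards_draws -[RHS](cardsID [set P : {set 'I_n} | #|P :\: c| != 0]); congr addn.
  by apply: eq_card => P; rewrite !inE e1 leq_add2l lt0n !andbA.
by apply: eq_card => P; rewrite !inE negbK -setDE; case: (#|P :\: c| == 0); rewrite ?andbF ?andbT.
Qed.

(** The codewords that cover some of the vertices (X :\: P) :|: Q with #|Q| = k
    although they are too far from X by exactly k. *)
Definition nearby X k Q : {set {set 'I_n}} := [set c in C | (#|X :\: c| == e + k) && (Q \subset c)].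

Lemma code_dist_vertex c0 c X : c0 \in C -> c \in C -> c != c0 -> X \in J ->
  2 * e < #|X :\: c0| + #|X :\: c|.
Proof.
move=> cC0 cC ne XJ; apply: leq_trans (code_dist cC cC0 ne) _.
have cX : #|X| = w by move: XJ; rewrite inE => /eqP.
have cXc : #|X| = #|c| by rewrite cX (code_card cC).
rewrite (cardsD_swap cXc) addnC.
apply: leq_trans (leq_card_setU _ _); apply: subset_leq_card; apply/subsetP => x.
by rewrite !inE; case: (x \in X); case: (x \in c); case: (x \in c0).
Qed.

(** If X lies at distance e + 1 - k from c0, then c0 covers the exchanges whose P
    meets X :\: c0. Each of the others has a codeword c at distance e + k that
    contains Q, with P inside X :\: c: these codewords share the exchanges out
    in equal parts. *)
Lemma nearby_count k c0 X Q : e < w -> c0 \in C -> X \in J -> 0 < k -> #|X :\: c0| + k = e + 1 ->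
  #|Q| = k -> Q \subset ~: (X :|: c0) ->
  'C(w - e - 1 + k, k) = #|nearby X k Q| * 'C(e + k, k).
Proof.
move=> ew cC0 XJ k0 dX cQ sQ; have cX : #|X| = w by move: XJ; rewrite inE => /eqP.
have sQX : Q \subset ~: X by apply: subset_trans sQ _; rewrite setCS subsetUl.
have Qc0 : #|Q :\: c0| = k.
  rewrite -cQ; apply: eq_card => x; rewrite inE; case xQ: (x \in Q); rewrite ?andbF // andbT.
  by have := subsetP sQ x xQ; rewrite !inE negb_or => /andP[].
have := cover_count XJ sQX cQ; rewrite (bigD1 c0) //=.
have := @covered_one X Q k c0; rewrite Qc0 dX cX => /(_ erefl).
have -> : #|X :&: c0| = w - e - 1 + k by have := cardsID c0 X; rewrite cX; lia.
suff -> : \sum_(c in C | c != c0) #|covered X Q k c| = #|nearby X k Q| * 'C(e + k, k).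
  by move=> h1 h2; apply/eqP; rewrite -(eqn_add2l #|covered X Q k c0|) h1 h2.
rewrite -sum1_card big_distrl /= [RHS]big_mkcond [LHS]big_mkcond; apply: eq_bigr => c _.
rewrite !inE; case cC: (c \in C) => //=; have [->|ne] := eqVneq c c0.
  by have -> : (#|X :\: c0| == e + k) = false by apply/eqP; move: dX k0; lia.
have dc := code_dist_vertex cC0 cC ne XJ.
rewrite -setD_eq0 -cards_eq0; have [e1|ne1] := eqVneq #|X :\: c| (e + k).
  have [e2|ne2] := eqVneq #|Q :\: c| 0; first by rewrite /= mul1n covered_full ?e2 ?addn0 // e1.
  by rewrite /= covered_none // e1; lia.
by rewrite /= covered_none //; move/eqP: ne1; lia.
Qed.

Lemma vertex_at c0 d : c0 \in C -> d <= w -> d <= n - w ->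
  exists2 X, X \in J & #|X :\: c0| = d /\ #|c0 :\: X| = d.
Proof.
move=> cC0 dw db; have cc := code_card cC0.
have [P sP cP] : exists2 P : {set 'I_n}, P \subset c0 & #|P| = d.
  by apply: subset_of_card; rewrite cc.
have [Q sQ cQ] : exists2 Q : {set 'I_n}, Q \subset ~: c0 & #|Q| = d.
  by apply: subset_of_card; have := cardsC c0; rewrite cc card_ord; lia.
have [e1 e2] := exchangeK sP sQ; exists ((c0 :\: P) :|: Q); last by rewrite e1 e2.
by rewrite inE card_exchange ?cP ?cQ ?cc.
Qed.

Lemma card_outside c0 X : c0 \in C -> X \in J -> #|~: (X :|: c0)| = n - w - #|X :\: c0|.
Proof.
move=> cC0 XJ; have cX : #|X| = w by move: XJ; rewrite inE => /eqP.
have := cardsC (X :|: c0); have := cardsUI X c0; have := cardsID c0 X.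
by rewrite (code_card cC0) cX card_ord; lia.
Qed.

Lemma code_nonempty : w <= n -> exists c0, c0 \in C.
Proof.
move=> wn; have [X _ cX] : exists2 X : {set 'I_n}, X \subset setT & #|X| = w.
  by apply: subset_of_card; rewrite cardsT card_ord.
have [_ /(_ X)] := codeC; rewrite inE cX eqxx => /(_ isT) /eqP /cards1P[c ec].
by exists c; have := set11 c; rewrite -ec inE => /andP[].
Qed.

Lemma local_dvd k : e < w -> e < n - w -> 0 < k <= e + 1 ->
  'C(e + k, k) %| 'C(w - e - 1 + k, k).
Proof.
move=> ew eb /andP[k0 ke].
have [c0 cC0] : exists c0, c0 \in C by apply: code_nonempty; lia.
have [X XJ [dX _]] : exists2 X, X \in J & #|X :\: c0| = e + 1 - k /\ #|c0 :\: X| = e + 1 - k.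
  by apply: vertex_at => //; lia.
have [Q sQ cQ] : exists2 Q : {set 'I_n}, Q \subset ~: (X :|: c0) & #|Q| = k.
  by apply: subset_of_card; rewrite card_outside // dX; lia.
rewrite (@nearby_count k c0 X Q) //; first exact: dvdn_mull.
by rewrite dX; lia.
Qed.

Lemma local_dvd1 : e < w -> e < n - w -> e + 1 %| w - e.
Proof.
move=> ew eb; have := @local_dvd 1 ew eb; rewrite !bin1 addn1 subnAC => h.
by have := h isT; congr (_ %| _); lia.
Qed.

End Local.

Lemma perfect_code_axiom n w e (C : {set {set 'I_n}}) : perfect_code w e C -> code_axiom w e C.
Proof.
case=> sC inj /and3P[/eqP cov /trivIsetP triv _]; split=> // Y YJ.
have inb c : (Y \in jball w e c) = (#|c :\: Y| <= e) by rewrite inE YJ.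
have : Y \in cover [set jball w e X | X in C] by rewrite cov.
case/bigcupP => _ /imsetP[c cC ->]; rewrite inb => cY.
apply/eqP/cards1P; exists c; apply/setP => c'; rewrite !inE.
apply/andP/eqP => [[c'C c'Y]|->] //; apply: inj => //; apply/eqP/negPn/negP => ne.
have := triv _ _ (imset_f (jball w e) c'C) (imset_f (jball w e) cC) ne.
by move/disjointFr => /(_ Y); rewrite !inb c'Y cY => /(_ isT).
Qed.

(** No two vertices are further apart than w or n - w, so the whole space is one
    ball as soon as e reaches one of them. *)
Lemma code_card1 n w e (C : {set {set 'I_n}}) : code_axiom w e C -> w <= n ->
  (w <= e) || (n - w <= e) -> #|C| = 1.
Proof.
move=> codeC wn small; have [c0 cC0] := code_nonempty codeC wn.
apply/eqP/cards1P; exists c0; apply/setP => c; rewrite inE.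
apply/idP/eqP => [cC|-> //]; have [sC _] := codeC.
apply: (code_uniq codeC (subsetP sC _ cC)) => //; first by rewrite setDv cards0.
have h1 := subset_leq_card (subsetDl c c0); rewrite (code_card codeC cC) in h1.
have h2 : #|c :\: c0| <= #|~: c0| by apply: subset_leq_card; rewrite setDE subsetIr.
have := cardsC c0; rewrite (code_card codeC cC0) card_ord => h3.
by clear -h1 h2 h3 small; lia.
Qed.


(** * Counting exchanges of one and of two points *)

Lemma sum_mem (T : finType) (A C : {set T}) x : A \subset C ->
  \sum_(c in C) (c \in A) * x = #|A| * x.
Proof.
move=> sA; rewrite -big_distrl /= -big_mkcondr /= sum1_card; congr (_ * _).
by rewrite -{2}(setIidPr sA); apply: eq_card => c; rewrite inE.
Qed.

Section Pairs.
Variables n w e : nat.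
Variable C : {set {set 'I_n}}.
Hypothesis codeC : code_axiom w e C.
Hypothesis ew : e < w.
Hypothesis eb : e < n - w.
Local Notation J := (johnson n w).
Implicit Types X Y P Q c : {set 'I_n}.
Local Notation nearby := (nearby e C).
Variables (c0 X : {set 'I_n}).
Hypotheses (cC0 : c0 \in C) (XJ : X \in J) (dX : #|X :\: c0| = e).
Let K := (w - e) %/ (e + 1).

Lemma card_X : #|X| = w. Proof. by move: XJ; rewrite inE => /eqP. Qed.

Lemma KE : w - e = K * (e + 1).
Proof. by rewrite divnK // (local_dvd1 codeC). Qed.

Lemma nearby_sub k Q : nearby X k Q \subset C.
Proof. by apply/subsetP => X' /setIdP[]. Qed.

Lemma card_nearby1 y : y \notin X :|: c0 -> #|nearby X 1 [set y]| = K.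
Proof.
move=> ny; have := @nearby_count n w e C codeC 1 c0 X [set y] ew cC0 XJ isT.
rewrite dX cards1 sub1set inE => /(_ erefl erefl ny); rewrite !bin1 subnK; last by lia.
by rewrite KE => /eqP; rewrite eqn_pmul2r ?addn1 // => /eqP.
Qed.

(** Two codewords near X that share two points outside X are at distance at most
    (e + 1) + (e - 1) = 2e, hence equal. *)
Lemma pair_nearby y y' c c' : y \notin X :|: c0 -> y' \notin X :|: c0 -> y != y' ->
  c \in nearby X 1 [set y; y'] -> c' \in nearby X 1 [set y; y'] -> c = c'.
Proof.
move=> ny ny' ne /setIdP[cC /andP[/eqP dc sc]] /setIdP[cC' /andP[/eqP dc' sc']].
apply/eqP/negPn/negP => nec; have := code_dist codeC cC cC' nec.
have yX : [set y; y'] \subset c :\: X.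
  apply/subsetP => x xq; rewrite inE (subsetP sc x xq) andbT.
  move: xq; rewrite in_set2; case/orP => /eqP ->.
    by move: ny; rewrite inE negb_or => /andP[].
  by move: ny'; rewrite inE negb_or => /andP[].
have ccX : #|X| = #|c| by rewrite card_X (code_card codeC cC).
have dcX := cardsD_swap ccX.
have := cardsID [set y; y'] (c :\: X); rewrite (setIidPr yX) cards2 ne -dcX dc.
have := leq_card_setU (X :\: c') ((c :\: X) :\: [set y; y']); rewrite dc'.
suff /subset_leq_card : c :\: c' \subset (X :\: c') :|: ((c :\: X) :\: [set y; y']).
  by rewrite /= => h1 [h2 _] h3 h4; clear -h1 h2 h3 h4; lia.
apply/subsetP => x; rewrite !inE => /andP[nx xc]; rewrite nx xc.
case xX: (x \in X) => //=; rewrite andbT -in_set2; apply: contra nx; exact: (subsetP sc').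
Qed.

(** The count of [cover_count] for k = 2. Up to multiples of
    'C(e + 2, 2) it depends on y and y' only through the number mu of codewords near X that
    contain both; mu is 0 or 1, and each value gives a divisibility by e + 2. *)
Lemma pair_count y y' : y \notin X :|: c0 -> y' \notin X :|: c0 -> y != y' ->
  let mu := #|nearby X 1 [set y; y']| in
  exists nu, 2 * K = nu + 2 * mu /\
  'C(w, 2) + mu * 'C(w - e - 1, 2) = 'C(e, 2) + mu * 'C(w, 2) + nu * 'C(e + 1, 2)
     + #|nearby X 2 [set y; y']| * 'C(e + 2, 2).
Proof.
move=> ny ny' ne mu; set Q := [set y; y'].
have cQ : #|Q| = 2 by rewrite cards2 ne.
have sQ : Q \subset ~: (X :|: c0).
  by apply/subsetP => x; rewrite in_set2 in_setC => /orP[] /eqP ->.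
have sQX : Q \subset ~: X by apply: subset_trans sQ _; rewrite setCS subsetUl.
pose A := nearby X 1 [set y]; pose B := nearby X 1 [set y'].
pose D := (A :\: B) :|: (B :\: A).
have AB : nearby X 1 Q = A :&: B.
  apply/setP => c; rewrite !inE subUset !sub1set.
  by case: (c \in C); case: (_ == _); rewrite ?andbF.
have sD : D \subset C.
  by rewrite subUset !(subset_trans (subsetDl _ _)) ?nearby_sub.
exists #|D|; split.
  rewrite /mu AB; have := card_nearby1 ny; have := card_nearby1 ny'.
  have := cardsID B A; have := cardsID A B; rewrite [B :&: A]setIC.
  have : #|D| = #|A :\: B| + #|B :\: A|.
    rewrite cardsU (_ : _ :&: _ = set0) ?cards0 ?subn0 //.
    by apply/setP => c; rewrite in_setI !in_setD in_set0; case: (c \in A); case: (c \in B).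
  rewrite -/A -/B => h1 h2 h3 h4 h5; clear -h1 h2 h3 h4 h5; lia.
have cQc c : #|Q :\: c| = (y \notin c) + (y' \notin c).
  rewrite -sum1_card (eq_bigl (fun x => (x \in Q) && (x \notin c))) => [|x]; last by rewrite inE andbC.
  rewrite big_mkcondr /= big_setU1 ?inE //= big_set1.
  by case: (y \in c); case: (y' \in c).
have := cover_count codeC XJ sQX cQ => eqC.
rewrite {1}eqC /mu -(sum_mem _ (nearby_sub 1 Q)) -(sum_mem _ (nearby_sub 1 Q)).
rewrite -(sum_mem _ sD) -(sum_mem _ (nearby_sub 2 Q)) -big_split /=.
have <- : \sum_(c in C) (c == c0) * 'C(e, 2) = 'C(e, 2).
  rewrite (bigD1 c0) //= eqxx mul1n big1 ?addn0 // => c /andP[_ /negPf ->] //.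
rewrite -!big_split /=; apply: eq_bigr => c cC.
have [->|nec] := eqVneq c c0.
  have yc0 : y \notin c0 by move: ny; rewrite !inE negb_or => /andP[].
  have yc0' : y' \notin c0 by move: ny'; rewrite !inE negb_or => /andP[].
  rewrite covered_full; last by rewrite dX cQc yc0 yc0'.
  by rewrite /D /A /B !inE dX /Q !subUset !sub1set (negPf yc0) (negPf yc0') !andbF /= /= ?mul0n ?mul1n ?addn0.
rewrite mul0n add0n.
have dc := code_dist_vertex codeC cC0 cC nec XJ; rewrite dX in dc.
have cQ' := cQc c.
rewrite /D /A /B !inE cC /= /Q !subUset !sub1set -/Q.
have [e1|n1] := eqVneq #|X :\: c| (e + 1).
  have -> : (#|X :\: c| == e + 2) = false by rewrite e1 eqn_add2l.
  have XIc : #|X :&: c| = w - e - 1 by have := cardsID c X; rewrite card_X e1 => <-; rewrite -subnDA addnK.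
  case yc: (y \in c) cQ'; case yc': (y' \in c) => /= cQ'.
  - have := @covered_one n e X Q 2 c; rewrite e1 cQ' XIc card_X !addn0 => /(_ erefl) /=; by rewrite ?mul0n ?mul1n ?addn0.
  - have tot : #|X :\: c| + #|Q :\: c| = e + 2 by rewrite e1 cQ' -addnA.
    by rewrite (covered_full tot) e1 /= ?mul0n ?mul1n ?addn0.
  - have tot : #|X :\: c| + #|Q :\: c| = e + 2 by rewrite e1 cQ' -addnA.
    by rewrite (covered_full tot) e1 /= ?mul0n ?mul1n ?addn0.
  - by rewrite covered_none ?cQ' ?e1 ?mul0n // -addnA ltn_add2l.
rewrite /=; have [e2|n2] := eqVneq #|X :\: c| (e + 2).
  case yc: (y \in c) cQ'; case yc': (y' \in c) => /= cQ'; last 3 first.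
  - by rewrite covered_none ?cQ' ?e2 ?mul0n // -addnA ltn_add2l.
  - by rewrite covered_none ?cQ' ?e2 ?mul0n // -addnA ltn_add2l.
  - by rewrite covered_none ?cQ' ?e2 ?mul0n // -addnA ltn_add2l.
  by rewrite covered_full ?cQ' ?e2 ?addn0 //= ?mul0n ?mul1n.
have lt : e + 2 < #|X :\: c| + #|Q :\: c|.
  by move/eqP: n1; move/eqP: n2; move: dc => h1 h2 h3; clear -h1 h2 h3; lia.
by rewrite (covered_none lt) /= ?mul0n.
Qed.
End Pairs.

Lemma double_bin2 m : 2 * 'C(m.+1, 2) = m.+1 * m.
Proof. by rewrite mulnC -[2]/(2`!) bin_ffact ffactnS ffactn1. Qed.

(** After division by e + 1 the identity reads L (L (e + 1) - 1) = N (e + 2), and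
    e + 1 = -1 modulo e + 2. *)
Lemma pair_dvd e L N : 0 < e ->
  'C(e + L * (e + 1), 2) = 'C(e, 2) + 2 * L * 'C(e + 1, 2) + N * 'C(e + 2, 2) -> e + 2 %| L * (L + 1).
Proof.
case: e => // e _ h.
have h1 := double_bin2 (e + L * (e.+1 + 1)); have h2 := double_bin2 e.
have h3 := double_bin2 e.+1; have h4 := double_bin2 e.+2.
rewrite -addSn in h1; rewrite !addn1 !addn2 in h h1 *.
have hh : (e.+1 + L * e.+2) * (e + L * e.+2) = e.+1 * e + L * (2 * (e.+2 * e.+1)) + N * (e.+3 * e.+2).
  rewrite -h1 -h2 -h3 -h4 h; clear; move: 'C(_, _) 'C(_, _) 'C(_, _) => x y z; lia.
clear h h1 h2 h3 h4.
have {}hh : N * e.+3 + L * L.+1 = L * L * e.+3.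
  by apply/eqP; rewrite -(@eqn_pmul2l e.+2) //; apply/eqP; lia.
by rewrite -(@dvdn_addr (N * e.+3)) ?dvdn_mull // hh dvdn_mull.
Qed.

Section Consequences.
Variables n w e : nat.
Variable C : {set {set 'I_n}}.
Hypothesis codeC : code_axiom w e C.
Hypothesis e0 : 0 < e.
Hypothesis ew : e < w.
Hypothesis eb : e < n - w.
Local Notation J := (johnson n w).
Local Notation nearby := (nearby e C).
Let K := (w - e) %/ (e + 1).

Lemma K_gt0 : 0 < K.
Proof. by rewrite divn_gt0 ?addn1 // dvdn_leq ?subn_gt0 // -addn1 (local_dvd1 codeC). Qed.

Lemma base_vertex : exists c0 X,
  [/\ c0 \in C, X \in J, #|X :\: c0| = e & exists y, y \notin X :|: c0].
Proof.
have [c0 cC0] : exists c0, c0 \in C by apply: (code_nonempty codeC); lia.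
have [X XJ [dX _]] : exists2 X, X \in J & #|X :\: c0| = e /\ #|c0 :\: X| = e.
  by apply: (vertex_at codeC cC0); lia.
exists c0, X; split => //.
have : 0 < #|~: (X :|: c0)| by rewrite (card_outside codeC cC0 XJ) dX subn_gt0.
by case/card_gt0P => y; rewrite inE; exists y.
Qed.

(** A codeword near X through y is disjoint from c0 outside X, since otherwise it
    would be closer than 2e + 1 to c0. *)
Lemma nearby_outside c0 X y c : c0 \in C -> X \in J -> #|X :\: c0| = e -> y \notin X :|: c0 ->
  c \in nearby X 1 [set y] -> [/\ #|c :\: X| = e + 1, y \in c :\: X & [disjoint c :\: X & X :|: c0]].
Proof.
move=> cC0 XJ dX ny cN; have /setIdP[cC /andP[/eqP dc]] := cN; rewrite sub1set => yc.
have cX : #|X| = w by move: XJ; rewrite inE => /eqP.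
have ccX : #|X| = #|c| by rewrite cX (code_card codeC cC).
have dcX : #|c :\: X| = e + 1 by rewrite -(cardsD_swap ccX).
have nec : c != c0.
  by apply: contraNneq ny => <-; rewrite inE yc orbT.
split=> //; first by rewrite inE yc andbT; move: ny; rewrite inE negb_or => /andP[].
have := code_dist codeC cC cC0 nec.
have s1 : c :\: c0 \subset (X :\: c0) :|: ((c :\: X) :\: c0).
  by apply/subsetP => x; rewrite !inE; case: (x \in X); case: (x \in c); case: (x \in c0).
have := subset_leq_card s1; have [+ _] := leq_card_setU (X :\: c0) ((c :\: X) :\: c0).
have := cardsID c0 (c :\: X); rewrite dX dcX => h1 h2 h3 h4.
have : #|(c :\: X) :&: c0| == 0 by apply/eqP; clear -h1 h2 h3 h4; lia.
rewrite cards_eq0 setI_eq0 => d0; rewrite -setI_eq0; apply/eqP/setP => x; rewrite in_setI in_setU in_set0.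
have := disjointFr d0 (x := x); case xc: (x \in c :\: X) => //= /(_ isT) ->; rewrite orbF.
by move: xc; rewrite inE => /andP[/negPf ->].
Qed.

(** The value mu = 1 is reached by two points of a single codeword near X; the
    identity of [pair_count] then has the shape of [pair_dvd] with K - 1 for K. *)
Lemma pair_one_dvd : e + 2 %| K * (K - 1).
Proof.
have [c0 [X [cC0 XJ dX [y ny]]]] := base_vertex.
have : 0 < #|nearby X 1 [set y]| by rewrite (card_nearby1 codeC ew eb cC0 XJ dX ny) K_gt0.
case/card_gt0P => c cN; have [dc yc dis] := nearby_outside cC0 XJ dX ny cN.
have : 0 < #|(c :\: X) :\ y| by have := cardsD1 y (c :\: X); rewrite yc dc; lia.
case/card_gt0P => y'; rewrite in_setD1 => /andP[ney y'c].
have ny' : y' \notin X :|: c0 by rewrite (disjointFr dis).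
have ne : y != y' by rewrite eq_sym.
have mu1 : #|nearby X 1 [set y; y']| = 1.
  apply/eqP; rewrite eqn_leq; apply/andP; split.
    rewrite leqNgt; apply/negP => /card_gt1P[c1 [c2 [i1 i2]]] /eqP; apply.
    exact: (pair_nearby codeC XJ ny ny' ne i1 i2).
  apply/card_gt0P; exists c; move: cN; rewrite !inE subUset !sub1set => /and3P[-> -> ->] /=.
  by move: y'c; rewrite inE => /andP[].
have [nu []] := pair_count codeC ew eb cC0 XJ dX ny ny' ne.
rewrite mu1 -/K !mul1n => e1 e2; have K0 := K_gt0.
have eL := KE codeC ew eb; rewrite -/K in eL.
have [L LK] : exists L, K = L.+1 by exists K.-1; rewrite prednK.
rewrite LK subn1 /= mulnC -[L.+1]addn1.
apply: (@pair_dvd e L #|nearby X 2 [set y; y']|) => //.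
have -> : e + L * (e + 1) = w - e - 1 by clear -eL LK; lia.
have ? : nu = 2 * L by clear -e1 LK; lia.
subst nu; clear -e2; lia.
Qed.

(** Each of the K codewords near X through y contains e further points outside X,
    none of which lies in two of these codewords. *)
Lemma nearby_count_outside c0 X y : c0 \in C -> X \in J -> #|X :\: c0| = e -> y \notin X :|: c0 ->
  K * e = \sum_(x in ~: (X :|: c0) :\ y) #|nearby X 1 [set y; x]|.
Proof.
move=> cC0 XJ dX ny.
rewrite /K -(card_nearby1 codeC ew eb cC0 XJ dX ny) -sum_nat_const.
transitivity (\sum_(c in nearby X 1 [set y]) \sum_(x in ~: (X :|: c0) :\ y | x \in c) 1).
  apply: eq_bigr => c cN; have [dc yc dis] := nearby_outside cC0 XJ dX ny cN.
  rewrite sum1_card -cardsE; have := cardsD1 y (c :\: X); rewrite yc dc addnC => /addnI ->.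
  apply: eq_card => x; have dx := disjointFr dis (x := x).
  rewrite [RHS]in_set -[RHS]/((x \in ~: (X :|: c0) :\ y) && (x \in c)) !inE; move: dx; rewrite !inE.
  case: (x == y); case: (x \in c); case: (x \in X); case: (x \in c0) => //=.
  by move/(_ isT).
rewrite (exchange_big_dep (mem (~: (X :|: c0) :\ y))) /=; last by move=> c x _ /andP[].
apply: eq_bigr => x xS; rewrite sum1_card -cardsE; apply: eq_card => c.
by rewrite [LHS]in_set -[LHS]/([&& c \in nearby X 1 [set y], x \in ~: (X :|: c0) :\ y & x \in c]) xS !inE subUset !sub1set -!andbA.
Qed.

Lemma nearby_le1 c0 X y x : c0 \in C -> X \in J -> #|X :\: c0| = e -> y \notin X :|: c0 ->
  x \in ~: (X :|: c0) :\ y -> #|nearby X 1 [set y; x]| <= 1.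
Proof.
move=> cC0 XJ dX ny; rewrite in_setD1 in_setC eq_sym => /andP[ne nx].
rewrite leqNgt; apply/negP => /card_gt1P[c1 [c2 [i1 i2]]] /eqP; apply.
exact: (pair_nearby codeC XJ ny nx ne i1 i2).
Qed.

Lemma card_outside1 c0 X y : c0 \in C -> X \in J -> #|X :\: c0| = e -> y \notin X :|: c0 ->
  #|~: (X :|: c0) :\ y| = n - w - e - 1.
Proof.
move=> cC0 XJ dX ny; have := cardsD1 y (~: (X :|: c0)).
by rewrite in_setC ny (card_outside codeC cC0 XJ) dX => ->; rewrite add1n subn1.
Qed.

Lemma roos_bound : K * e <= n - w - e - 1.
Proof.
have [c0 [X [cC0 XJ dX [y ny]]]] := base_vertex.
rewrite (nearby_count_outside cC0 XJ dX ny) -(card_outside1 cC0 XJ dX ny) -sum1_card.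
by apply: leq_sum => x xS; apply: (nearby_le1 cC0 XJ dX ny xS).
Qed.

(** When the K codewords near X through y leave a point of the outside free, that
    point realises mu = 0. *)
Lemma pair_zero_dvd : K * e < n - w - e - 1 -> e + 2 %| K * (K + 1).
Proof.
have [c0 [X [cC0 XJ dX [y ny]]]] := base_vertex.
rewrite (nearby_count_outside cC0 XJ dX ny) -(card_outside1 cC0 XJ dX ny) => lt.
have [x xS /eqP x0] : exists2 x, x \in ~: (X :|: c0) :\ y & #|nearby X 1 [set y; x]| == 0.
  apply/exists_inP; move: lt; apply: contraTT; rewrite negb_exists_in -leqNgt => /forall_inP h.
  by rewrite -sum1_card; apply: leq_sum => x xS; rewrite lt0n; apply: contra (h x xS).
move: xS; rewrite in_setD1 in_setC eq_sym => /andP[ne nx].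
have [nu []] := pair_count codeC ew eb cC0 XJ dX ny nx ne.
rewrite x0 -/K !mul0n !addn0 => <- e2.
apply: (@pair_dvd e K #|nearby X 2 [set y; x]|) => //.
by rewrite -(KE codeC ew eb) subnKC // ltnW.
Qed.

(** With w = 2e + 1 the minimum distance makes distinct codewords disjoint, and
    a second codeword exists near X. *)
Lemma code_antipodal : w = 2 * e + 1 -> n = 2 * w ->
  exists2 X : {set 'I_n}, X \in J & C = [set X; ~: X].
Proof.
move=> wE nE; have [c0 [X [cC0 XJ dX [y ny]]]] := base_vertex.
have /card_gt0P[c /setIdP[cC /andP[_ yc]]] : 0 < #|nearby X 1 [set y]|.
  by rewrite (card_nearby1 codeC ew eb cC0 XJ dX ny) K_gt0.
have nec : c != c0.
  by rewrite sub1set in yc; apply: contraNneq ny => <-; rewrite inE yc orbT.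
have opp c' : c' \in C -> c' != c0 -> c' = ~: c0.
  move=> cC' ne; have := code_dist codeC cC' cC0 ne.
  have := cardsID c0 c'; rewrite (code_card codeC cC') wE => h1 h2.
  have d0 : #|c' :&: c0| == 0 by apply/eqP; clear -h1 h2; lia.
  apply/eqP; rewrite eqEcard -disjoints_subset -setI_eq0 -cards_eq0 d0 /=.
  have := cardsC c0; rewrite card_ord (code_card codeC cC0) (code_card codeC cC') => h.
  by rewrite -(leq_add2l w) h [leqLHS]nE mul2n addnn.
exists c0; first by rewrite inE (code_card codeC cC0).
apply/setP => c'; rewrite in_set2; apply/idP/idP.
  by move=> cC'; have [//|ne] := eqVneq c' c0; rewrite (opp c' cC' ne) eqxx.
by case/orP => /eqP -> //; rewrite -(opp c cC nec).
Qed.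

End Consequences.

(** * Binomial coefficients and carries *)

Lemma logn_fact_wide p n N : prime p -> n <= N -> logn p n`! = \sum_(1 <= k < N.+1) n %/ p ^ k.
Proof.
move=> pp nN; rewrite logn_fact // [RHS](big_cat_nat (n := n.+1)) //=.
suff -> : \sum_(n.+1 <= k < N.+1) n %/ p ^ k = 0 by rewrite addn0.
rewrite big_nat_cond big1 // => k; rewrite andbT => /andP[nk _].
by rewrite divn_small // (leq_trans nk) // ltnW // ltn_expl // prime_gt1.
Qed.

(** For k <= B the multiple u of p ^ k creates no carry, for k = B + 1 there is at
    most one, and for larger k the powers p ^ k exceed T. *)
Lemma logn_bin_carry p B u T : prime p -> p ^ B %| u -> u <= T -> T < p ^ B.+2 ->
  logn p 'C(T, u) <= (p ^ B.+1 <= T).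
Proof.
move=> pp du uT TB; have p1 := prime_gt1 pp.
have : logn p T`! = logn p 'C(T, u) + (logn p u`! + logn p (T - u)`!).
  by rewrite -(bin_fact uT) !lognM ?muln_gt0 ?fact_gt0 ?bin_gt0.
rewrite (logn_fact_wide pp (leqnn T)) (logn_fact_wide pp uT) (logn_fact_wide pp (leq_subr u T)).
rewrite -big_split /= => eq1.
rewrite -(leq_add2r (\sum_(1 <= k < T.+1) (u %/ p ^ k + (T - u) %/ p ^ k))) -eq1.
have le1 : \sum_(1 <= k < T.+1) (k == B.+1) * (p ^ B.+1 <= T) <= (p ^ B.+1 <= T).
  rewrite -big_distrl /=; case: (_ <= T); rewrite ?muln0 // muln1.
  rewrite -(big_mkcond (pred1 B.+1) (fun=> 1)) sum1_count /=.
  by rewrite count_uniq_mem ?iota_uniq //; case: (_ \in _).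
rewrite -(leq_add2r (\sum_(1 <= k < T.+1) (u %/ p ^ k + (T - u) %/ p ^ k))) in le1.
apply: leq_trans le1; rewrite -big_split /=; apply: leq_sum => k _.
have pk : 0 < p ^ k by rewrite expn_gt0 prime_gt0.
have [kB|kB] := leqP k B.
  have dk : p ^ k %| u by apply: dvdn_trans du; apply: dvdn_exp2l.
  by rewrite -{1}(subnKC uT) divnDl //= leq_addl.
have [->|kB1] := eqVneq k B.+1; last first.
  have kB2 : B.+2 <= k by rewrite ltn_neqAle eq_sym kB1.
  rewrite [T %/ _]divn_small ?leq0n //.
  by apply: leq_trans TB _; rewrite leq_exp2l.
rewrite mul1n; case: (leqP (p ^ B.+1) T) => pT; last by rewrite [T %/ _]divn_small.
rewrite -{1}(subnKC uT) divnD ?expn_gt0 ?prime_gt0 // addnC leq_add2r.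
exact: leq_b1.
Qed.

Section Squarefree.
Variables w b s Phi : nat.
Let T := b + 1 + s.
Hypothesis le_wb : w <= b.
Hypothesis asw : b - w + s <= w.
Hypothesis Tb : T <= 2 * b.
Hypothesis dvd : forall u, u <= w -> u <= T -> T - u <= b -> Phi %| 'C(T, u).

(** Either u or T - u is an admissible lower index for the hypothesis on Phi, and
    both choices give the same binomial coefficient. *)
Lemma logn_le_carry p u : prime p -> p ^ trunc_log p b %| u -> s < u <= b ->
  logn p Phi <= (p ^ (trunc_log p b).+1 <= T).
Proof.
move=> pp du /andP[su ub]; set B := trunc_log p b.
have uT : u <= T by rewrite /T; lia.
have TB : T < p ^ B.+2.
  have : b < p ^ B.+1 by apply: trunc_log_ltn; apply: prime_gt1.
  rewrite [p ^ B.+2]expnS; have := prime_gt1 pp; rewrite -/B; nia.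
have dC : Phi %| 'C(T, u).
  have [uw|uw] := leqP u w; first by apply: dvd => //; rewrite /T; lia.
  by rewrite -bin_sub //; apply: dvd; rewrite /T; lia.
apply: leq_trans (logn_bin_carry pp du uT TB).
by apply: dvdn_leq_log; rewrite // bin_gt0.
Qed.

End Squarefree.

(** * Divisors of the ball size *)

(** Writing M = w + 1 and M' = b + 1, the difference of the two sides is
    M' 'C(M, i + 1) 'C(b, i) - (M + M') 'C(w, i) 'C(b, i), a sum of multiples of M and M'. *)
Lemma ball_term_mod d w b i : d %| w.+1 -> d %| b.+1 ->
  i.+1 * ('C(w, i) * 'C(b, i)) = i.+1 * ('C(w, i.+1) * 'C(b, i.+1)) %[mod d].
Proof.
move=> dw db; have hw := mul_bin_diag w.+1 i; have hb := mul_bin_diag b.+1 i.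
rewrite /= !binS in hw hb.
(* Pascal's rule turns both products with w + 1 and b + 1 into multiples of i + 1 *)
have key : b.+1 * (('C(w, i.+1) + 'C(w, i)) * 'C(b, i)) + i.+1 * ('C(w, i) * 'C(b, i)) =
    i.+1 * ('C(w, i.+1) * 'C(b, i.+1)) + (w.+1 + b.+1) * ('C(w, i) * 'C(b, i)).
  move: hw hb; move: 'C(w, i) 'C(w, i.+1) 'C(b, i) 'C(b, i.+1) => A A1 B B1 hw hb.
  have -> : (w.+1 + b.+1) * (A * B) = (w.+1 * A) * B + (b.+1 * B) * A by lia.
  have -> : b.+1 * ((A1 + A) * B) = (b.+1 * B) * (A1 + A) by lia.
  by rewrite hw hb; lia.
have d1 : b.+1 * (('C(w, i.+1) + 'C(w, i)) * 'C(b, i)) = 0 %[mod d].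
  by apply/eqP; rewrite mod0n; apply: dvdn_mulr.
have d2 : (w.+1 + b.+1) * ('C(w, i) * 'C(b, i)) = 0 %[mod d].
  by apply/eqP; rewrite mod0n; apply: dvdn_mulr; apply: dvdn_add.
move/(congr1 (modn^~ d)): key => /=; rewrite -modnDml d1 mod0n add0n => ->.
by rewrite -modnDmr d2 mod0n addn0.
Qed.

(** Summation by parts against the weights i + 1, whose increments are 1. *)
Lemma ball_mod d w b e : d %| w.+1 -> d %| b.+1 ->
  ball_size w b e = e.+1 * ('C(w, e) * 'C(b, e)) %[mod d].
Proof.
move=> dw db; elim: e => [|e IH]; first by rewrite /ball_size big_ord_recl big_ord0 addn0 mul1n.
rewrite /ball_size big_ord_recr /= -modnDml -/(ball_size w b e) IH ball_term_mod // modnDml.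
by rewrite -mulSnr.
Qed.

Lemma dvdn_ball w b e : e.+1 %| w.+1 -> e.+1 %| b.+1 -> e.+1 %| ball_size w b e.
Proof. by move=> dw db; rewrite /dvdn (ball_mod e dw db) -/(dvdn _ _) dvdn_mulr. Qed.

(** The factors w + 1 and b + 1 turn the terms into (i + 1)^2 'C(w + 1, i + 1)
    'C(b + 1, i + 1), and (i + 1)(i + 2)(2i + 3) / 6 is the sum of the first i + 1 squares,
    so this is again a summation by parts. *)
Lemma ball_mod2 d w b e : d %| w.+2 -> d %| b.+2 ->
  6 * (w.+1 * b.+1 * ball_size w b e) =
  e.+1 * e.+2 * (2 * e + 3) * ('C(w.+1, e.+1) * 'C(b.+1, e.+1)) %[mod d].
Proof.
move=> dw db.
have E i : w.+1 * b.+1 * ('C(w, i) * 'C(b, i)) = i.+1 ^ 2 * ('C(w.+1, i.+1) * 'C(b.+1, i.+1)).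
  have hw := mul_bin_diag w.+1 i; have hb := mul_bin_diag b.+1 i; rewrite /= in hw hb.
  by rewrite mulnACA hw hb mulnACA.
elim: e => [|e IH].
  by rewrite /ball_size big_ord_recl big_ord0 addn0 E exp1n mul1n !mulnA.
rewrite /ball_size big_ord_recr /= -/(ball_size w b e) mulnDr mulnDr -modnDml IH modnDml E.
have := ball_term_mod e.+1 dw db.
set c := 'C(_, _) * 'C(_, _); set c1 := 'C(_, _) * 'C(_, _) => h.
have -> : e.+1 * e.+2 * (2 * e + 3) * c = e.+1 * (2 * e + 3) * (e.+2 * c) by lia.
rewrite -modnDml -modnMmr h modnMmr modnDml; congr (_ %% d).
by clear; lia.
Qed.

Lemma dvdn_ball2 g w b e : g %| w.+2 -> g %| b.+2 -> g %| e.+2 -> g %| 6 * ball_size w b e.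
Proof.
move=> dw db de.
have co m : g %| m.+2 -> coprime g m.+1.
  by move=> dm; apply: coprime_dvdl dm _; rewrite coprime_sym coprimenS.
rewrite -(Gauss_dvdr _ (co w dw)) -(Gauss_dvdr _ (co b db)).
have -> : b.+1 * (w.+1 * (6 * ball_size w b e)) = 6 * (w.+1 * b.+1 * ball_size w b e) by lia.
rewrite /dvdn (ball_mod2 e dw db) -/(dvdn _ _).
by rewrite -!mulnA mulnCA dvdn_mulr.
Qed.

(** What remains of e + 2 when both e + 2 %| 2K and e + 2 %| K (K + 1) are used to
    extract a divisor of K: only a single factor 2 can be lost. *)
Definition twist e := if e.+2 %% 4 == 2 then e.+2 %/ 2 else e.+2.

Lemma twist_dvd e : twist e %| e.+2.
Proof.
rewrite /twist; case: eqP => // h; apply/dvdnP; exists 2; lia.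
Qed.

Lemma twist_dvdK e K : e + 2 %| 2 * K -> e + 2 %| K * (K + 1) -> twist e %| K.
Proof.
rewrite addn2 => /dvdnP[q hq] h2; rewrite /twist; case: eqP => h.
  have e2 : e.+2 = 2 * (e.+2 %/ 2) by lia.
  apply/dvdnP; exists q; move: e2; move: (e.+2 %/ 2) => f e2.
  by rewrite e2 in hq; lia.
have [o|ev] := boolP (odd e).
  rewrite -(@Gauss_dvdr _ 2); first by rewrite hq dvdn_mull.
  by rewrite coprimen2 /= o.
rewrite -(@Gauss_dvdl _ _ (K + 1)) //.
have oK : odd (K + 1).
  have [k ek] : exists k, e.+2 = 4 * k by exists (e.+2 %/ 4); lia.
  have : K = 2 * (q * k) by rewrite ek in hq; lia.
  by move=> ->; lia.
have : gcdn e.+2 (K + 1) %| 2.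
  have d1 : gcdn e.+2 (K + 1) %| 2 * K by rewrite hq dvdn_mull // dvdn_gcdl.
  have d2 : gcdn e.+2 (K + 1) %| 2 * K + 2.
    by rewrite (_ : 2 * K + 2 = 2 * (K + 1)) ?dvdn_mull ?dvdn_gcdr // mulnDr.
  by rewrite (dvdn_addr _ d1) in d2.
rewrite -[coprime _ _]/(gcdn _ _ == 1) => d2.
have := dvdn_leq (isT : 0 < 2) d2; have : 0 < gcdn e.+2 (K + 1) by rewrite gcdn_gt0.
case E2: (gcdn e.+2 (K + 1)) => [|[|[|?]]] //= _ _.
by have := dvdn_gcdr e.+2 (K + 1); rewrite E2 dvdn2 oK.
Qed.

(** * The adjacency operator and the dual Hahn polynomials *)

Import Order.TTheory GRing.Theory Num.Theory.
Local Open Scope ring_scope.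

Section Operator.
Variables n w : nat.
Hypothesis le_wn : (w <= n)%N.
Local Notation b := (n - w)%N.
Local Notation J := (johnson n w).
Local Notation fn := {ffun {set 'I_n} -> rat}.
Implicit Types (X Y Z : {set 'I_n}) (h g : fn) (p q : {poly rat}).

Definition adj h : fn := [ffun X => \sum_(Y in J | #|X :\: Y| == 1%N) h Y].
(** The operator p(adj). Functions on all subsets are used instead of functions on
    the vertices, so that no subtype is needed; only values on J matter. *)
Definition pact p h : fn := [ffun X => \sum_(i < size p) p`_i * iter i adj h X].

Lemma pactE N p h X : (size p <= N)%N -> pact p h X = \sum_(i < N) p`_i * iter i adj h X.
Proof.
move=> le_pN; rewrite ffunE -(subnKC le_pN) big_split_ord /= [X in _ = _ + X]big1 ?addr0 //.
by move=> i _; rewrite nth_default ?mul0r // leq_addr.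
Qed.

Lemma adj_ext h g : {in J, h =1 g} -> adj h = adj g.
Proof. by move=> e; apply/ffunP => X; rewrite !ffunE; apply: eq_bigr => Y /andP[/e]. Qed.

Lemma pactD p q h X : pact (p + q) h X = pact p h X + pact q h X.
Proof.
pose N := maxn (size p) (size q).
rewrite (@pactE N) ?size_polyD // (@pactE N p) ?leq_maxl // (@pactE N q) ?leq_maxr //.
by rewrite -big_split; apply: eq_bigr => i _; rewrite coefD mulrDl.
Qed.

Lemma pactZ a p h X : pact (a *: p) h X = a * pact p h X.
Proof.
rewrite (@pactE (size p)) ?size_scale_leq // (@pactE (size p)) // mulr_sumr.
by apply: eq_bigr => i _; rewrite coefZ mulrA.
Qed.

Lemma pact_sum (I : Type) (r : seq I) (P : pred I) (F : I -> {poly rat}) h X :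
  pact (\sum_(i <- r | P i) F i) h X = \sum_(i <- r | P i) pact (F i) h X.
Proof.
elim: r => [|i r IH]; first by rewrite !big_nil (@pactE 0) ?size_poly0 // big_ord0.
by rewrite !big_cons; case: (P i) => //; rewrite pactD IH.
Qed.

Lemma pact1 h X : pact 1 h X = h X.
Proof. by rewrite (@pactE 1) ?size_poly1 // big_ord1 coef1 mul1r. Qed.

Lemma pact_mulX p h : pact (p * 'X) h = pact p (adj h).
Proof.
apply/ffunP => X; rewrite (@pactE (size p).+1); last first.
  by rewrite (leq_trans (size_polyMleq _ _)) // size_polyX addn2.
rewrite big_ord_recl coefMX mul0r add0r [RHS]ffunE.
by apply: eq_bigr => i _; rewrite coefMX /= -iterSr.
Qed.

Lemma pact_adj p h : pact p (adj h) = adj (pact p h).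
Proof.
apply/ffunP => X; rewrite !ffunE; under [RHS]eq_bigr => Y _ do rewrite ffunE.
rewrite exchange_big /=; apply: eq_bigr => i _.
by rewrite -iterSr /= ffunE mulr_sumr.
Qed.

Lemma pactM p q h : pact (p * q) h = pact p (pact q h).
Proof.
elim/poly_ind: p h => [|p c IH] h.
  by apply/ffunP => X; rewrite mul0r !(@pactE 0) ?size_poly0 // !big_ord0.
have cE : c%:P = c *: 1 :> {poly rat} by rewrite alg_polyC.
apply/ffunP => X; rewrite mulrDl -mulrA ['X * q]mulrC mulrA mul_polyC !pactD pactZ.
by rewrite !pact_mulX IH !pact_adj cE pactZ pact1.
Qed.

Lemma pactC p q h : pact p (pact q h) = pact q (pact p h).
Proof. by rewrite -!pactM mulrC. Qed.

Lemma pactX h : pact 'X h = adj h.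
Proof. by apply/ffunP=> X; rewrite -['X]mul1r pact_mulX pact1. Qed.

Lemma pact_XsubC a h X : pact ('X - a%:P) h X = adj h X - a * h X.
Proof.
have -> : 'X - a%:P = 'X + (- a) *: 1 :> {poly rat} by rewrite scaleNr alg_polyC.
by rewrite pactD pactX pactZ pact1 mulNr.
Qed.

Definition sph i h : fn := [ffun X => \sum_(Y in J | #|X :\: Y| == i) h Y].

Lemma sum_single (R : nmodType) X (F : {set 'I_n} -> R) :
  \sum_(P : {set 'I_n} | (P \subset X) && (#|P| == 1%N)) F P = \sum_(x in X) F [set x].
Proof.
rewrite -(big_imset (h := fun x : 'I_n => [set x]) F); last by move=> x y _ _; exact: set1_inj.
apply: eq_bigl => P; apply/andP/imsetP => [[sP /cards1P[x eP]]|[x xX ->]].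
  by exists x; rewrite // -sub1set -eP.
by rewrite sub1set cards1.
Qed.

(** The three values are the intersection numbers of the Johnson graph: an exchange
    of one point against Z lowers, raises or preserves the distance. *)
Lemma adj_count X Z i : X \in J -> Z \in J ->
  \sum_(Y in J | #|X :\: Y| == 1%N) (#|Y :\: Z| == i)%:R =
  let j := #|X :\: Z| in
  (j * j)%:R * (j == i.+1)%:R + j%:R * (n%:R - 2 * j%:R) * (j == i)%:R
  + (w%:R - j%:R) * (b%:R - j%:R) * (j.+1 == i)%:R :> rat.
Proof.
rewrite !inE => /eqP cX /eqP cZ /=; set j := #|X :\: Z|.
have cXZ : #|X :&: Z| = (w - j)%N by rewrite -cX -(cardsID Z X) addnK.
have cCZ : #|~: X :&: Z| = j.
  by rewrite setIC -setDE /j cardsD_swap // cX cZ.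
have cCC : #|~: X :\: Z| = (b - j)%N.
  apply/eqP; rewrite -(eqn_add2l #|~: X :&: Z|) cardsID cCZ.
  have := cardsC X; rewrite card_ord cX => cC; rewrite subnKC; first by apply/eqP; lia.
  by rewrite -cCZ (leq_trans (subset_leq_card (subsetIl _ _))) //; lia.
have jw : (j <= w)%N by rewrite -cX subset_leq_card // subsetDl.
have jb : (j <= b)%N.
  have := cardsC X; rewrite card_ord cX => cC.
  by rewrite -cCZ (leq_trans (subset_leq_card (subsetIl _ _))) //; lia.
rewrite sum_sphere // sum_single.
transitivity (\sum_(x in X) \sum_(y in ~: X) ((j + (y \notin Z) == i + (x \notin Z))%N)%:R : rat).
  apply: eq_bigr => x xX; rewrite sum_single; apply: eq_bigr => y yX.
  have := @card_exchangeD n X [set x] [set y] Z; rewrite !sub1set xX yX => /(_ isT isT).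
  have c1 (u : 'I_n) : #|[set u] :\: Z| = (u \notin Z).
    case uZ: (u \in Z) => /=.
      by apply/eqP; rewrite cards_eq0 setD_eq0 sub1set.
    have -> : [set u] :\: Z = [set u] by apply/setDidPl; rewrite disjoints1 uZ.
    by rewrite cards1.
  by rewrite !c1 -/j => <-; rewrite eqn_add2r.
have inner (k : nat) : \sum_(y in ~: X) ((j + (y \notin Z) == k)%N)%:R =
    j%:R * (j == k)%:R + (b%:R - j%:R) * (j.+1 == k)%:R :> rat.
  rewrite (big_setID Z) /= (eq_bigr (fun=> (j == k)%:R)); last first.
    by move=> y; rewrite !inE => /andP[_ ->]; rewrite addn0.
  rewrite [X in _ + X](eq_bigr (fun=> (j.+1 == k)%:R)); last first.
    by move=> y; rewrite !inE => /andP[-> _]; rewrite addn1.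
  by rewrite !sumr_const cCZ cCC -[_ *+ j]mulr_natl -[_ *+ (b - j)]mulr_natl natrB.
rewrite (big_setID Z) /= (eq_bigr (fun=> j%:R * (j == i)%:R + (b%:R - j%:R) * (j.+1 == i)%:R)); last first.
  by move=> x; rewrite !inE => /andP[_ ->]; rewrite inner addn0.
rewrite [X in _ + X](eq_bigr (fun=> j%:R * (j == i.+1)%:R + (b%:R - j%:R) * (j == i)%:R)); last first.
  by move=> x; rewrite !inE => /andP[-> _]; rewrite inner addn1 eqSS.
rewrite !sumr_const cXZ -/j -[_ *+ j]mulr_natl -[_ *+ (w - j)]mulr_natl natrB //.
rewrite natrB // natrM; ring.
Qed.

Lemma adj_sph i h X : X \in J ->
  adj (sph i h) X = (i.+1%:R ^+ 2) * sph i.+1 h X + i%:R * (n%:R - 2 * i%:R) * sph i h X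
    + (if i is i'.+1 then (w%:R - i'%:R) * (b%:R - i'%:R) * sph i' h X else 0).
Proof.
move=> XJ; rewrite ffunE; under eq_bigr => Y _ do rewrite ffunE big_mkcondr /=.
rewrite exchange_big /=.
transitivity (\sum_(Z in J) h Z * \sum_(Y in J | #|X :\: Y| == 1%N) (#|Y :\: Z| == i)%:R).
  apply: eq_bigr => Z _; rewrite mulr_sumr; apply: eq_bigr => Y _.
  by case: eqP => _; rewrite ?mulr1 ?mulr0.
under eq_bigr => Z ZJ do rewrite (adj_count _ XJ ZJ) /= 2!(mulrDr (h Z)).
rewrite !big_split /=; congr (_ + _ + _).
- rewrite ffunE mulr_sumr big_mkcondr; apply: eq_bigr => Z _ /=.
  by case: eqP => [->|_]; rewrite ?mulr0 // natrM mulr1 mulrC expr2.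
- rewrite ffunE mulr_sumr big_mkcondr; apply: eq_bigr => Z _ /=.
  by case: eqP => [->|_]; rewrite ?mulr0 // mulr1 mulrC.
case: i => [|i]; first by apply: big1 => Z _; rewrite !mulr0.
rewrite ffunE mulr_sumr big_mkcondr; apply: eq_bigr => Z _ /=.
by rewrite eqSS; case: eqP => [->|_]; rewrite ?mulr0 // mulr1 mulrC.
Qed.

(** The dual Hahn polynomials, defined by their three-term recurrence with two
    consecutive ones carried along; [pact_hahn] says that p_i(adj) sums over the
    sphere of radius i. *)
Fixpoint hahn2 i : {poly rat} * {poly rat} :=
  if i is i'.+1 then
    let: (q, r) := hahn2 i' in
    (r, (i'.+1%:R ^+ 2)^-1 *: (r * 'X - (i'%:R * (n%:R - 2 * i'%:R)) *: r
          - ((w%:R - i'.-1%:R) * (b%:R - i'.-1%:R)) *: q))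
  else (0, 1).
Definition hahn i := (hahn2 i).2.

Lemma hahn0 : hahn 0 = 1. Proof. by []. Qed.

Lemma hahn2E i : hahn2 i = (if i is i'.+1 then hahn i' else 0, hahn i).
Proof. by case: i => [|i] //; rewrite /hahn /=; case: (hahn2 i). Qed.

Lemma hahnS i : (i.+1%:R ^+ 2) *: hahn i.+1 = hahn i * 'X
   - (i%:R * (n%:R - 2 * i%:R)) *: hahn i
   - (if i is i'.+1 then ((w%:R - i'%:R) * (b%:R - i'%:R)) *: hahn i' else 0).
Proof.
rewrite {1}/hahn /= hahn2E /= scalerA divff ?scale1r; last by rewrite expf_neq0 ?pnatr_eq0.
by case: i => [|i] //=; rewrite scaler0.
Qed.

Lemma pact_hahn i h X : X \in J -> pact (hahn i) h X = sph i h X.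
Proof.
elim/ltn_ind: i h X => i IH h X XJ; case: i IH => [|i] IH.
  rewrite hahn0 pact1 ffunE (big_pred1 X) // => Y /=; rewrite cards_eq0 setD_eq0.
  move: XJ; rewrite !inE => /eqP cX; apply/andP/eqP => [[/eqP cY sXY]|->]; last by rewrite cX.
  by apply/esym/eqP; rewrite eqEcard sXY cX cY /=.
have e := adj_sph i h XJ.
have nz : (i.+1%:R ^+ 2 : rat) != 0 by rewrite expf_neq0 ?pnatr_eq0.
apply: (mulfI nz); rewrite -pactZ hahnS.
have -> : hahn i * 'X - (i%:R * (n%:R - 2 * i%:R)) *: hahn i -
     (if i is i'.+1 then ((w%:R - i'%:R) * (b%:R - i'%:R)) *: hahn i' else 0) =
   hahn i * 'X + (- (i%:R * (n%:R - 2 * i%:R))) *: hahn i +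
     (if i is i'.+1 then (- ((w%:R - i'%:R) * (b%:R - i'%:R))) *: hahn i' else 0).
  by rewrite scaleNr; case: (i) => [|i']; rewrite ?oppr0 // scaleNr.
rewrite !pactD pactZ pact_mulX pact_adj (adj_ext (g := sph i h)); last by move=> Y; exact: IH.
rewrite (IH i) // e.
case: i IH {e nz} => [|i] IH /=.
  by rewrite (@pactE 0) ?size_poly0 // big_ord0 !addr0; ring.
by rewrite pactZ IH //; ring.
Qed.

Lemma hahn_size_coef i : (size (hahn i) <= i.+1)%N /\ (hahn i)`_i = (i`!%:R ^+ 2)^-1.
Proof.
elim/ltn_ind: i => -[|i] IH; first by rewrite hahn0 size_poly1 coef1 expr1n invr1.
have nz : (i.+1%:R ^+ 2 : rat) != 0 by rewrite expf_neq0 ?pnatr_eq0.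
have [si ci] := IH i (ltnSn i).
have sm : (size ((if i is i'.+1 then ((w%:R - i'%:R) * (b%:R - i'%:R)) *: hahn i' else 0)%R : {poly rat}) <= i)%N.
  case: i IH {nz si ci} => [|i'] IH; first by rewrite size_poly0.
  by rewrite (leq_trans (size_scale_leq _ _)) // (IH i' _).1.
split.
  rewrite -(size_scale _ nz) hahnS (leq_trans (size_polyD _ _)) // size_polyN geq_max.
  rewrite (leq_trans sm) // ?andbT; last by rewrite ltnW.
  rewrite (leq_trans (size_polyD _ _)) // size_polyN geq_max (leq_trans (size_polyMleq _ _)) //=.
    by rewrite (leq_trans (size_scale_leq _ _)) // (leq_trans si).
  by rewrite size_polyX addn2 /= ltnS.
apply: (mulfI nz); rewrite -coefZ hahnS !coefB coefMX /= ci coefZ.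
rewrite (nth_default _ si) mulr0 subr0 nth_default ?subr0 ?(leq_trans sm) //.
by rewrite factS natrM exprMn [in RHS]invfM mulVKf.
Qed.

End Operator.

(** * Lloyd's theorem *)

(** The eigenvalues of the Johnson graph J(w + b, w). *)
Definition theta (w b t : nat) : rat := (w%:R - t%:R) * (b%:R - t%:R) - t%:R.

Lemma sub_set1_sum (T : finType) (D A : {set T}) : D \subset A ->
  (\sum_(y in A) (D \subset [set y]) = if D == set0 then #|A| else (#|D| == 1))%N.
Proof.
move=> sDA; have [->|nzD] := eqVneq D set0.
  by rewrite -sum1_card; apply: eq_bigr => y _; rewrite sub0set.
have [/cards1P[z eD]|nD1] := boolP (#|D| == 1%N).
  have zA : z \in A by rewrite -sub1set -eD.
  rewrite (bigD1 z) //= eD subxx big1 // => y /andP[_ ne].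
  by rewrite sub1set inE eq_sym (negPf ne).
rewrite big1 // => y _; apply/eqP; rewrite eqb0; apply: contra nD1 => sDy.
by rewrite eqn_leq (leq_trans (subset_leq_card sDy)) ?cards1 // card_gt0.
Qed.

Section Lloyd.
Variables n w e : nat.
Hypothesis le_wn : (w <= n)%N.
Local Notation b := (n - w)%N.
Local Notation J := (johnson n w).
Local Notation fn := {ffun {set 'I_n} -> rat}.
Local Notation adj := (@adj n w).
Local Notation pact := (@pact n w).
Local Notation theta := (theta w b).
Implicit Types (X Y Z I K : {set 'I_n}) (h g : fn) (p q : {poly rat}).

(** The indicator of the vertices that contain I. These functions triangularise the
    operator: modulo the juntas of smaller sets, the junta of I is an eigenvector
    for theta #|I|. *)
Definition junta I : fn := [ffun X : {set 'I_n} => (I \subset X)%:R].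

Lemma adj_junta I X : X \in J ->
  adj (junta I) X = theta #|I| * junta I X
    + (w%:R - #|I|%:R + 1) * \sum_(x in I) junta (I :\ x) X.
Proof.
move=> XJ; have := XJ; rewrite inE => /eqP cX.
set D := I :\: X.
have cD : (#|X :\: I| + #|I| = w + #|D|)%N.
  have := cardsID I X; have := cardsID X I; rewrite cX -/D setIC; lia.
have e1 : adj (junta I) X = (#|X :\: I| * \sum_(y in ~: X) (D \subset [set y]))%N%:R.
  rewrite ffunE sum_sphere // sum_single -sum1_card.
  rewrite [X in (X * _)%N](eq_bigl (fun x => (x \in X) && (x \notin I))); last first.
    by move=> x; rewrite inE andbC.
  rewrite [X in (X * _)%N]big_mkcondr big_distrlr /= natr_sum; apply: eq_bigr => x xX.
  rewrite sum_single natr_sum; apply: eq_bigr => y; rewrite inE => yX.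
  rewrite ffunE; congr _%:R; rewrite -[if _ then _ else _]/(nat_of_bool _) mulnb; congr nat_of_bool.
  apply/subsetP/andP => [sI|[xI /subsetP sD] z zI].
    split; first by apply/negP => /sI; rewrite !inE eqxx /= => /eqP exy; rewrite -exy xX in yX.
    by apply/subsetP => z; rewrite !inE => /andP[zX /sI]; rewrite !inE (negPf zX) andbF.
  rewrite !inE; case zX: (z \in X); last by have := sD z; rewrite !inE zX zI => ->; rewrite ?orbT.
  by rewrite andbT; case: eqP => // ezx; rewrite -ezx zI in xI.
have e2 : \sum_(x in I) junta (I :\ x) X = (\sum_(x in I) (D \subset [set x]))%N%:R.
  rewrite natr_sum; apply: eq_bigr => x _; rewrite ffunE; congr (nat_of_bool _)%:R.
  by rewrite /D !subDset setUC.
rewrite e1 e2 ffunE !sub_set1_sum ?subsetDl //; last first.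
  by apply/subsetP => z; rewrite !inE => /andP[].
have cC : #|~: X| = b by have := cardsC X; rewrite card_ord cX; lia.
have cDr : #|X :\: I|%:R = w%:R + #|D|%:R - #|I|%:R :> rat.
  by rewrite -natrD -cD natrD addrK.
have -> : (I \subset X) = (D == set0) by rewrite setD_eq0.
rewrite /theta; have [D0|_] := eqVneq D set0.
  by rewrite natrM cDr D0 cards0 cC /=; ring.
case: eqP => [D1|_]; last by rewrite muln0 /=; ring.
by rewrite muln1 cDr D1 /=; ring.
Qed.

Lemma pact_ext p h g X : {in J, h =1 g} -> X \in J -> pact p h X = pact p g X.
Proof.
move=> ehg XJ; rewrite !ffunE; apply: eq_bigr => -[[|i] _] _ /=; first by rewrite ehg.
by rewrite -!iterS !iterSr (adj_ext ehg).
Qed.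

Lemma pact0 p h X : {in J, forall Y, h Y = 0} -> X \in J -> pact p h X = 0.
Proof.
move=> h0 XJ; rewrite (@pact_ext p h 0) //; last by move=> Y YJ; rewrite h0 // ffunE.
have a0 : adj 0 = 0.
  by apply/ffunP => Y; rewrite !ffunE; apply: big1 => Z _; rewrite ffunE.
rewrite ffunE big1 // => i _; have -> : iter i adj 0 = 0 by elim: (nat_of_ord i) => //= k ->.
by rewrite ffunE mulr0.
Qed.

Definition qpoly t := \prod_(s < t) ('X - (theta s)%:P).

Definition sc (a : rat) h : fn := [ffun X => a * h X].

Lemma iter_adjD i h g : iter i adj (h + g) = iter i adj h + iter i adj g.
Proof.
elim: i => //= i ->; apply/ffunP => X; rewrite !ffunE -big_split.
by apply: eq_bigr => Y _; rewrite ffunE.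
Qed.

Lemma iter_adj_sc i a h : iter i adj (sc a h) = sc a (iter i adj h).
Proof.
elim: i => //= i ->; apply/ffunP => X; rewrite !ffunE mulr_sumr.
by apply: eq_bigr => Y _; rewrite ffunE.
Qed.

Lemma pact_hD p h g : pact p (h + g) = pact p h + pact p g.
Proof.
apply/ffunP => X; rewrite !ffunE -big_split; apply: eq_bigr => i _.
by rewrite iter_adjD ffunE mulrDr.
Qed.

Lemma pact_h0 p : pact p 0 = 0.
Proof. by apply: (addrI (pact p 0)); rewrite -pact_hD !addr0. Qed.

Lemma pact_sc p a h : pact p (sc a h) = sc a (pact p h).
Proof.
apply/ffunP => X; rewrite !ffunE mulr_sumr; apply: eq_bigr => i _.
by rewrite iter_adj_sc ffunE mulrCA.
Qed.

Lemma pact_hsum p (T : finType) (A : {set T}) (F : T -> fn) :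
  pact p (\sum_(x in A) F x) = \sum_(x in A) pact p (F x).
Proof. exact: (big_morph _ (pact_hD p) (pact_h0 p)). Qed.

(** Each factor pushes the junta of a t-set into the span of smaller ones. For
    t = w + 1 this applies to the indicators of all vertices, so [qpoly] at w + 1
    annihilates everything. *)
Lemma qpoly_junta t I X : (#|I| < t)%N -> X \in J -> pact (qpoly t) (junta I) X = 0.
Proof.
elim: t I X => // t IH I X lt_It XJ; rewrite /qpoly big_ord_recr /= -/(qpoly t).
have [lt_I|] := ltnP #|I| t.
  by rewrite pactM pactC pact0 // => Y YJ; apply: IH.
rewrite leq_eqVlt ltnNge -ltnS lt_It orbF => /eqP cI; rewrite pactM.
rewrite (@pact_ext _ _ (sc (w%:R - t%:R + 1) (\sum_(x in I) junta (I :\ x)))) //.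
  rewrite pact_sc pact_hsum ffunE sum_ffunE big1 ?mulr0 // => x xI; apply: IH => //.
  by rewrite (cardsD1 x) xI in cI; lia.
move=> Y YJ; rewrite pact_XsubC adj_junta // -cI [RHS]ffunE sum_ffunE; ring.
Qed.

Variable C : {set {set 'I_n}}.
Hypothesis codeC : code_axiom w e C.
Local Notation Phi := (ball_size w b e).
(** How far the code is from averaging h correctly. *)
Definition lam h : rat := \sum_(c in C) h c - Phi%:R^-1 * \sum_(X in J) h X.
Definition lloyd : {poly rat} := \sum_(i < e.+1) hahn n w i.

Lemma pact_lloyd h X : X \in J ->
  pact lloyd h X = \sum_(Y in J | (#|X :\: Y| <= e)%N) h Y.
Proof.
move=> XJ; rewrite pact_sum; under eq_bigr => i _ do rewrite pact_hahn // ffunE.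
rewrite (partition_big (fun Y => inord #|X :\: Y| : 'I_e.+1) xpredT) //=.
apply: eq_bigr => i _; apply: eq_bigl => Y; rewrite -andbA; congr (_ && _).
apply/eqP/andP => [->|[le /eqP <-]]; last by rewrite inordK.
by rewrite -ltnS ltn_ord; split=> //; apply/eqP; apply: val_inj; rewrite /= inordK.
Qed.

Lemma card_ball Y : Y \in J -> #|[set X in J | (#|X :\: Y| <= e)%N]| = Phi.
Proof.
move=> YJ; have := YJ; rewrite inE => /eqP cY.
rewrite -sum1_card (eq_bigl (fun X => (X \in J) && (#|Y :\: X| <= e)%N)); last first.
  move=> X; rewrite [LHS]inE; case XJ : (X \in J) => //=.
  by move: XJ; rewrite inE => /eqP cX; rewrite cardsD_swap // cX cY.
rewrite (partition_big (fun X => inord #|Y :\: X| : 'I_e.+1) xpredT) //=.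
apply: eq_bigr => i _; rewrite -(card_sphere i cY) -sum1_card; apply: eq_bigl => X.
rewrite [RHS]inE -andbA; congr (_ && _).
apply/andP/eqP => [[le /eqP <-]|->]; first by rewrite inordK.
by rewrite -ltnS ltn_ord; split=> //; apply/eqP; apply: val_inj; rewrite /= inordK.
Qed.

(** Summing over the balls round the codewords sums over all vertices once. *)
Lemma lam_lloyd h : lam (pact lloyd h) = 0.
Proof.
have [sC uC] := codeC.
rewrite /lam; under eq_bigr => c /(subsetP sC) cJ do rewrite pact_lloyd // big_mkcondr.
under [X in _ * X]eq_bigr => c cJ do rewrite pact_lloyd // big_mkcondr.
rewrite exchange_big /= [X in _ - _ * X]exchange_big /=.
have -> : \sum_(Y in J) \sum_(c in C) (if (#|c :\: Y| <= e)%N then h Y else 0) =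
    \sum_(Y in J) h Y.
  apply: eq_bigr => Y YJ; rewrite -big_mkcondr sumr_const.
  have := uC Y YJ; rewrite -sum1_card; under eq_bigl do rewrite inE.
  by rewrite sum1_card => ->.
have -> : \sum_(Y in J) \sum_(X in J) (if (#|X :\: Y| <= e)%N then h Y else 0) =
    Phi%:R * \sum_(Y in J) h Y.
  rewrite mulr_sumr; apply: eq_bigr => Y YJ; rewrite -big_mkcondr sumr_const mulr_natl.
  by rewrite -(card_ball YJ) cardsE.
by rewrite mulKf ?subrr // pnatr_eq0 -lt0n ball_size_gt0.
Qed.

Lemma lam_ext h g : {in J, h =1 g} -> lam h = lam g.
Proof.
have [sC _] := codeC; move=> ehg; rewrite /lam.
rewrite (eq_bigr g) => [|c /(subsetP sC) /ehg //]; congr (_ - _ * _).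
by apply: eq_bigr => X /ehg.
Qed.

Lemma lamD h g : lam (h + g) = lam h + lam g.
Proof.
have lin (B : {set {set 'I_n}}) : \sum_(X in B) (h + g) X = \sum_(X in B) h X + \sum_(X in B) g X.
  by rewrite -big_split; apply: eq_bigr => X _; rewrite ffunE.
rewrite /lam !lin; ring.
Qed.

Lemma lam_sc a h : lam (sc a h) = a * lam h.
Proof.
have lin (B : {set {set 'I_n}}) : \sum_(X in B) sc a h X = a * \sum_(X in B) h X.
  by rewrite mulr_sumr; apply: eq_bigr => X _; rewrite ffunE.
rewrite /lam !lin; ring.
Qed.

Lemma lam_sum (T : finType) (A : {set T}) (F : T -> fn) :
  lam (\sum_(x in A) F x) = \sum_(x in A) lam (F x).
Proof.
apply: (big_morph _ lamD); apply: (addrI (lam 0)); by rewrite -lamD !addr0.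
Qed.

Lemma iter_adj_sum i (T : finType) (A : {set T}) (F : T -> fn) :
  iter i adj (\sum_(x in A) F x) = \sum_(x in A) iter i adj (F x).
Proof.
apply: (big_morph _ (iter_adjD i)); apply: (addrI (iter i adj 0)).
by rewrite -iter_adjD !addr0.
Qed.

Lemma lam_iter_ext i h g : {in J, h =1 g} -> lam (iter i adj h) = lam (iter i adj g).
Proof. by case: i => [|i] e1; [exact: lam_ext | rewrite !iterSr (adj_ext e1)]. Qed.

(** The triangular action of the operator on juntas, seen through [lam]. *)
Lemma lam_junta_step t I i : (forall I' k, (#|I'| < t)%N -> lam (iter k adj (junta I')) = 0) -> #|I| = t ->
  lam (iter i.+1 adj (junta I)) = theta t * lam (iter i adj (junta I)).
Proof.
move=> IH cI.
have -> : lam (iter i.+1 adj (junta I)) = lam (iter i adj (sc (theta t) (junta I) +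
     sc (w%:R - t%:R + 1) (\sum_(x in I) junta (I :\ x)))).
  rewrite iterSr; apply: lam_iter_ext => X XJ.
  by rewrite adj_junta // cI [RHS]ffunE ![sc _ _ X]ffunE sum_ffunE.
rewrite iter_adjD lamD !iter_adj_sc !lam_sc iter_adj_sum lam_sum big1 ?mulr0 ?addr0 //.
by move=> x xI; apply: IH; rewrite -cI (cardsD1 x I) xI.
Qed.

Lemma lam_pact p h : lam (pact p h) = \sum_(i < size p) p`_i * lam (iter i adj h).
Proof.
have -> : pact p h = \sum_(i in [set: 'I_(size p)]) sc p`_i (iter i adj h).
  apply/ffunP => X; rewrite ffunE sum_ffunE; apply: eq_big => i; first by rewrite inE.
  by rewrite ffunE.
by rewrite lam_sum; apply: eq_big => i; rewrite ?inE ?lam_sc.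
Qed.

(** Inductively, the operator multiplies the values of [lam] on juntas of s points by theta s.
    Then [lam_lloyd] says that lloyd(theta s) times such a value is 0: the code is a
    design of strength t - 1. *)
Lemma lam_junta t I k : (#|I| < t)%N ->
  (forall s, (s < t)%N -> lloyd.[theta s] != 0) -> lam (iter k adj (junta I)) = 0.
Proof.
elim: t I k => // t IH I k; rewrite ltnS leq_eqVlt => /orP[/eqP cI nz|lt_I nz]; last first.
  by apply: IH => // s st; apply: nz; apply: ltnW.
have IH' I' k' : (#|I'| < t)%N -> lam (iter k' adj (junta I')) = 0.
  by move=> lt_I; apply: IH => // s st; apply: nz; apply: ltnW.
have step i := lam_junta_step i IH' cI.
have pw i : lam (iter i adj (junta I)) = theta t ^+ i * lam (junta I).
  by elim: i => [|i IHi]; rewrite ?mul1r // step IHi exprS mulrA.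
have := lam_lloyd (junta I); rewrite lam_pact.
under eq_bigr => i _ do rewrite pw mulrA.
rewrite -mulr_suml -horner_coef => /eqP; rewrite mulf_eq0 (negPf (nz t (ltnSn t))) /=.
by rewrite pw => /eqP ->; rewrite mulr0.
Qed.

Definition juntaN I K : fn := [ffun X : {set 'I_n} => ((I \subset X) && [disjoint K & X])%:R].

(** Inclusion and exclusion, one point of K at a time. *)
Lemma lam_juntaN t I K : (#|I| + #|K| < t)%N ->
  (forall s, (s < t)%N -> lloyd.[theta s] != 0) -> lam (juntaN I K) = 0.
Proof.
move=> lt_IK nz; have [m] := ubnP #|K|; elim: m I K lt_IK => // m IH I K lt_IK le_Km.
have [K0|[y yK]] := set_0Vmem K.
  have -> : juntaN I K = junta I.
    by apply/ffunP => X; rewrite !ffunE K0 -setI_eq0 set0I eqxx andbT.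
  by apply: (@lam_junta t I 0) => //; apply: leq_ltn_trans lt_IK; rewrite leq_addr.
have cK : #|K| = #|K :\ y|.+1 by rewrite (cardsD1 y) yK.
have cI : (#|y |: I| <= #|I|.+1)%N by rewrite cardsU1; case: (y \notin I).
have -> : juntaN I K = juntaN I (K :\ y) + sc (-1) (juntaN (y |: I) (K :\ y)).
  apply/ffunP => X; rewrite !ffunE subUset sub1set.
  have -> : [disjoint K & X] = (y \notin X) && [disjoint K :\ y & X].
    by rewrite !disjoints_subset -{1}(setD1K yK) subUset sub1set inE.
  by case: (y \in X); case: (I \subset X); case: [disjoint _ & X]; rewrite /=; ring.
by rewrite lamD lam_sc !IH ?mulr0 ?addr0 //; lia.
Qed.

(** A design of strength t - 1 meets the expected number of vertices that contain
    one set and avoid another. There are 'C(r, u) such vertices, and 'C(r, u) / Phi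
    of them are codewords, so that this quotient is an integer. *)
Lemma design_dvd t r u : (forall s, (s < t)%N -> lloyd.[theta s] != 0) ->
  (r <= n)%N -> (n - r < t)%N -> (u <= w)%N -> (u <= r)%N -> (r - u <= b)%N ->
  (Phi %| 'C(r, u))%N.
Proof.
move=> nz rn nrt uw ur rub.
have ex (A : {set 'I_n}) m : (m <= #|A|)%N -> exists2 B : {set 'I_n}, B \subset A & #|B| = m.
  rewrite -bin_gt0 -cards_draws => /card_gt0P[B]; rewrite inE => /andP[sB /eqP cB].
  by exists B.
have [I _ cI] : exists2 B : {set 'I_n}, B \subset setT & #|B| = (w - u)%N.
  by apply: ex; rewrite cardsT card_ord; lia.
have cCI := cardsC I; rewrite card_ord cI in cCI.
have [K sK cK] : exists2 B : {set 'I_n}, B \subset ~: I & #|B| = (n - r - (w - u))%N.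
  by apply: ex; lia.
have : lam (juntaN I K) = 0 by apply: (lam_juntaN _ nz); rewrite cI cK; lia.
have sum_nat (B : {set {set 'I_n}}) : \sum_(X in B) juntaN I K X =
    #|[set X in B | (I \subset X) && [disjoint K & X]]|%:R.
  rewrite -sum1_card natr_sum [RHS](eq_bigl (fun X => (X \in B) && ((I \subset X) && [disjoint K & X]))).
    by rewrite big_mkcondr; apply: eq_bigr => X _; rewrite ffunE; case: (_ && _).
  by move=> X; rewrite inE.
rewrite /lam !sum_nat.
have -> : #|[set X in J | (I \subset X) && [disjoint K & X]]| = 'C(r, u).
  have := @card_draws_meet n (~: K) I w (w - u) (leq_subr _ _).
  have sI : I \subset ~: K by rewrite -disjoints_subset disjoint_sym disjoints_subset.
  rewrite (setIidPr sI) cI binn mul1n subKn //.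
  have -> : #|~: K :\: I| = r.
    have := cardsID I (~: K); rewrite (setIidPr sI) cI.
    have := cardsC K; rewrite card_ord cK; lia.
  move=> <-; apply: eq_card => X; rewrite !inE.
  have -> : (X \subset ~: K) = [disjoint K & X] by rewrite disjoint_sym disjoints_subset.
  have -> : (I \subset X) = (#|X :&: I| == (w - u)%N).
    apply/idP/eqP => [/setIidPr -> //|e1].
    by apply/setIidPr/eqP; rewrite eqEcard subsetIr e1 cI /=.
  by case: [disjoint _ & _]; rewrite ?andbF ?andbT //= andbC.
set N := #|[set X in C | _]| => /eqP; rewrite subr_eq0 => /eqP e1.
apply/dvdnP; exists N; apply/eqP; rewrite -(eqr_nat rat) natrM e1 mulrAC mulVf ?mul1r //.
by rewrite pnatr_eq0 -lt0n ball_size_gt0.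
Qed.

(** One application of the operator moves the support by at most one step. *)
Lemma iter_support k X0 X : X0 \in J -> X \in J -> (k < #|X :\: X0|)%N ->
  iter k adj (junta X0) X = 0.
Proof.
move=> X0J; elim: k X => [|k IH] X XJ lt_k.
  rewrite /= ffunE; case: (boolP (X0 \subset X)) => // sub.
  suff eX : X0 = X by rewrite eX setDv cards0 in lt_k.
  by move: X0J XJ; rewrite !inE => /eqP c0 /eqP cX; apply/eqP; rewrite eqEcard sub c0 cX /=.
rewrite /= ffunE big1 // => Y /andP[YJ /eqP cXY]; apply: IH => //.
have : (#|X :\: X0| <= #|X :\: Y| + #|Y :\: X0|)%N.
  apply: leq_trans (leq_card_setU _ _); apply: subset_leq_card; apply/subsetP => x.
  by rewrite !inE => /andP[-> ->]; case: (x \in Y).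
by rewrite cXY; lia.
Qed.

Lemma sum_adj h : \sum_(X in J) adj h X = theta 0 * \sum_(X in J) h X.
Proof.
under eq_bigr => X _ do rewrite ffunE big_mkcondr.
rewrite exchange_big mulr_sumr; apply: eq_bigr => Y YJ; rewrite -big_mkcondr sumr_const.
have -> : #|[pred X in J | #|X :\: Y| == 1%N]| = (w * b)%N.
  have := YJ; rewrite inE => /eqP cY; have := card_sphere 1 cY; rewrite !bin1 => <-.
  apply: eq_card => X; rewrite !inE; case: eqP => //= cX.
  by rewrite cardsD_swap // cX cY.
by rewrite -mulr_natl natrM /theta !subr0.
Qed.

Lemma sum_pact p h : \sum_(X in J) pact p h X = p.[theta 0] * \sum_(X in J) h X.
Proof.
have it i : \sum_(X in J) iter i adj h X = theta 0 ^+ i * \sum_(X in J) h X.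
  by elim: i => [|i IH]; rewrite ?mul1r //= sum_adj IH exprS mulrA.
under eq_bigr => X _ do rewrite ffunE.
rewrite exchange_big horner_coef mulr_suml; apply: eq_bigr => i _ /=.
by rewrite -mulr_sumr it mulrA.
Qed.

Lemma sum_pact_lloyd h : \sum_(X in J) pact lloyd h X = Phi%:R * \sum_(X in J) h X.
Proof.
under eq_bigr => X XJ do rewrite pact_lloyd // big_mkcondr.
rewrite exchange_big mulr_sumr; apply: eq_bigr => Y YJ; rewrite -big_mkcondr sumr_const mulr_natl.
by rewrite -(card_ball YJ) cardsE.
Qed.

Lemma lloyd_theta0 : lloyd.[theta 0] = Phi%:R.
Proof.
pose h : fn := [ffun=> 1].
have hs : \sum_(X in J) h X != 0.
  under eq_bigr => X _ do rewrite ffunE.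
  rewrite sumr_const pnatr_eq0 -lt0n.
  have -> : #|J| = 'C(n, w) by rewrite /johnson card_draws card_ord.
  by rewrite bin_gt0.
by apply: (mulIf hs); rewrite -sum_pact sum_pact_lloyd.
Qed.

Lemma lloyd_size_coef : (size lloyd <= e.+1)%N /\ lloyd`_e = (e`!%:R ^+ 2)^-1.
Proof.
rewrite /lloyd; split.
  apply: leq_trans (size_sum _ _ _) _; apply/bigmax_leqP => i _.
  by rewrite (leq_trans (hahn_size_coef n w i).1) // ltn_ord.
rewrite coef_sum big_ord_recr /= big1 ?add0r ?(hahn_size_coef n w e).2 // => i _.
by rewrite nth_default // (leq_trans (hahn_size_coef n w i).1).
Qed.

(** Lloyd's theorem. Let G be the gcd of lloyd and of the polynomial [qpoly] that
    kills every function. By Bezout G = u lloyd + v qpoly, so [lam] vanishes on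
    G(adj) applied to the indicator of X0. If G had degree less than e, this
    function would vanish on the code, all of whose words are at least e steps away, and
    then its total sum G(theta 0) would be 0, which contradicts lloyd(theta 0) = Phi.
    So G has full degree and lloyd divides qpoly, a product of distinct linear factors. *)
Lemma lloyd_roots X0 : X0 \in J -> (forall c, c \in C -> (e <= #|c :\: X0|)%N) ->
  exists ts : seq nat, [/\ size ts = e, sorted ltn ts, all (fun t => 0 < t <= w)%N ts &
    lloyd = (e`!%:R ^+ 2)^-1 *: \prod_(t <- ts) ('X - (theta t)%:P)].
Proof.
move=> X0J far; have [sC _] := codeC; set Q := qpoly w.+1; set G := gcdp lloyd Q.
have nz0 : lloyd.[theta 0] != 0 by rewrite lloyd_theta0 pnatr_eq0 -lt0n ball_size_gt0.
have [sl cl] := lloyd_size_coef.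
have nzf : (e`!%:R ^+ 2)^-1 != 0 :> rat by rewrite invr_eq0 expf_neq0 // pnatr_eq0 -lt0n fact_gt0.
have szl : size lloyd = e.+1.
  apply/eqP; rewrite eqn_leq sl /= ltnNge; apply/negP => le.
  by move: cl; rewrite nth_default // => e0; rewrite -e0 eqxx in nzf.
have szG : (e < size G)%N.
  rewrite ltnNge; apply/negP => szG.
  have [[u v] /= uvG] := Bezoutp lloyd Q; rewrite -/G in uvG.
  set G' := u * lloyd + v * Q in uvG.
  have szG' : (size G' <= e)%N by rewrite (eqp_size uvG).
  have l0 : lam (pact G' (junta X0)) = 0.
    have -> : pact G' (junta X0) = pact lloyd (pact u (junta X0)) + pact v (pact Q (junta X0)).
      by apply/ffunP => X; rewrite pactD [RHS]ffunE !pactM pactC.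
    rewrite lamD lam_lloyd add0r.
    rewrite (@lam_ext _ 0); first by apply: (addrI (lam 0)); rewrite -lamD !addr0.
    move=> X XJ; rewrite pact0 ?ffunE // => Y YJ; apply: qpoly_junta => //.
    by move: X0J; rewrite inE => /eqP ->.
  have : G'.[theta 0] = 0.
    move: l0; rewrite /lam sum_pact big1 ?sub0r => [|c cC].
      move/eqP; rewrite oppr_eq0 !mulf_eq0 invr_eq0 pnatr_eq0 gtn_eqF ?ball_size_gt0 //=.
      case/orP => [/eqP //|]; rewrite (bigD1 X0) //= ffunE subxx big1 ?addr0 ?oner_eq0 //.
      move=> X /andP[XJ neX]; rewrite ffunE; case: (boolP (_ \subset _)) => // sub.
      case/eqP: neX; apply/esym/eqP; rewrite eqEcard sub /=.
      by move: X0J XJ; rewrite !inE => /eqP -> /eqP ->.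
    rewrite ffunE big1 // => i _.
    have lti : (i < #|c :\: X0|)%N := leq_trans (leq_trans (ltn_ord i) szG') (far c cC).
    by rewrite iter_support ?mulr0 //; exact: (subsetP sC).
  move/eqP; rewrite -/(root _ _) (eqp_root uvG) => /(root_dvdp (dvdp_gcdl _ _)).
  by rewrite /root (negPf nz0).
have dvG : G %| lloyd by apply: dvdp_gcdl.
have eG : G %= lloyd.
  rewrite -(dvdp_size_eqp dvG) eqn_leq szl szG andbT -szl dvdp_leq //.
  by rewrite -size_poly_gt0 szl.
have : lloyd %| \prod_(s <- iota 0 w.+1) ('X - (theta s)%:P).
  rewrite -(eqp_dvdl _ eG) -[iota 0 w.+1]/(index_iota 0 w.+1) big_mkord.
  exact: dvdp_gcdr.
case/dvdp_prod_XsubC => m; set ts := mask m _ => /eqpP[[c1 c2] /= /andP[nz1 nz2] e12].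
have mon : \prod_(t <- ts) ('X - (theta t)%:P) \is monic by apply: monic_prod_XsubC.
have lE : lloyd = (c2 / c1) *: \prod_(t <- ts) ('X - (theta t)%:P).
  by rewrite mulrC -scalerA -e12 scalerA mulVf // scale1r.
have nz12 : c2 / c1 != 0 by rewrite mulf_neq0 // invr_eq0.
have szt : size ts = e.
  by apply/eqP; rewrite -eqSS -szl lE size_scale // size_prod_XsubC.
exists ts; split => //.
- by apply: (subseq_sorted ltn_trans (mask_subseq _ _)); exact: iota_ltn_sorted.
- apply/allP => t tts; have := mem_mask tts; rewrite mem_iota add0n ltnS => /andP[_ ->].
  rewrite andbT lt0n; apply/eqP => t0; rewrite t0 in tts.
  move: nz0; rewrite lE hornerZ mulf_eq0 negb_or => /andP[_].
  by rewrite horner_prod (big_rem 0%N tts) /= hornerXsubC subrr mul0r eqxx.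
rewrite lE; congr (_ *: _); rewrite -cl lE coefZ.
move/monicP: mon; rewrite lead_coefE size_prod_XsubC szt => ->.
by rewrite mulr1.
Qed.

End Lloyd.

(** * The location of the Lloyd roots *)

Section Roots.
Variables n w e : nat.
Hypothesis le_w2n : (2 * w <= n)%N.
Hypothesis le_en : (e <= n)%N.
Let b := (n - w)%N.
Local Notation lloyd := (lloyd n w e).

(** With (w - i)(b - i) <= n^2 / 4 the recurrence propagates the lower bound
    p_i >= n / (2i) p_(i-1) as long as x is at least (2e - 3/2) n. *)
Lemma hahn_growth (x : rat) i : (i.+1 < e.+1)%N -> (4 * e%:R - 3) * n%:R <= 2 * x ->
  0 < (hahn n w i).[x] /\ n%:R * (hahn n w i).[x] <= 2 * i.+1%:R * (hahn n w i.+1).[x].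
Proof.
move=> ie hx; have bE : (n - w)%:R = n%:R - w%:R :> rat by rewrite natrB //; lia.
have eR : (i.+1%:R <= e%:R :> rat) by rewrite ler_nat.
have n0 : (0 : rat) <= n%:R by rewrite ler0n.
elim: i ie eR => [|i IH] ie eR.
  have := congr1 (fun p => p.[x]) (hahnS n w 0) => /=.
  rewrite hahn0 !hornerE /= => h; split=> //.
  by move: eR h; nra.
have [||p0 pi] := IH; [lia | by apply: le_trans _ eR; rewrite ler_nat | ].
have n1 : (1 : rat) <= n%:R by rewrite ler1n; lia.
have i0 : (0 : rat) <= i%:R by rewrite ler0n.
have p1 : 0 < (hahn n w i.+1).[x].
  have i2 : 0 < 2 * i.+1%:R :> rat by rewrite mulr_gt0 ?ltr0n.
  rewrite -(pmulr_rgt0 _ i2).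
  by apply: lt_le_trans pi; rewrite mulr_gt0 // (lt_le_trans ltr01 n1).
split=> //.
have := congr1 (fun p => p.[x]) (hahnS n w i.+1) => /=.
rewrite !hornerE /= bE; move: p0 pi p1 eR.
set p := (hahn n w i).[x]; set q := (hahn n w i.+1).[x]; set r := (hahn n w i.+2).[x].
have ein : (i.+2%:R <= n%:R :> rat) by rewrite ler_nat; lia.
move: ein; rewrite -[i.+2]addn2 -[i.+1]addn1 !natrD => ein p0 pi q0 eR eq.
have xy : 4 * ((w%:R - i%:R) * (n%:R - w%:R - i%:R)) <= n%:R ^+ 2 :> rat.
  have : 0 <= i%:R * (n%:R - i%:R) :> rat by rewrite mulr_ge0 //; lra.
  by have := sqr_ge0 (n%:R - 2 * w%:R : rat); lra.
have le1 : (w%:R - i%:R) * (n%:R - w%:R - i%:R) * p * 2 <= n%:R * (i%:R + 1) * q.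
  have h1 : 4 * ((w%:R - i%:R) * (n%:R - w%:R - i%:R)) * p <= n%:R ^+ 2 * p.
    by rewrite ler_pM2r.
  have h2 : n%:R * (n%:R * p) <= n%:R * (2 * (i%:R + 1) * q) by rewrite ler_wpM2l.
  by lra.
have le2 : (i%:R + 2) * n%:R <= 2 * (x - (i%:R + 1) * (n%:R - 2 * (i%:R + 1))) - n%:R * (i%:R + 1) :> rat.
  by nra.
have le3 : (i%:R + 2) * n%:R * q <= 2 * (i%:R + 2) ^+ 2 * r.
  have := ler_wpM2r (ltW q0) le2; lra.
have ip : 0 < i%:R + 2 :> rat by lra.
by rewrite -(ler_pM2l ip); lra.
Qed.

Lemma lloyd_gt0 (x : rat) : (0 < e)%N -> (4 * e%:R - 3) * n%:R <= 2 * x -> 0 < (lloyd).[x].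
Proof.
move=> e0 hx; have n1 : (1 : rat) <= n%:R by rewrite ler1n; lia.
have pos i : (i <= e)%N -> 0 < (hahn n w i).[x].
  case: i => [|i] ie; first by rewrite hahn0 hornerE.
  have [p0 h] := hahn_growth (i := i) ie hx.
  have i2 : 0 < 2 * i.+1%:R :> rat by rewrite mulr_gt0 ?ltr0n.
  rewrite -(pmulr_rgt0 _ i2).
  by apply: lt_le_trans h; rewrite mulr_gt0 // (lt_le_trans ltr01 n1).
rewrite horner_sum big_ord_recl ltr_wpDr ?pos //.
by apply: sumr_ge0 => i _; rewrite ltW // pos // ltn_ord.
Qed.

Lemma theta_diff s t : (s <= n)%N -> (t <= n)%N ->
  theta w b s - theta w b t = (t%:R - s%:R) * (n%:R + 1 - t%:R - s%:R).
Proof.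
move=> sn tn; rewrite /theta /b natrB; last by lia.
by ring.
Qed.

Variable C : {set {set 'I_n}}.
Hypothesis codeC : code_axiom w e C.
Hypothesis e_gt0 : (0 < e)%N.

(** In this order: the size of the root set, its location, the value of lloyd at
    theta 0, the design property below the smallest root t0, and the upper
    bound for theta t0 from [lloyd_gt0]. *)
Lemma lloyd_theorem X0 : X0 \in johnson n w -> (forall c, c \in C -> (e <= #|c :\: X0|)%N) ->
  exists t0 ts,
  [/\ size ts = e.-1 /\ path ltn t0 ts,
      (0 < t0)%N && all (fun t => t <= w)%N (t0 :: ts),
      (\prod_(t <- t0 :: ts) (t * (n + 1 - t)) = e`! ^ 2 * ball_size w b e)%N,
      (forall r u, r <= n -> n - r < t0 -> u <= w -> u <= r -> r - u <= b ->
         ball_size w b e %| 'C(r, u))%N &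
      (2 * (w - t0) * (b - t0 + 1) < 2 * w + (4 * e - 3) * n)%N].
Proof.
move=> X0J far; have lewn : (w <= n)%N by lia.
have [ts [szt st allt lE]] := lloyd_roots lewn codeC X0J far.
have nzf : (e`!%:R ^+ 2)^-1 != 0 :> rat by rewrite invr_eq0 expf_neq0 // pnatr_eq0 -lt0n fact_gt0.
case: ts szt st allt lE => [|t0 ts] szt st allt lE; first by have := e_gt0; rewrite -szt.
exists t0, ts; have t0w : (t0 <= w)%N by case/andP: allt => /andP[].
split.
- by split=> //; rewrite -szt.
- case/andP: allt => /andP[-> _] /allP a1; rewrite /= t0w /=.
  by apply/allP => t /a1 /andP[].
- have := lloyd_theta0 e lewn; rewrite lE hornerZ horner_prod -/b => h.
  apply/eqP; rewrite -(eqr_nat rat) natrM natrX -h mulrA mulfV; last by rewrite expf_neq0 // pnatr_eq0 -lt0n fact_gt0.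
  rewrite mul1r natr_prod; apply/eqP; apply: eq_big_seq => t tts.
  have /andP[_ tw] := allP allt t tts.
  rewrite hornerXsubC theta_diff //; last by lia.
  by rewrite !subr0 natrM natrB ?natrD //; lia.
- move=> r u; apply: (design_dvd lewn codeC) => s st0.
  rewrite lE hornerZ mulf_neq0 // horner_prod prodf_seq_neq0; apply/allP => t tts.
  have /andP[_ tw] := allP allt t tts.
  have lest : (s < t)%N.
    apply: leq_trans st0 _; move: tts; rewrite inE => /predU1P[-> //|tin].
    by have := allP (order_path_min ltn_trans st) t tin => /ltnW.
  rewrite hornerXsubC theta_diff; [|lia|lia].
  have st' : (s%:R < t%:R :> rat) by rewrite ltr_nat.
  have stn : (s%:R + t%:R <= n%:R :> rat) by rewrite -natrD ler_nat; lia.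
  by apply: mulf_neq0; apply/eqP; lra.
rewrite ltnNge; apply/negP => le1.
have : 0 < (lloyd).[theta w b t0].
  apply: lloyd_gt0 => //; rewrite /theta.
  have : ((2 * w + (4 * e - 3) * n)%N%:R <= (2 * (w - t0) * (b - t0 + 1))%N%:R :> rat) by rewrite ler_nat.
  have e3 : ((4 * e - 3)%N%:R = 4 * e%:R - 3 :> rat) by rewrite natrB ?natrM //; lia.
  have b0 : ((b - t0)%N%:R = b%:R - t0%:R :> rat) by rewrite natrB // /b; lia.
  have w0 : ((w - t0)%N%:R = w%:R - t0%:R :> rat) by rewrite natrB.
  rewrite natrD !natrM natrD e3 b0 w0.
  by lra.
rewrite lE hornerZ horner_prod big_cons hornerXsubC subrr mul0r mulr0.
by rewrite ltxx.
Qed.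
End Roots.

Local Close Scope ring_scope.

(** * Arithmetic of a nontrivial code *)

(** Complementation preserves distances and exchanges w and n - w. *)
Lemma code_compl n w e (C : {set {set 'I_n}}) : w <= n -> code_axiom w e C ->
  code_axiom (n - w) e [set ~: c | c in C].
Proof.
move=> wn codeC; have [_ cov] := codeC.
have cc (Y : {set 'I_n}) : (#|~: Y| == w) = (#|Y| == n - w).
  have := cardsC Y; rewrite card_ord => h; apply/eqP/eqP; clear -h wn; lia.
split=> [|Y].
  apply/subsetP => _ /imsetP[c cC ->]; rewrite inE -cc setCK.
  by rewrite (code_card codeC cC).
rewrite inE -cc => cY; rewrite -(cov (~: Y)) ?inE //.
rewrite -[RHS](card_imset _ (@setC_inj 'I_n)); apply: eq_card => c; apply/idP/imsetP; rewrite inE.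
  case/andP=> /imsetP[d dC ->] dY; exists d => //; rewrite inE dC.
  by rewrite (cardsD_swap _) ?(code_card codeC dC) ?(eqP cY) // setDE setIC -setDE.
case=> d /setIdP[dC dY] ->; rewrite imset_f //=.
have -> : ~: d :\: Y = ~: Y :\: d by rewrite !setDE setIC.
have cdY : #|~: Y| = #|d| by rewrite (code_card codeC dC) (eqP cY).
by rewrite (cardsD_swap cdY).
Qed.

Lemma bin3E m : 6 * 'C(m.+2, 3) = m.+2 * m.+1 * m.
Proof. by rewrite mulnC -[6]/(3`!) bin_ffact !ffactnS ffactn0 muln1 mulnA. Qed.

(** With 2K = e + 2 the quotient of the two binomials forces e + 3 to divide
    (2m + 2)(2m + 4) for 2m = (e + 1)(e + 2) = 2 modulo e + 3, so e + 3 would be an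
    odd divisor of 24. *)
Lemma bin3_half e K : 0 < e -> e + 2 = 2 * K ->
  ~~ ('C(e + 3, 3) %| 'C(K * (e + 1) + 2, 3)).
Proof.
move=> e0 eK; apply/negP => /dvdnP[q hq].
have h1 := bin3E (K * (e + 1)); rewrite -[(K * _).+2]addn2 hq in h1.
have h2 : 6 * 'C(e + 3, 3) = (e + 3) * (e + 2) * (e + 1).
  by rewrite addn3 bin3E; clear; lia.
rewrite mulnCA h2 in h1.
have h3 : q * (e + 3) * 2 = (K * (e + 1) + 2) * (K * (e + 1) + 1).
  have p : 0 < K * (e + 1) by rewrite muln_gt0 addn1 andbT; lia.
  apply/eqP; rewrite -(eqn_pmul2r p); apply/eqP.
  move: h1; move: (K * (e + 1)) (mulnC K (e + 1)) => m em h1.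
  have eK2 : (e + 2) * (e + 1) = 2 * m by rewrite eK em -mulnA [K * _]mulnC.
  have : q * (e + 3) * ((e + 2) * (e + 1)) = (m + 2) * (m + 1) * m by lia.
  by rewrite eK2; lia.
have d24 : e + 3 %| 24.
  have z : 4 * ((K * (e + 1) + 2) * (K * (e + 1) + 1)) = ((e + 2) * (e + 1) + 4) * ((e + 2) * (e + 1) + 2).
    by rewrite eK; lia.
  have : e + 3 %| ((e + 2) * (e + 1) + 4) * ((e + 2) * (e + 1) + 2).
    by rewrite -z -h3; apply/dvdnP; exists (8 * q); lia.
  have -> : ((e + 2) * (e + 1) + 4) * ((e + 2) * (e + 1) + 2) = (e * (e * e + 3 * e + 10)) * (e + 3) + 24 by lia.
  by rewrite dvdn_addr ?dvdn_mull.
have : e + 3 <= 24 by apply: dvdn_leq.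
have : e = 2 * K - 2 by lia.
move=> eE; move: d24; rewrite eE => d24 le.
have : K <= 11 by lia.
by move: d24 e0; rewrite eE; case: K {eK h1 h2 hq h3 eE le} => [|[|[|[|[|[|[|[|[|[|[|[|?]]]]]]]]]]]].
Qed.

Lemma twist_bound e K : 0 < e -> 0 < K -> e + 2 %| 2 * K -> 'C(e + 3, 3) %| 'C(K * (e + 1) + 2, 3) ->
  e + 2 <= K.
Proof.
move=> e0 K0 /dvdnP[q hq] d3; have q0 : 0 < q by case: q hq => //; lia.
case: (ltngtP q 1) => [|q2|q1]; [lia | nia |].
by have := @bin3_half e K e0; rewrite d3 hq q1 mul1n => /(_ erefl).
Qed.

(** What a nontrivial code leaves behind: the parameters w <= b = n - w have
    all the divisibilities that the local counts give, and the Lloyd roots. *)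
Record feasible (w b e : nat) : Prop := Feasible {
  feas_le : w <= b;
  feas_K : exists K, [/\ w = e + K * (e + 1), e + 2 <= K, e + 2 %| 2 * K & twist e %| K];
  feas_K' : exists K, [/\ b = e + K * (e + 1), e + 2 <= K, e + 2 %| 2 * K & twist e %| K];
  feas_gap : (b - w) * e < w - e;
  feas_bin3 : 'C(e + 3, 3) %| 'C(w - e + 2, 3);
  feas_bin3' : 'C(e + 3, 3) %| 'C(b - e + 2, 3);
  feas_roots : exists t0 ts,
    [/\ size ts = e.-1 /\ path ltn t0 ts,
      (0 < t0)%N && all (fun t => t <= w)%N (t0 :: ts),
      (\prod_(t <- t0 :: ts) (t * (w + b + 1 - t)) = e`! ^ 2 * ball_size w b e)%N,
      (forall r u, r <= w + b -> w + b - r < t0 -> u <= w -> u <= r -> r - u <= b ->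
         ball_size w b e %| 'C(r, u))%N &
      (2 * (w - t0) * (b - t0 + 1) < 2 * w + (4 * e - 3) * (w + b))%N] }.

(** Modulo e + 2 the hypotheses say that 4m = 2 and m^2 = m, so that
    4 = (4m)^2 = 16m = 8. *)
Lemma equal_case_dvd m e x y : 2 * (m * e + 1) = x * (e + 2) ->
  (m * (e + 1) + 1) * (m * (e + 1)) = y * (e + 2) -> e + 2 %| 4.
Proof.
move=> hx hy; have : ((e + 2)%:Z %| 4%:Z)%Z.
  pose N := (e%:Z + 2)%R; pose u := (2 * m%:Z - x%:Z)%R.
  pose v := (y%:Z - m%:Z * m%:Z * N + 2 * m%:Z * m%:Z - m%:Z)%R.
  have A : (4 * m%:Z = 2 + u * N)%R by rewrite /u /N; lia.
  have B : (m%:Z * m%:Z - m%:Z = N * v)%R by rewrite /v /N; lia.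
  have D : (16 * (m%:Z * m%:Z - m%:Z) = (4 * m%:Z) * (4 * m%:Z) - 4 * (4 * m%:Z))%R by lia.
  apply/dvdzP; exists (u * u * N - 16 * v)%R.
  have NE : ((e + 2)%:Z = N)%R by rewrite /N; lia.
  rewrite NE; move: D; rewrite B A; clear; lia.
by rewrite dvdzE.
Qed.

(** The case mu = 0 is not available when the codewords near a vertex through a point
    exhaust the outside. For the smaller parameter this would mean K = 1, and for the
    larger one [equal_case_dvd] excludes it, as e + 2 > 4. *)
Lemma pair_arith w b e K K' : 2 < e -> w <= b -> w - e = K * (e + 1) -> b - e = K' * (e + 1) ->
  0 < K -> 0 < K' -> ~ (K = 1 /\ K' = 1) -> K * e <= b - e - 1 -> K' * e <= w - e - 1 ->
  e + 2 %| K * (K - 1) -> e + 2 %| K' * (K' - 1) ->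
  (K * e < b - e - 1 -> e + 2 %| K * (K + 1)) -> (K' * e < w - e - 1 -> e + 2 %| K' * (K' + 1)) ->
  [/\ e + 2 %| 2 * K, e + 2 %| K * (K + 1), e + 2 %| 2 * K', e + 2 %| K' * (K' + 1)
    & K' * e < w - e - 1].
Proof.
move=> e3 wb wE bE K0 K0' nt r1 r2 one one' zero zero'.
have K1 : 1 < K.
  rewrite ltnNge; apply/negP => le1; apply: nt; have KK : K = 1 by apply/eqP; rewrite eqn_leq le1.
  have K'1 : K' <= 1.
    have e0 : 0 < e by apply: leq_trans e3.
    by rewrite KK mul1n in wE; move: r2; rewrite wE addn1 subn1 /= -[X in _ <= X -> _]mul1n leq_pmul2r.
  by split=> //; apply/eqP; rewrite eqn_leq K'1.
have KK' : K <= K'.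
  by rewrite -(@leq_pmul2r (e + 1)) ?addn1 // -addn1 -wE -bE leq_sub2r.
have lt0 : K * e < b - e - 1.
  by rewrite bE; apply: leq_trans (_ : K * (e + 1) - 1 <= _); [clear -K1; lia | rewrite leq_sub2r // leq_mul2r KK' orbT].
have {}zero := zero lt0.
have sum_dvd L : 0 < L -> e + 2 %| L * (L - 1) -> e + 2 %| L * (L + 1) -> e + 2 %| 2 * L.
  move=> L0 h1 h2; rewrite -(dvdn_addr _ h1); have -> // : L * (L - 1) + 2 * L = L * (L + 1).
  by rewrite mulnBr mulnDr muln1 mul2n -addnn addnA subnK // leq_pmulr.
have K2 := sum_dvd K K0 one zero.
have lt0' : K' * e < w - e - 1.
  rewrite ltn_neqAle r2 andbT; apply/eqP => eqK.
  have h1 : K' * e + 1 = K * (e + 1) by rewrite -wE; clear -eqK K1 wE; nia.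
  have [m em] : exists m, K' = m * (e + 1) + 1.
    exists (K' - K).
    have : (K' - K) * (e + 1) + 1 + K * (e + 1) = K' + K * (e + 1); last by clear -KK'; lia.
    by rewrite addnAC -mulnDl subnK // -h1 mulnDr muln1; clear; lia.
  have Km : K = m * e + 1.
    apply/eqP; rewrite -(@eqn_pmul2r (e + 1)) ?addn1 // -addn1 -h1 em; apply/eqP; clear; lia.
  have d4 : e + 2 %| 4.
    (* modulo e + 2 these are K = 1 - 2m and K' = 1 - m *)
    move: K2 one'; rewrite Km em => /dvdnP[x hx] /dvdnP[y hy].
    apply: (@equal_case_dvd m e x y) => //.
    by move: hy; rewrite addnK; clear; lia.
  by have := dvdn_leq (isT : 0 < 4) d4; clear -e3; lia.
have {}zero' := zero' lt0'.
have K2' := sum_dvd K' K0' one' zero'.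
by split.
Qed.

Section Code.
Variables n w e : nat.
Variable C : {set {set 'I_n}}.
Hypothesis codeC : code_axiom w e C.
Hypothesis e3 : 2 < e.
Hypothesis ew : e < w.
Hypothesis wb : w <= n - w.
Let b := n - w.

Lemma code_feasible : ~ (w = 2 * e + 1 /\ b = 2 * e + 1) -> feasible w b e.
Proof.
move=> nt; have wn : w <= n by lia.
have codeC' := code_compl wn codeC; set C' := [set ~: c | c in C] in codeC'.
have e0 : 0 < e by lia.
have eb : e < n - w by lia.
have nbw : n - (n - w) = w by lia.
have ew' : e < n - (n - w) by rewrite nbw.
have wE := KE codeC ew eb; have bE := KE codeC' eb ew'.
have K0 := K_gt0 codeC ew eb; have K0' := K_gt0 codeC' eb ew'.
have r1 := roos_bound codeC e0 ew eb; have r2 := roos_bound codeC' e0 eb ew'.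
have one := pair_one_dvd codeC e0 ew eb; have one' := pair_one_dvd codeC' e0 eb ew'.
have zero := pair_zero_dvd codeC e0 ew eb; have zero' := pair_zero_dvd codeC' e0 eb ew'.
have d3 := @local_dvd n w e C codeC 3 ew eb; have d3' := @local_dvd n (n - w) e C' codeC' 3 eb ew'.
rewrite nbw in r2 zero'; rewrite -/b in wE bE K0' r1 r2 one' zero zero' d3' eb *.
have [|K2 Ks K2' Ks' lt0'] := @pair_arith w b e _ _ e3 wb wE bE K0 K0' _ r1 r2 one one' zero zero'.
  move=> [k1 k2]; apply: nt; rewrite k1 in wE; rewrite k2 in bE.
  by clear -wE bE ew eb; split; lia.
clear r1 r2 one one' zero zero'; move: wE bE K0 K0' K2 Ks K2' Ks' lt0'.
move: ((w - e) %/ (e + 1)) ((b - e) %/ (e + 1)) => K K' wE bE K0 K0' K2 Ks K2' Ks' lt0'.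
have dd3 : 'C(e + 3, 3) %| 'C(w - e + 2, 3).
  have := d3; rewrite (_ : w - e - 1 + 3 = w - e + 2); last by clear -ew; lia.
  by apply; clear -e3; lia.
have dd3' : 'C(e + 3, 3) %| 'C(b - e + 2, 3).
  have := d3'; rewrite (_ : b - e - 1 + 3 = b - e + 2); last by clear -eb; lia.
  by apply; clear -e3; lia.
have le1 : e + 2 <= K by apply: twist_bound; rewrite // -wE.
have le2 : e + 2 <= K' by apply: twist_bound; rewrite // -bE.
have nE : n = w + b by rewrite /b subnKC.
split => //.
- by exists K; split=> //; [by rewrite -wE subnKC // ltnW | exact: twist_dvdK].
- by exists K'; split=> //; [by rewrite -bE subnKC // ltnW | exact: twist_dvdK].
- move: lt0'; have bK : b = e + K' * (e + 1) by rewrite -bE subnKC // ltnW.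
  have wK : w = e + K * (e + 1) by rewrite -wE subnKC // ltnW.
  clear -bK wK wb ew; move=> lt.
  have : (e + 1) * (K' * e).+1 <= (e + 1) * (K * (e + 1)) by rewrite leq_mul2l; lia.
  by subst w; rewrite bK; nia.
have [c0 [X [cC0 XJ dX _]]] := base_vertex codeC e0 ew eb.
have h2w : 2 * w <= n by clear -wb wn; lia.
have hen : e <= n by clear -ew wn; lia.
rewrite -nE; apply: (lloyd_theorem h2w hen codeC e0 XJ).
move=> c cC; have [->|ne] := eqVneq c c0.
  rewrite -(@cardsD_swap _ X c0) ?dX //; move: XJ; rewrite inE => /eqP ->.
  by rewrite (code_card codeC cC0).
have := code_dist_vertex codeC cC0 cC ne XJ; rewrite dX -(@cardsD_swap _ X c); first by clear; lia.
by move: XJ; rewrite inE => /eqP ->; rewrite (code_card codeC cC).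
Qed.
End Code.

Lemma feas_dvd_ball w b e : feasible w b e -> e.+1 %| ball_size w b e.
Proof.
case=> _ [K [-> _ _ _]] [K' [-> _ _ _]] _ _ _ _.
by apply: dvdn_ball; rewrite addn1 -addSn dvdn_add // dvdn_mull.
Qed.

Lemma feas_dvd_ball6 w b e : feasible w b e -> twist e %| 6 * ball_size w b e.
Proof.
case=> _ [K [-> _ _ gK]] [K' [-> _ _ gK']] _ _ _ _.
by apply: dvdn_ball2; rewrite ?twist_dvd // -!addSn dvdn_add ?twist_dvd // dvdn_mulr.
Qed.

Lemma feas_gap3 w b e : feasible w b e -> 2 < e -> 3 * (b - w) <= w.
Proof.
move=> [wb _ _ gap _ _ _] e3; have : 3 * (b - w) <= (b - w) * e by rewrite mulnC leq_mul2l e3 orbT.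
by move: gap; clear; lia.
Qed.

(** The bounds on s make b + 1 + s = n + 1 - t0 barely exceed b; the last item says
    that a prime dividing the ball size must have a power in between. *)
Lemma feas_carry w b e : feasible w b e -> 2 < e ->
  exists s ts,
  [/\ size ts = e /\ uniq ts, all (fun t => (0 < t <= w) && (w + b + 1 - t <= b + 1 + s)) ts,
      \prod_(t <- ts) (t * (w + b + 1 - t)) = e`! ^ 2 * ball_size w b e,
      2 * s * (s + (b - w) + 1) < 2 * w + (4 * e - 3) * (w + b) &
      forall p u, prime p -> p ^ trunc_log p b %| u -> s < u <= b -> b - w + s <= w -> b + 1 + s <= 2 * b ->
        logn p (ball_size w b e) <= (p ^ (trunc_log p b).+1 <= b + 1 + s)].
Proof.
move=> F e3; have [wb _ _ gap _ _ [t0 [ts [[sz pt] al pr dv bd]]]] := F.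
have /andP[t00 al'] := al; have /andP[t0w _] := al'.
exists (w - t0), (t0 :: ts); split => //.
- split; first by rewrite /= sz prednK //; clear -e3; lia.
  exact: (sorted_uniq ltn_trans ltnn (pt : sorted ltn (t0 :: ts))).
- apply/allP => t tin; rewrite (allP al' t tin) andbT.
  have le : t0 <= t.
    by move: tin; rewrite inE => /predU1P[-> //|h]; rewrite ltnW // (allP (order_path_min ltn_trans pt)).
  by clear -le t00 t0w wb; lia.
- by apply: leq_trans bd; rewrite ltnS leq_mul2l; clear -wb t0w; lia.
move=> p u pp du su asw Tb; apply: (logn_le_carry wb asw Tb _ pp du su).
move=> v vw vT Tv; apply: dv => //; clear -t0w t00 wb; lia.
Qed.

(** As soon as 2s <= b the largest multiple of p ^ B up to b lies above s, and can serve
    as u in [feas_carry]. *)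
Lemma feas_carry_half w b e : feasible w b e -> 2 < e -> 16 * e - 8 <= b ->
  exists s ts,
  [/\ size ts = e /\ uniq ts, all (fun t => (0 < t <= w) && (w + b + 1 - t <= b + 1 + s)) ts,
      \prod_(t <- ts) (t * (w + b + 1 - t)) = e`! ^ 2 * ball_size w b e,
      s ^ 2 <= (4 * e - 2) * b /\ 2 * s <= b &
      forall p, prime p -> logn p (ball_size w b e) <= (p ^ (trunc_log p b).+1 <= b + 1 + s)].
Proof.
move=> F e3 eb; have [s [ts [hs al pr bd lg]]] := feas_carry F e3.
have g3 := feas_gap3 F e3; have wb := feas_le F.
have b0 : 0 < b by clear -eb e3; lia.
have bdb : 2 * s * (s + 1) < (8 * e - 4) * b.
  apply: leq_ltn_trans (_ : 2 * s * (s + (b - w) + 1) < _); first by rewrite leq_mul2l; clear; lia.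
  apply: leq_trans bd _; clear -wb e3; nia.
have sb : 2 * s <= b.
  rewrite leqNgt; apply/negP => lt; have : (b + 1) * (b + 1) <= 2 * s * (2 * s) by apply: leq_mul; clear -lt; lia.
  have : (8 * e - 4) * b * 2 <= b * b by rewrite mulnAC leq_mul2r; clear -eb; lia.
  by move: bdb; clear; nia.
exists s, ts; split=> //; first by split=> //; move: bdb; clear -e3; nia.
move=> p pp; set q := p ^ trunc_log p b.
have qb : q <= b by apply: trunc_logP; rewrite ?prime_gt1.
have q0 : 0 < q by rewrite expn_gt0 prime_gt0.
apply: (lg p (b %/ q * q)) => //; first by rewrite -/q dvdn_mull.
- have := divn_eq b q; have := ltn_pmod b q0.
  have : 0 < b %/ q by rewrite divn_gt0.
  set d := b %/ q; set r := b %% q; move=> d0 rq e1; move: d0 rq e1 sb qb; clear; nia.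
- by clear -g3 sb wb; lia.
by clear -sb b0 eb e3; lia.
Qed.

(** * Small radii *)

Lemma feas_squarefree p w b e : feasible w b e -> 2 < e -> 16 * e - 8 <= b -> prime p ->
  ~~ (p ^ 2 %| ball_size w b e).
Proof.
move=> F e3 eb pp; have [s [ts [_ _ _ _ /(_ p pp) h]]] := feas_carry_half F e3 eb.
rewrite pfactor_dvdn ?ball_size_gt0 // -ltnNge ltnS.
exact: leq_trans h (leq_b1 _).
Qed.

Lemma feas_large w b e : feasible w b e -> e ^ 2 + 4 * e + 2 <= w.
Proof.
by case=> _ [K [-> le _ _]] _ _ _ _ _; move: le; clear; nia.
Qed.

Lemma feas_b w b e : feasible w b e -> 11 < e -> 16 * e - 8 <= b.
Proof.
move=> F e12; have := feas_large F; have := feas_le F; move: e12; clear; nia.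
Qed.

Lemma bin3_dvdE e v K : v = e + K * (e + 1) -> 'C(e + 3, 3) %| 'C(v - e + 2, 3) ->
  exists q, q * ((e + 3) * (e + 2) * (e + 1)) =
    (K * (e + 1) + 2) * (K * (e + 1) + 1) * (K * (e + 1)).
Proof.
move=> ->; rewrite addKn => /dvdnP[q hq]; exists q.
have := bin3E (K * (e + 1)); have := bin3E e.+1; rewrite -[(e.+1).+2]addn3 -[(_ * _).+2]addn2 hq.
by clear; lia.
Qed.

Lemma feas_param w b e : feasible w b e -> exists K q q',
  [/\ w = e + K * (e + 1), e + 2 <= K, 2 * K = q * (e + 2) &
    q' * ((e + 3) * (e + 2) * (e + 1)) = (K * (e + 1) + 2) * (K * (e + 1) + 1) * (K * (e + 1))].
Proof.
case=> _ [K [wE K0 /dvdnP[q hq] _]] _ _ d3 _ _.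
by have [q' hq'] := bin3_dvdE wE d3; exists K, q, q'.
Qed.

Lemma feas_param' w b e : feasible w b e -> exists K q q',
  [/\ b = e + K * (e + 1), e + 2 <= K, 2 * K = q * (e + 2) &
    q' * ((e + 3) * (e + 2) * (e + 1)) = (K * (e + 1) + 2) * (K * (e + 1) + 1) * (K * (e + 1))].
Proof.
case=> _ _ [K [bE K0 /dvdnP[q hq] _]] _ _ d3 _.
by have [q' hq'] := bin3_dvdE bE d3; exists K, q, q'.
Qed.

(** Since K >= e + 2, the bound fails only for K = e + 2, and then the count of triples
    is violated. *)
Lemma feas_b_small w b e : feasible w b e -> e \in [:: 5; 6; 7; 8; 11] -> 16 * e - 8 <= b.
Proof.
move=> F; have [K [q [q' [-> K0 hq hq']]]] := feas_param' F; clear F.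
have [KE|ne] := eqVneq K (e + 2).
  by rewrite KE in hq'; rewrite !inE => /or4P[/eqP E|/eqP E|/eqP E|/orP[]/eqP E];
     rewrite E in hq'; exfalso; clear -hq'; lia.
have {ne} lt : e + 2 < K by rewrite ltn_neqAle eq_sym ne.
by rewrite !inE => /or4P[/eqP E|/eqP E|/eqP E|/orP[]/eqP E]; rewrite E in lt hq *; clear -lt hq; lia.
Qed.

(** The coefficients 'C(16, j) with 0 < j < 6 are divisible by 4, so that adding 16 to
    the upper index is harmless by the Vandermonde identity. *)
Lemma bin_mod4 m i : i < 6 -> 'C(m, i) = 'C(m %% 16, i) %[mod 4].
Proof.
move=> i6; rewrite {1}(divn_eq m 16); elim: (m %/ 16) => [|k IH]; first by rewrite mul0n.
rewrite -IH mulSn -addnA -binomial.Vandermonde big_ord_recl bin0 mul1n subn0.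
apply/eqP; rewrite -[X in _ == X %[mod _]]addn0 eqn_modDl mod0n; apply: dvdn_sum => -[j ji] _.
apply: dvdn_mulr; rewrite /bump /=.
have : j < 5 by apply: leq_trans ji _.
by case: j {ji} => [|[|[|[|[|]]]]].
Qed.

Lemma ball5_mod4 w b : w %% 16 \in [:: 3; 5; 11; 13] -> b %% 16 \in [:: 3; 5; 11; 13] ->
  4 %| ball_size w b 5.
Proof.
move=> hw hb; have -> : 4 %| ball_size w b 5 = (4 %| ball_size (w %% 16) (b %% 16) 5).
  rewrite /dvdn; congr (_ == _); rewrite /ball_size -modn_summ -[RHS]modn_summ; congr (_ %% _).
  apply: eq_bigr => i _; rewrite -modnMm -[RHS]modnMm.
  by rewrite (bin_mod4 w (ltn_ord i)) (bin_mod4 b (ltn_ord i)).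
move: hw hb; rewrite !inE.
by rewrite /ball_size !big_ord_recl big_ord0 => /or4P[] /eqP -> /or4P[] /eqP ->; vm_compute.
Qed.

(** The count of triples makes W (W + 1)(W + 2) divisible by 16 for W = 6K, so
    W is 0 or 6 modulo 8. *)
Lemma feas_e5 K q : q * ((5 + 3) * (5 + 2) * (5 + 1)) = (K * (5 + 1) + 2) * (K * (5 + 1) + 1) * (K * (5 + 1)) ->
  (5 + K * (5 + 1)) %% 16 \in [:: 3; 5; 11; 13].
Proof.
move=> h; have : 16 %| (K * 6 + 2) * (K * 6 + 1) * (K * 6).
  by rewrite -h; apply/dvdnP; exists (q * 21); clear; lia.
have Kr := divn_eq K 8; have lt := ltn_pmod K (isT : 0 < 8).
move: Kr lt; move: (K %/ 8) (K %% 8) => k r -> lt.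
rewrite -[5 + 1]/6.
have -> : (5 + (k * 8 + r) * 6) %% 16 = (5 + r * 6) %% 16 by lia.
have -> : 16 %| ((k * 8 + r) * 6 + 2) * ((k * 8 + r) * 6 + 1) * ((k * 8 + r) * 6) =
   (16 %| (r * 6 + 2) * (r * 6 + 1) * (r * 6)).
  have e1 : (k * 8 + r) * 6 = k * 3 * 16 + r * 6 by clear; lia.
  rewrite e1; move: (r * 6) => x; set y := k * 3 * 16.
  have -> : (y + x + 2) * (y + x + 1) * (y + x) =
    k * 3 * (y * y + y * (3 * x + 3) + 3 * x * x + 6 * x + 2) * 16 + (x + 2) * (x + 1) * x.
    by rewrite /y; clear; lia.
  by rewrite dvdn_addr // -/(dvdn _ _) dvdn_mull.
by case: r lt => [|[|[|[|[|[|[|[|]]]]]]]].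
Qed.

(** The only case with b below 16e - 8 is w = b = 23; there s <= 14 < 16, so 16 itself
    is a suitable multiple of the power of 2 below b. *)
Lemma feas_e3 w b : ~ feasible w b 3.
Proof.
move=> F; have d4 : 4 %| ball_size w b 3 := feas_dvd_ball F.
have [K [q [q' [bE K0 hq hq']]]] := feas_param' F.
have [K2 [q2 [q2' [wE K20 hq2 hq2']]]] := feas_param F.
have [b40|b40] := leqP 40 b.
  by have := feas_squarefree F isT b40 (isT : prime 2); rewrite d4.
have b23 : b = 23 by clear -bE K0 hq b40; lia.
have wb := feas_le F.
have w23 : w = 23 by clear -wE K20 wb b23; lia.
have [s [ts [_ _ _ bd lg]]] := feas_carry F isT.
rewrite {}b23 {}w23 in bd lg d4; have s14 : s <= 14 by clear -bd; nia.
have : logn 2 (ball_size 23 23 3) <= 1.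
  apply: (leq_trans (lg 2 16 isT isT _ _ _)); [clear -s14; lia | clear -s14; lia | clear -s14; lia|].
  exact: leq_b1.
by rewrite leqNgt -pfactor_dvdn ?d4 // ball_size_gt0.
Qed.

(** As e + 1 divides Phi and twist e divides 6 Phi, one of 4 and 9 divides Phi, except for
    e = 5, where the residues of w and b modulo 16 make Phi divisible by 4. *)
Lemma feas_small w b e : e \in [:: 3; 5; 6; 7; 8; 11; 14; 15; 17] -> ~ feasible w b e.
Proof.
move=> he F; have [e3|n3] := eqVneq e 3; first by rewrite e3 in F; apply: feas_e3 F.
have e2 : 2 < e by move: he; rewrite !inE; clear; lia.
have eb : 16 * e - 8 <= b.
  have [e11|e11] := ltnP 11 e; first exact: feas_b F e11.
  by apply: (feas_b_small F); move: he n3 e11; rewrite !inE; clear; lia.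
have sq p : prime p -> ~~ (p ^ 2 %| ball_size w b e) by apply: feas_squarefree F e2 eb.
have := feas_dvd_ball F; have := feas_dvd_ball6 F; move: (sq 2 isT) (sq 3 isT).
have [K [q [q' [bE K0 _ hq']]]] := feas_param' F.
have [K2 [q2 [q2' [wE K20 _ hq2']]]] := feas_param F; clear eb e2 n3 sq F.
have dvd4 (N m : nat) : N %| m -> forall d, d %| N -> d %| m by move=> h d /dvdn_trans; apply.
move: he; rewrite !inE => he s4 s9 d6 d1.
have [E|n3] := eqVneq e 3; first by move: s4; rewrite (dvd4 _ _ d1) // E.
have [E|n7] := eqVneq e 7; first by move: s4; rewrite (dvd4 _ _ d1) // E.
have [E|n11] := eqVneq e 11; first by move: s4; rewrite (dvd4 _ _ d1) // E.
have [E|n15] := eqVneq e 15; first by move: s4; rewrite (dvd4 _ _ d1) // E.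
have [E|n8] := eqVneq e 8; first by move: s9; rewrite (dvd4 _ _ d1) // E.
have [E|n17] := eqVneq e 17; first by move: s9; rewrite (dvd4 _ _ d1) // E.
have half m : 8 %| 6 * m -> 4 %| m by clear; lia.
have [E|n6] := eqVneq e 6; first by move: s4; rewrite half // (dvd4 _ _ d6) // E.
have [E|n14] := eqVneq e 14; first by move: s4; rewrite half // (dvd4 _ _ d6) // E.
have E : e = 5.
  move: he; rewrite (negPf n3) (negPf n6) (negPf n7) (negPf n8) (negPf n11) (negPf n14) (negPf n15) (negPf n17).
  by rewrite !orbF => /eqP.
rewrite E in bE wE hq' hq2' s4.
by case/negP: s4; apply: ball5_mod4; rewrite ?bE ?wE; [apply: feas_e5 hq2' | apply: feas_e5 hq'].
Qed.

(** Here w = 13 + 210 j, and the count of triples makes 32 divide a product of three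
    consecutive integers, which excludes j < 7. *)
Lemma feas_e13 w b : feasible w b 13 -> 1483 <= w.
Proof.
move=> F; have [K [q [q' [-> K0 hq hq']]]] := feas_param F; clear F.
have [j jE] : exists j, K = 15 * j by exists (q %/ 2); clear -hq; lia.
rewrite jE in K0 hq' *; clear jE hq.
rewrite leqNgt; apply/negP => lt; have : j < 7 by clear -lt; lia.
by case: j hq' {lt} K0 => [|[|[|[|[|[|[|]]]]]]] //; clear; lia.
Qed.

(** * Primes of the ball size *)

Lemma odd_spread (s : seq nat) N : uniq s -> all odd s -> size s = N.+1 ->
  exists m M, [/\ m \in s, M \in s & m + 2 * N <= M].
Proof.
move=> us os sz; have ex : exists x, x \in s.
  by case: s sz {us os} => // x s _; exists x; rewrite inE eqxx.
have [m ms min] := ex_minnP ex; exists m.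
have [/hasP[M Ms le]|/hasPn no] := boolP (has (fun x => m + 2 * N <= x) s); first by exists M.
have : size s <= size (iota 0 N).
  rewrite -(size_map (fun x => (x - m)./2)); apply: uniq_leq_size.
    rewrite map_inj_in_uniq // => x y xs ys.
    have := allP os _ xs; have := allP os _ ys; have := allP os _ ms.
    by have := min _ xs; have := min _ ys; clear; lia.
  move=> _ /mapP[x xs ->]; rewrite mem_iota; have := no _ xs; rewrite -ltnNge.
  by have := min _ xs; clear; lia.
by rewrite size_iota sz ltnn.
Qed.

Lemma expn_bernoulli p k : p ^ k.+1 + 2 * k.+1 * p ^ k <= (p + 2) ^ k.+1.
Proof.
elim: k => [|k IH]; first by rewrite !expn1 expn0 !muln1.
rewrite [leqRHS]expnS; apply: leq_trans (leq_mul (leqnn (p + 2)) IH).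
by rewrite !expnS; move: (p ^ k) => u; clear; nia.
Qed.

Section PrimePowers.
Variables b s e : nat.
Hypothesis sb : s ^ 2 <= (4 * e - 2) * b.
Hypothesis b0 : 0 < b.
Hypothesis e0 : 0 < e.
Let T := b + 1 + s.

(** If m and m + 2N are among the roots, then 4Nm <= s, whereas m^2 > b and
    s^2 < 4 e b. *)
Lemma odd_squares_count (r : seq nat) : uniq r -> all odd r -> all (fun x => b < x ^ 2 <= T) r ->
  4 * (size r).-1 ^ 2 < e.
Proof.
move=> ur odr alr; case sz: (size r) => [|N] //=.
have [m [M [mr Mr le]]] := odd_spread ur odr sz.
have /andP[bm _] := allP alr m mr; have /andP[_ MT] := allP alr M Mr.
have h1 : (m + 2 * N) ^ 2 <= T by apply: leq_trans MT; rewrite leq_exp2r.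
have h2 : 4 * N * m <= s by move: h1 bm; rewrite /T; clear; nia.
have h3 : (4 * N * m) ^ 2 <= s ^ 2 by rewrite leq_exp2r.
have h4 : (4 * N) ^ 2 * m ^ 2 <= (4 * e - 2) * b by rewrite -expnMn; apply: leq_trans sb.
have h5 : (4 * N) ^ 2 * b <= (4 * N) ^ 2 * m ^ 2 by rewrite leq_mul2l (ltnW bm) orbT.
have h6 : (4 * N) ^ 2 <= 4 * e - 2 by rewrite -(leq_pmul2r b0); apply: leq_trans h4.
by move: h6 e0; clear; rewrite expnMn; lia.
Qed.

(** As for squares, with 6 N m^2 <= s and m^3 > b; the spare factor m >= 3 gains 3. *)
Lemma odd_cubes_count (r : seq nat) : uniq r -> all odd r -> all (fun x => 2 < x) r ->
  all (fun x => b < x ^ 3 <= T) r -> 27 * (size r).-1 ^ 2 <= e.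
Proof.
move=> ur odr gr alr; case sz: (size r) => [|N] //=.
have [m [M [mr Mr le]]] := odd_spread ur odr sz.
have /andP[bm _] := allP alr m mr; have /andP[_ MT] := allP alr M Mr; have m3 := allP gr m mr.
have h1 : (m + 2 * N) ^ 3 <= T by apply: leq_trans MT; rewrite leq_exp2r.
have h2 : 6 * N * m ^ 2 <= s.
  have e1 : (m + 2 * N) ^ 3 = m ^ 3 + 6 * N * m ^ 2 + 12 * m * N ^ 2 + 8 * N ^ 3.
    by rewrite !expnS !expn0; clear; lia.
  by move: h1 bm; rewrite e1 /T; clear; lia.
have h3 : (6 * N * m ^ 2) ^ 2 <= (4 * e - 2) * b by apply: leq_trans sb; rewrite leq_exp2r.
have h4 : 36 * N ^ 2 * m * b <= (6 * N * m ^ 2) ^ 2.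
  have -> : (6 * N * m ^ 2) ^ 2 = 36 * N ^ 2 * m * m ^ 3 by rewrite !expnS !expn0; clear; lia.
  by rewrite leq_mul2l (ltnW bm) orbT.
have h5 : 36 * N ^ 2 * m <= 4 * e - 2 by rewrite -(leq_pmul2r b0); apply: leq_trans h3.
have : 36 * N ^ 2 * 3 <= 36 * N ^ 2 * m by rewrite leq_mul2l m3 orbT.
by move: h5; clear; lia.
Qed.

Hypothesis be : e ^ 2 <= b.

(** The gap between the k-th powers is at least 2k p^(k-1), and
    p^(k-2) >= e because p^(5(k-2)) >= p^(3k) > b^3 >= e^6. *)
Lemma odd_power_unique k p q : 4 < k -> 0 < p -> p + 2 <= q -> b < p ^ k -> q ^ k <= T -> False.
Proof.
move=> k5 p0 pq bp qT.
have h1 : p ^ k + 2 * k * p ^ k.-1 <= q ^ k.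
  apply: leq_trans (_ : (p + 2) ^ k <= _); last by rewrite leq_exp2r //; clear -k5; lia.
  by case: k k5 {bp qT} => // k _; apply: expn_bernoulli.
have h2 : 2 * k * p ^ k.-1 <= s by move: h1 bp qT; rewrite /T; clear; lia.
have h3 : (2 * k * p ^ k.-1) ^ 2 <= (4 * e - 2) * b by apply: leq_trans sb; rewrite leq_exp2r.
have e1 : (p ^ k.-1) ^ 2 = p ^ k * p ^ (k - 2).
  by rewrite -expnM -expnD; congr (_ ^ _); clear -k5; lia.
have pe : e <= p ^ (k - 2).
  rewrite leqNgt; apply/negP => lt.
  have : (p ^ (k - 2)) ^ 5 <= e ^ 5 by rewrite leq_exp2r // ltnW.
  have : p ^ (k * 3) <= (p ^ (k - 2)) ^ 5.
    by rewrite -expnM leq_pexp2l //; clear -k5; lia.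
  have : e ^ 5 <= b ^ 3.
    apply: leq_trans (_ : e ^ 6 <= _); first by rewrite leq_pexp2l.
    by rewrite -[6]/(2 * 3) expnM leq_exp2r.
  have : b ^ 3 < p ^ (k * 3) by rewrite expnM ltn_exp2r.
  by clear; lia.
have : (2 * k) ^ 2 * (b * e) <= (4 * e - 2) * b.
  apply: leq_trans h3; rewrite [leqRHS]expnMn e1 leq_mul2l; apply/orP; right.
  by apply: leq_mul => //; apply: ltnW.
have : 100 <= (2 * k) ^ 2 by rewrite -[100]/(10 ^ 2) leq_exp2r //; clear -k5; lia.
have : 0 < b * e by rewrite muln_gt0 b0.
by clear; nia.
Qed.
End PrimePowers.

(** The primes up to b that have a power in the interval (b, T]. *)
Definition support (b T : nat) : seq nat :=
  [seq p <- iota 0 b.+1 | prime p && (p ^ (trunc_log p b).+1 <= T)].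

(** Compared prime by prime: Phi contributes only primes of the support, each once. *)
Lemma dvdn_support G m Phi b T : 0 < G -> 0 < m -> 0 < Phi -> G %| m * Phi ->
  (forall p, prime p -> p %| G -> p <= b) ->
  (forall p, prime p -> logn p Phi <= (p ^ (trunc_log p b).+1 <= T)) ->
  G %| m * \prod_(p <- support b T) p.
Proof.
move=> G0 m0 P0 GD Gb lg; apply/dvdn_partP => // p; rewrite mem_primes => /and3P[pp _ pG].
have Pr : 0 < \prod_(p <- support b T) p.
  by rewrite big_seq prodn_cond_gt0 // => q; rewrite mem_filter => /andP[/andP[/prime_gt0]].
rewrite p_part pfactor_dvdn ?muln_gt0 ?m0 //.
apply: leq_trans (_ : logn p (m * Phi) <= _); first by rewrite dvdn_leq_log // muln_gt0 m0.
rewrite !lognM // leq_add2l; apply: leq_trans (lg p pp) _.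
case: (leqP (p ^ (trunc_log p b).+1) T) => // le; rewrite -pfactor_dvdn // expn1.
have ps : p \in support b T by rewrite mem_filter pp le mem_iota add0n ltnS Gb.
by rewrite (big_rem p ps) /= dvdn_mulr.
Qed.

Lemma ffact_ge n m : m <= n -> (n - m) ^ m <= n ^_ m.
Proof.
elim: m n => [|m IH] [|n] //; rewrite ltnS => mn.
rewrite ffactSS expnS subSS leq_mul ?IH //.
by apply: leq_trans (leq_subr m n) _.
Qed.

(** The product of the roots t divides e!^2 times the product over the support, while
    the product of the n + 1 - t is at most T^e; together they equal e!^2 Phi, which is at least
    w(w-1)..(w-e+1) b(b-1)..(b-e+1). *)
Lemma feas_product w b e : feasible w b e -> 2 < e -> 16 * e - 8 <= b ->
  exists s, [/\ s ^ 2 <= (4 * e - 2) * b,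
    forall p, prime p -> p %| ball_size w b e -> p ^ (trunc_log p b).+1 <= b + 1 + s &
    (w - e) ^ e * (b - e) ^ e <= (b + 1 + s) ^ e * (e`! ^ 2 * \prod_(p <- support b (b + 1 + s)) p)].
Proof.
move=> F e3 eb; have [s [ts [[sz us] al pr [sb _] lg]]] := feas_carry_half F e3 eb.
have wb := feas_le F; have wl := feas_large F.
exists s; split => //.
  move=> p pp pP; have := lg p pp; case: (_ <= b + 1 + s) => //.
  by rewrite leqn0 lognE pp ball_size_gt0 pP.
set T := b + 1 + s; set G := \prod_(t <- ts) t.
have G0 : 0 < G.
  by rewrite /G big_seq prodn_cond_gt0 // => t tin; have /andP[/andP[]] := allP al t tin.
have GD : G %| e`! ^ 2 * ball_size w b e by rewrite -pr big_split /= dvdn_mulr.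
have GS : G %| e`! ^ 2 * \prod_(p <- support b T) p.
  apply: (dvdn_support G0 _ (ball_size_gt0 w b e) GD) => //; first by rewrite expn_gt0 fact_gt0.
  move=> p pp; rewrite /G big_seq Euclid_dvd_prod // big_has_cond => /hasP[t tin /andP[_ pt]].
  have /andP[/andP[t0 tw] _] := allP al t tin.
  by apply: leq_trans (leq_trans (dvdn_leq t0 pt) tw) wb.
have S0 : 0 < e`! ^ 2 * \prod_(p <- support b T) p.
  rewrite muln_gt0 expn_gt0 fact_gt0 /= big_seq prodn_cond_gt0 // => q.
  by rewrite mem_filter => /andP[/andP[/prime_gt0]].
apply: leq_trans (_ : T ^ e * G <= _); last by rewrite leq_mul2l dvdn_leq ?orbT.
apply: leq_trans (_ : e`! ^ 2 * ball_size w b e <= _).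
  apply: leq_trans (_ : (w ^_ e) * (b ^_ e) <= _).
    by apply: leq_mul; apply: ffact_ge; move: wl wb; clear; nia.
  rewrite -!bin_ffact /ball_size big_ord_recr /= mulnDr -[X in X <= _]add0n leq_add //.
  by rewrite -mulnn; clear; lia.
rewrite -pr big_split /= -/G [leqLHS]mulnC leq_mul2r; apply/orP; right.
have -> : T ^ e = \prod_(t <- ts) T by rewrite big_const_seq count_predT sz iter_muln_1.
rewrite [leqLHS]big_seq [leqRHS]big_seq; apply: leq_prod => t tin.
by have /andP[] := allP al t tin.
Qed.

(** * Determinants of exponential type *)

(** Distinct exponents sum to at least 0 + 1 + .. + (size s - 1). *)
Lemma uniq_sumn_ge (s : seq nat) : uniq s -> 'C(size s, 2) <= sumn s.
Proof.
have [k] := ubnP (size s); elim: k s => // k IHk s lt_sk uniq_s.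
have [/size0nil-> //|s_gt0] := posnP (size s).
have [x xs x_ge] : exists2 x, x \in s & (size s).-1 <= x.
  apply/hasP; apply: contraT => /hasPn small.
  suff: size s <= size (iota 0 (size s).-1) by rewrite size_iota -ltnS prednK // ltnn.
  apply: uniq_leq_size => // y ys; rewrite mem_iota /=.
  by have := small y ys; rewrite -ltnNge.
have szs : size s = (size (rem x s)).+1 by rewrite (perm_size (perm_to_rem xs)).
rewrite (perm_sumn (perm_to_rem xs)) szs binS bin1 /=.
rewrite addnC leq_add //; first by move: x_ge; rewrite szs.
by apply: IHk; rewrite ?rem_uniq //; move: lt_sk; rewrite szs.
Qed.

Lemma bin2_add_le s m t : 'C(s, 2) <= t -> 'C(s + m, 2) <= t + m * (s + m).
Proof.
move=> le_st; have h x : 'C(x, 2) * 2 = x * x.-1.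
  by case: x => // x; rewrite mulnC -mul_bin_diag bin1.
have := h s; have := h (s + m); nia.
Qed.

Local Open Scope ring_scope.

Lemma det_le_prod (R : numDomainType) (N : nat) (V : 'M[R]_N) (t : 'I_N -> R) :
  (forall i j, `|V i j| <= t i) -> `|\det V| <= N`!%:R * \prod_i t i.
Proof.
move=> V_le; rewrite /determinant (le_trans (ler_norm_sum _ _ _)) //.
apply: le_trans (_ : \sum_(s : 'S_N) \prod_i t i <= _); last first.
  by rewrite sumr_const cardT -cardE card_Sn mulr_natl.
apply: ler_sum => s _; rewrite normrM normrX normrN1 expr1n mul1r normr_prod.
by apply: ler_prod => i _; rewrite normr_ge0 V_le.
Qed.

Lemma det_scale_rows (R : comNzRingType) (N : nat) (al : 'I_N -> R)
    (V : 'I_N -> 'I_N -> R) :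
  \det (\matrix_(i, j) (al i * V i j)) = (\prod_i al i) * \det (\matrix_(i, j) V i j).
Proof.
have -> : \matrix_(i, j) (al i * V i j)
    = diag_mx (\row_i al i) *m (\matrix_(i, j) V i j).
  by apply/matrixP=> i j; rewrite mul_diag_mx !mxE.
by rewrite det_mulmx det_diag; congr (_ * _); apply: eq_bigr => i _; rewrite mxE.
Qed.

(** The maximum principle behind interpolation determinants. Expanding every column into its
    monomials and its error term makes the determinant a sum of determinants, and one
    with two equal exponents vanishes. In the others the exponents add up to at least
    'C(N, 2), where an error column counts as exponent N; this is the gain in the power of rho. *)
Lemma det_interpolation_le (R : realFieldType) (N M : nat) (z : 'I_N -> R)
    (k : 'I_N -> nat) (a : 'I_N -> 'I_M -> R) (E A : 'M[R]_N) (eps : 'I_N -> R)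
    (rho : R) :
  (forall j, 0 <= z j <= 1) -> 1 <= rho -> (forall j c, `|E j c| <= eps c) ->
  (forall j c, A j c = \sum_mu a c mu * z j ^+ (k c + mu) + E j c) ->
  `|\det A| * rho ^+ 'C(N, 2) <=
    N`!%:R * \prod_c (\sum_mu `|a c mu| * rho ^+ (k c + mu) + eps c * rho ^+ N).
Proof.
move=> z01 rho1 E_le A_eq.
have eps0 c : 0 <= eps c by apply: le_trans (E_le c c).
have rho0 : 0 <= rho by apply: le_trans rho1.
(* None stands for the error term of a column *)
pose al c (o : option 'I_M) := if o is Some mu then a c mu else 1.
pose V c (o : option 'I_M) j := if o is Some mu then z j ^+ (k c + mu) else E j c.
pose t c (o : option 'I_M) := if o is Some mu then 1 else eps c.
pose d c (o : option 'I_M) := if o is Some mu then (k c + mu)%N else N.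
have optE (F : option 'I_M -> R) : \sum_o F o = \sum_mu F (Some mu) + F None.
  rewrite (bigD1 None) //= addrC; congr (_ + _).
  rewrite (reindex_omap Some id) => [|[mu|] //].
  by apply: eq_bigl => mu; rewrite eqxx.
have AE j c : A j c = \sum_o al c o * V c o j by rewrite A_eq optE mul1r.
have detA : \det A =
    \sum_(g : {ffun 'I_N -> option 'I_M}) \det (\matrix_(c, j) (al c (g c) * V c (g c) j)).
  rewrite -det_tr /determinant exchange_big; apply: eq_bigr => s _ /=.
  rewrite -big_distrr /=; congr (_ * _).
  under eq_bigr => c _ do rewrite mxE AE.
  rewrite bigA_distr_bigA; apply: eq_bigr => g _.
  by apply: eq_bigr => c _; rewrite mxE.
have -> : \prod_c (\sum_mu `|a c mu| * rho ^+ (k c + mu) + eps c * rho ^+ N) =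
    \sum_(g : {ffun 'I_N -> option 'I_M}) \prod_c (`|al c (g c)| * t c (g c) * rho ^+ d c (g c)).
  rewrite -(bigA_distr_bigA (fun c o => `|al c o| * t c o * rho ^+ d c o)) /=.
  apply: eq_bigr => c _; rewrite optE /= normr1 mul1r; congr (_ + _).
  by apply: eq_bigr => mu _; rewrite mulr1.
rewrite detA mulr_sumr; apply: le_trans (ler_wpM2r (exprn_ge0 _ rho0) (ler_norm_sum _ _ _)) _.
rewrite mulr_suml; apply: ler_sum => g _; rewrite det_scale_rows normrM normr_prod.
rewrite -mulrA 2!big_split /= -mulrA [leRHS]mulrCA; apply: ler_wpM2l; first exact: prodr_ge0.
have t_ge c o : 0 <= t c o by case: o => //=.
have V_le c j : `|V c (g c) j| <= t c (g c).
  rewrite /V /t; case: (g c) => [mu|]; last exact: E_le.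
  have /andP[z0 z1] := z01 j.
  by rewrite ger0_norm ?exprn_ge0 // exprn_ile1.
have [|inj] := boolP [exists c1, exists c2, [&& c1 != c2, g c1 != None, g c2 != None
      & d c1 (g c1) == d c2 (g c2)]].
  case/existsP=> c1 /existsP[c2 /and4P[ne12 g1 g2 /eqP e12]].
  rewrite (determinant_alternate ne12) ?normr0 ?mul0r; last first.
    move=> j; rewrite !mxE /V; move: g1 g2 e12.
    by case: (g c1) => // mu1 _; case: (g c2) => // mu2 _ /= ->.
  by rewrite mulr_ge0 ?ler0n // mulr_ge0 // prodr_ge0 // => c _; rewrite exprn_ge0.
rewrite mulrA; apply: ler_pM; rewrite ?exprn_ge0 //.
  by apply: det_le_prod => c j; rewrite mxE V_le.
rewrite prodrXr ler_weXn2l //.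
pose S := enum [pred c | g c != None].
have uS : uniq [seq d c (g c) | c <- S].
  rewrite map_inj_in_uniq ?enum_uniq // => c1 c2.
  rewrite !mem_enum !inE => g1 g2 /eqP e12.
  apply: contraNeq inj => ne12; apply/existsP; exists c1; apply/existsP; exists c2.
  by rewrite ne12 g1 g2 e12.
have := bin2_add_le (N - size S) (uniq_sumn_ge uS); rewrite size_map.
have SN : (size S <= N)%N by rewrite -cardE (leq_trans (max_card _)) ?card_ord.
rewrite subnKC // => /leq_trans -> //.
rewrite (bigID (fun c => g c != None)) /= leq_add //.
  by rewrite sumnE big_map big_enum.
rewrite (eq_bigr (fun=> N)) => [|c]; last by rewrite negbK => /eqP ->.
rewrite sum_nat_const leq_mul2r; apply/orP; right.
rewrite leq_subLR -cardE -[leqLHS](card_ord N) -(cardC [pred c | g c != None]).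
by rewrite leq_add2l; apply/eq_leq/eq_card.
Qed.

Lemma coef_top_mul (R : nzRingType) (p q : {poly R}) a b :
  (size p <= a.+1)%N -> (size q <= b.+1)%N -> (p * q)`_(a + b) = p`_a * q`_b.
Proof.
move=> sp sq; have lt_a : (a < (a + b).+1)%N by lia.
rewrite coefM (bigD1 (Ordinal lt_a)) //= addKn big1 ?addr0 // => j /eqP ne_j.
have [lt_j|le_j] := ltnP a j.
  by rewrite [p`_j]nth_default ?mul0r // (leq_trans sp).
rewrite [q`_ _]nth_default ?mulr0 // (leq_trans sq) //.
have : nat_of_ord j <> a by move=> ja; apply: ne_j; apply: val_inj.
by lia.
Qed.

Lemma coef_top_prod (R : comNzRingType) (I : Type) (r : seq I) (p : I -> {poly R}) (d : I -> nat) :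
  (forall i, (size (p i) <= (d i).+1)%N) ->
  (size (\prod_(i <- r) p i)%R <= (\sum_(i <- r) d i).+1)%N /\
  (\prod_(i <- r) p i)`_(\sum_(i <- r) d i) = \prod_(i <- r) (p i)`_(d i).
Proof.
move=> sp; elim: r => [|i r [IHs IHc]]; first by rewrite !big_nil size_poly1 coef1.
rewrite !big_cons; split; last by rewrite coef_top_mul // IHc.
apply: leq_trans (size_polyMleq _ _) _.
have := sp i; move: IHs; move: (\prod_(_ <- _) _) => q; lia.
Qed.

Lemma det_coef_top (R : comNzRingType) (m : nat) (M : 'M[{poly R}]_m) (d : 'I_m -> nat) :
  (forall i j, (size (M i j) <= (d j).+1)%N) ->
  (size (\det M)%R <= (\sum_j d j).+1)%N /\
  (\det M)`_(\sum_j d j) = \det (\matrix_(i, j) (M i j)`_(d j)).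
Proof.
move=> sM; have h (s : 'S_m) := coef_top_prod (index_enum 'I_m) (fun j => sM (s j) j).
split; last rewrite -[RHS]det_tr; rewrite -[\det M]det_tr /determinant.
  apply: leq_trans (size_sum _ _ _) _; apply/bigmax_leqP => s _.
  under eq_bigr => j _ do rewrite mxE.
  rewrite -signr_odd; case: odd; rewrite ?expr1 ?expr0 ?mulN1r ?mul1r ?size_polyN; exact: (h s).1.
rewrite coef_sum; apply: eq_bigr => s _.
have hs := (h s).2; under eq_bigr => j _ do rewrite mxE.

under [in RHS]eq_bigr => j _ do rewrite !mxE.
rewrite -hs -signr_odd -[in RHS]signr_odd.
by case: odd; rewrite ?expr1 ?expr0 ?mulN1r ?mul1r ?coefN.
Qed.

(** An exponential polynomial with coefficients P_j of degree at most K cannot vanish along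
    l translates of too many points: eliminating the exponentials from the l equations
    at a point shows that the point is a root of one fixed determinant, which is not
    zero because its top coefficient is a Vandermonde determinant. *)
Lemma zero_estimate (F : numFieldType) (K l : nat) (P : 'I_l -> {poly F})
    (ga g : F) (pts : seq (F * F)) :
  (forall j, size (P j) <= K.+1)%N -> (exists j, P j != 0) -> 1 < g ->
  uniq [seq u.1 | u <- pts] -> all (fun u => u.2 != 0) pts ->
  (forall u, u \in pts -> forall i : nat, (i < l)%N ->
     \sum_j (P j).[u.1 + ga *+ i] * (g ^+ i * u.2) ^+ j = 0) ->
  (size pts <= K * l)%N.
Proof.
move=> sP [j0 nz_j0] g1 uniq_pts nz_pts vanish.
pose J := [pred j | P j != 0]; pose m := #|J|.
have le_ml : (m <= l)%N by rewrite -[leqRHS]card_ord max_card.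
pose ev (a : 'I_m) : 'I_l := enum_val a.
have evP a : P (ev a) != 0 by have := enum_valP a.
have m_gt0 : (0 < m)%N by apply/card_gt0P; exists j0.
pose D : 'M[{poly F}]_m := \matrix_(i, a)
  (((g ^+ i) ^+ ev a) *: (P (ev a) \Po ('X + (ga *+ i)%:P))).
pose d a := (size (P (ev a))).-1.
have g0 : 0 < g by apply: lt_trans g1.
have szD i a : (size (D i a) <= (d a).+1)%N.
  rewrite mxE (leq_trans (size_scale_leq _ _)) // size_comp_poly2 ?size_XaddC //.
  by rewrite /d prednK ?size_poly_gt0.
have [sD cD] := det_coef_top szD.
have topD : \det (\matrix_(i, j) (D i j)`_(d j)) != 0.
  have -> : \matrix_(i, j) (D i j)`_(d j) =
      Vandermonde m (\row_a (g ^+ ev a)) *m diag_mx (\row_a lead_coef (P (ev a))).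
    apply/matrixP=> i a; rewrite mul_mx_diag !mxE coefZ -!exprM mulnC; congr (_ * _).
    have sX : size ('X + (ga *+ i)%:P) = 2 by rewrite size_XaddC.
    have := lead_coef_comp (P (ev a)) (q := 'X + (ga *+ i)%:P).
    rewrite sX lead_coefXaddC expr1n mulr1 => /(_ isT) <-.
    by rewrite lead_coefE size_comp_poly2 // sX.
  rewrite det_mulmx det_diag det_Vandermonde mulf_neq0 //.
    apply/prodf_neq0 => i _; apply/prodf_neq0 => j lt_ij; rewrite !mxE subr_eq0.
    rewrite (inj_eq (ieexprIn g0 (negbT (gt_eqF g1)))) (inj_eq val_inj) (inj_eq enum_val_inj).
    by rewrite -val_eqE gtn_eqF.
  by apply/prodf_neq0 => a _; rewrite mxE lead_coef_eq0.
have nzD : \det D != 0 by apply: contraNneq topD => D0; rewrite -cD D0 coef0.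
have roots : all (root (\det D)) [seq u.1 | u <- pts].
  apply/allP => x /mapP[u u_pts ->]; rewrite /root -horner_evalE -det_map_mx.
  rewrite -det_tr; apply/det0P; exists (\row_a u.2 ^+ ev a).
    apply/negP => /eqP/matrixP /(_ 0 (Ordinal m_gt0)); rewrite !mxE => /eqP.
    by rewrite expf_eq0 (negPf (allP nz_pts _ u_pts)) andbF.
  apply/matrixP => z i; rewrite !mxE.
  rewrite -[RHS](vanish u u_pts i (leq_trans (ltn_ord i) le_ml)).
  rewrite [RHS](bigID (mem J)) /= [X in _ = _ + X]big1 ?addr0; last first.
    by move=> j; rewrite inE negbK => /eqP ->; rewrite horner0 mul0r.
  rewrite [RHS]big_enum_val /=; apply: eq_bigr => a _.
  rewrite !mxE horner_evalE hornerZ horner_comp !hornerE exprMn -/(ev a) /=.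
  by rewrite [RHS]mulrC [_ ^+ _ * (u.2 ^+ _)]mulrC.
have := max_poly_roots nzD roots; rewrite size_map => /(_ uniq_pts).
move=> /leq_trans /(_ sD); rewrite ltnS => /leq_trans; apply.
apply: leq_trans (_ : \sum_(a < m) K <= _)%N; last by rewrite sum_nat_const card_ord mulnC leq_mul.
by apply: leq_sum => a _; have := sP (ev a); rewrite /d; case: size.
Qed.

Lemma ltn_mulD (a b s r : nat) : (r < a -> s < b -> r * b + s < a * b)%N.
Proof. by move=> ra sb; apply: leq_trans (leq_mul ra (leqnn b)); rewrite mulSn addnC ltn_add2r. Qed.

(** By [zero_estimate] no nontrivial combination of the functions x^k y^j vanishes at all points
    (r ga + s be, p^r q^s) of the grid; so the matrix of their values has full rank, and
    some choice of rows gives a nonzero minor. *)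
Lemma nonzero_minor (K l Rr S p q be ga : nat) :
  (1 < p)%N -> (0 < q)%N -> (0 < l)%N -> (K * l < Rr * S)%N ->
  (forall r s r' s', r < Rr -> s < S -> r' < Rr -> s' < S ->
     r * ga + s * be = r' * ga + s' * be -> r = r' /\ s = s')%N ->
  exists f : 'I_(K.+1 * l) -> nat * nat,
    (forall i, (f i).1 < Rr + l /\ (f i).2 < S)%N /\
    \det (\matrix_(i, c) (((f i).1 * ga + (f i).2 * be) ^ (c %/ l) *
          (p ^ (f i).1 * q ^ (f i).2) ^ (c %% l))%:Z) != 0.
Proof.
move=> p1 q0 l0 lt_KS x_inj; set N := (K.+1 * l)%N.
have S0 : (0 < S)%N by move: lt_KS; rewrite lt0n; apply: contraTneq => ->; rewrite muln0.
(* l extra values of r leave room for the translates in the zero estimate *)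
pose W := ((Rr + l) * S)%N.
pose g (a : 'I_W) := (a %/ S, a %% S)%N.
have gP a : ((g a).1 < Rr + l)%N /\ ((g a).2 < S)%N by rewrite ltn_divLR // ltn_mod.
pose e (u : nat * nat) (c : nat) : nat :=
  ((u.1 * ga + u.2 * be) ^ (c %/ l) * (p ^ u.1 * q ^ u.2) ^ (c %% l))%N.
pose G : 'M[rat]_(W, N) := \matrix_(a, c) (e (g a) c)%:R.
suff fullG : row_full G.
  pose f := fullrankfun fullG; exists (g \o f); split=> [i|]; first exact: gP.
  have : rowsub f G \in unitmx by rewrite -row_full_unit fullrowsub_full.
  rewrite unitmxE unitfE; apply: contraNneq => det0.
  have -> : rowsub f G = map_mx intr (\matrix_(i, c) (e (g (f i)) c)%:Z).
    by apply/matrixP=> i c; rewrite !mxE -pmulrn.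
  by rewrite det_map_mx det0.
have [//|/negbTE nfull] := boolP (row_full G).
have : kermx G^T != 0 by rewrite kermx_eq0 /row_free mxrank_tr -/(row_full G) nfull.
case/rowV0Pn=> v /sub_kermxP vG nz_v.
have idx k j : (k < K.+1)%N -> (j < l)%N -> (k * l + j < N)%N by exact: ltn_mulD.
pose V (c : nat) := if insub c is Some i then v 0 (i : 'I_N) else 0.
pose P (j : 'I_l) := \poly_(k < K.+1) V (k * l + j)%N.
pose pts := [seq ((u.1 * ga + u.2 * be)%:R, (p ^ u.1 * q ^ u.2)%:R) : rat * rat |
  u <- [seq (r, s) | r <- iota 0 Rr, s <- iota 0 S]].
have : (size pts <= K * l)%N.
  apply: (@zero_estimate rat K l P ga%:R p%:R pts).
  - by move=> j; rewrite size_poly.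
  - case/rV0Pn: nz_v => c nz_c.
    have lt_j : (c %% l < l)%N by rewrite ltn_mod.
    exists (Ordinal lt_j); apply/eqP => P0.
    have := coef_poly K.+1 (fun k => V (k * l + c %% l)%N) (c %/ l).
    rewrite -/(P (Ordinal lt_j)) P0 coef0 ltn_divLR // ltn_ord -divn_eq /V valK => e0.
    by rewrite -e0 eqxx in nz_c.
  - by rewrite ltr1n.
  - rewrite -map_comp map_inj_in_uniq.
      by apply: allpairs_uniq; rewrite ?iota_uniq // => -[? ?] [? ?].
    move=> _ _ /allpairsP[[r s] [/= + + ->]] /allpairsP[[r' s'] [/= + + ->]].
    rewrite !mem_iota /= => rR sS rR' sS' /eqP; rewrite eqr_nat => /eqP.
    by case/(x_inj _ _ _ _ rR sS rR' sS') => -> ->.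
  - apply/allP => _ /mapP[u _ ->] /=; rewrite pnatr_eq0 -lt0n muln_gt0 !expn_gt0 q0.
    by rewrite (ltnW p1).
  move=> _ /mapP[_ /allpairsP[[r s] [+ + ->]] ->] i lt_il; rewrite !mem_iota /= => rR sS.
  have lt_a : ((r + i) * S + s < W)%N by apply: ltn_mulD => //; lia.
  have := congr1 (fun M : 'rV_W => M 0 (Ordinal lt_a)) vG; rewrite !mxE => vG0; rewrite -[RHS]vG0.
  have gE : g (Ordinal lt_a) = (r + i, s)%N.
    by rewrite /g /= divnMDl // modnMDl divn_small // modn_small // addn0.
  transitivity (\sum_(j < l) \sum_(k < K.+1) V (k * l + j)%N * (e (r + i, s)%N (k * l + j)%N)%:R).
    apply: eq_bigr => j _; rewrite horner_poly mulr_suml; apply: eq_bigr => k _.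
    rewrite /e /= divnMDl // modnMDl divn_small // modn_small // addn0 -mulrA.
    congr (_ * _); rewrite [RHS]natrM [X in _ = X * _]natrX [X in _ = _ * X]natrX; congr (_ ^+ _ * _ ^+ _).
      by rewrite -[_ *+ i]mulr_natr -natrM -natrD; congr _%:R; lia.
    by rewrite expnD -natrX -natrM; congr _%:R; lia.
  rewrite exchange_big /= pair_bigA /=.
  have divl (c : 'I_N) : (c %/ l < K.+1)%N by rewrite ltn_divLR.
  have modl (c : 'I_N) : (c %% l < l)%N by rewrite ltn_mod.
  pose h (u : 'I_K.+1 * 'I_l) : 'I_N := Ordinal (idx _ _ (ltn_ord u.1) (ltn_ord u.2)).
  rewrite [RHS](reindex h) /=; last first.
    exists (fun c => (Ordinal (divl c), Ordinal (modl c))) => [[k j]|c] _.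
      congr (_, _); apply: val_inj => /=; first by rewrite divnMDl // divn_small // addn0.
      by rewrite modnMDl modn_small.
    by apply: val_inj; rewrite /= -divn_eq.
  apply: eq_bigr => u _; rewrite !mxE gE; congr (_ * _).
  by rewrite /V -[(_ * l + _)%N]/(val (h u)) valK.
rewrite size_map size_allpairs !size_iota leqNgt lt_KS //.
Qed.

(** * A lower bound for a difference of two logarithms *)

From mathcomp Require Import mathcomp_extra boolp classical_sets functions reals.
From mathcomp Require Import topology normedtype sequences exp.
Import numFieldNormedType.Exports.
Local Open Scope classical_set_scope.

Lemma exp_partial_near (R : realType) (x eps : R) : 0 < eps ->
  exists M, forall M', (M <= M')%N ->
    `|expR x - \sum_(i < M') x ^+ i / i`!%:R| <= eps.
Proof.
move=> eps0; have /cvgrPdist_le /(_ _ eps0) [M _ h] := is_cvg_series_exp_coeff x.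
exists M => M' leM; have := h M' leM; rewrite /= /series /= big_mkord.
exact.
Qed.

Lemma exp_partial_le (R : realType) (x : R) M : 0 <= x ->
  \sum_(i < M) x ^+ i / i`!%:R <= expR x.
Proof.
move=> x0; rewrite leNgt; apply/negP => lt.
pose d := (\sum_(i < M) x ^+ i / i`!%:R - expR x) / 2.
have d0 : 0 < d by rewrite divr_gt0 // subr_gt0.
have [M0 h] := exp_partial_near x d0.
have := h (maxn M M0) (leq_maxr _ _); set S := \sum_(i < maxn _ _) _.
have : \sum_(i < M) x ^+ i / i`!%:R <= S.
  rewrite /S -!(big_mkord xpredT (fun i => x ^+ i / i`!%:R)) [leRHS](big_cat_nat _ (leq_maxl M M0)) //=.
  by rewrite lerDl sumr_ge0 // => i _; rewrite divr_ge0 ?exprn_ge0.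
rewrite ler_norml /d => ? /andP[? ?]; lra.
Qed.

Lemma expR1_le3 (R : realType) : expR 1 <= 3 :> R.
Proof.
have h : (5 / 6 : R) <= expR (- (1 / 6)) by apply: le_trans (expR_ge1Dx _); lra.
have : (5 / 6 : R) ^+ 6 <= expR (- 1).
  have -> : expR (-1) = expR (- (1 / 6)) ^+ 6 :> R by rewrite -expRM_natr; congr expR; lra.
  by rewrite ler_pXn2r // nnegrE ?expR_ge0 //; lra.
move=> h6; have h3 : (1 / 3 : R) <= expR (- 1) by apply: le_trans h6; lra.
rewrite -[leLHS]invrK -expRN -[leRHS]invrK lef_pV2 ?posrE ?expR_gt0 ?invr_gt0 //.
by rewrite -div1r.
Qed.

Lemma expR_dist (R : realType) (u v B : R) : u <= B -> v <= B ->
  `|expR u - expR v| <= expR B * `|u - v|.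
Proof.
have main (a b : R) : a <= b -> b <= B -> `|expR a - expR b| <= expR B * `|a - b|.
  move=> ab bB; rewrite distrC (distrC a) !ger0_norm ?subr_ge0 ?ler_expR //.
  have -> : expR b - expR a = expR b * (1 - expR (a - b)).
    by rewrite mulrBr mulr1 -expRD addrCA subrr addr0.
  apply: ler_pM; rewrite ?expR_ge0 ?ler_expR //.
    by rewrite subr_ge0 -expR0 ler_expR subr_le0.
  by have := expR_ge1Dx (a - b); lra.
move=> uB vB; have [uv|vu] := leP u v; first exact: main.
by rewrite distrC (distrC u); apply: main => //; apply: ltW.
Qed.

Local Close Scope classical_set_scope.

Lemma ln_dist_nat (R : realType) (a b : nat) (B : R) : (0 < a)%N -> (0 < b)%N -> a != b ->
  a%:R <= B -> b%:R <= B -> B^-1 <= `|ln a%:R - ln b%:R|.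
Proof.
have main (u v : nat) : (0 < u)%N -> (u < v)%N -> v%:R <= B -> B^-1 <= `|ln u%:R - ln v%:R|.
  move=> u0 uv vB; have v0 : (0 < v)%N by apply: ltn_trans uv.
  have u0r : (0 : R) < u%:R by rewrite ltr0n.
  have v0r : (0 : R) < v%:R by rewrite ltr0n.
  have vu : ln u%:R <= ln v%:R :> R by rewrite ler_ln ?posrE // ler_nat ltnW.
  rewrite distrC ger0_norm ?subr_ge0 //.
  have -> : ln v%:R - ln u%:R = - ln (1 + (u%:R / v%:R - 1)) :> R.
    by rewrite addrCA subrr addr0 ln_div ?posrE // opprB.
  have le1 : ln (1 + (u%:R / v%:R - 1)) <= u%:R / v%:R - 1 :> R.
    by apply: le_ln1Dx; rewrite -[ltLHS]add0r ltrD2r divr_gt0.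
  apply: le_trans (_ : v%:R^-1 <= _); first by rewrite lef_pV2 ?posrE // (lt_le_trans v0r).
  apply: le_trans (_ : 1 - u%:R / v%:R <= _); last by rewrite lerNr opprB.
  rewrite -(ler_pM2r v0r) mulVf ?gt_eqF // mulrBl mul1r divfK ?gt_eqF //.
  by rewrite lerBrDr -(natrD _ 1) ler_nat.
move=> a0 b0 ne aB bB; have [ab|ba|/eqP] := ltngtP a b; last by rewrite (negPf ne).
  exact: main.
by rewrite distrC; apply: main.
Qed.

Lemma sum_divn (K l : nat) : (0 < l)%N -> (\sum_(c < K * l) c %/ l = l * 'C(K, 2))%N.
Proof.
move=> l0; rewrite -(big_mkord xpredT (fun c => c %/ l)%N).
elim: K => [|K IH]; first by rewrite big_geq // muln0.
rewrite mulSn addnC (big_cat_nat _ (leq_addr _ _)) //= IH -{1}[(K * l)%N]add0n big_addn addKn.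
rewrite (eq_big_nat _ _ (F2 := fun=> K)) => [|i /andP[_ il]]; last first.
  by rewrite divnDMl // divn_small.
by rewrite sum_nat_const_nat subn0 -mulnDr binS bin1 addnC.
Qed.

Lemma sum_modn (K l : nat) : (0 < l)%N -> (\sum_(c < K * l) c %% l = K * 'C(l, 2))%N.
Proof.
move=> l0; rewrite -(big_mkord xpredT (fun c => c %% l)%N).
elim: K => [|K IH]; first by rewrite big_geq.
rewrite mulSn addnC (big_cat_nat _ (leq_addr _ _)) //= IH -{1}[(K * l)%N]add0n big_addn addKn.
rewrite (eq_big_nat _ _ (F2 := id)) => [|i /andP[_ il]]; last first.
  by rewrite addnC modnMDl modn_small.
by rewrite mulSn addnC; congr addn; rewrite -bin2_sum.
Qed.

(** Two equal values would give i ga = j be with i, j < m^2; then i ln p - j ln q is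
    as small as the linear form times m^2, although p^i and q^j are distinct integers
    of moderate size. *)
Lemma comb_inj (R : realType) (p q be ga m : nat) (lam : R) :
  (1 < p)%N -> (1 < q)%N -> coprime p q -> (0 < be)%N -> (0 < ga)%N -> (0 < m)%N ->
  ln p%:R <= lam -> ln q%:R <= lam -> lam <= m%:R ->
  `|be%:R * ln p%:R - ga%:R * ln q%:R| <= expR (- (2 * m%:R ^+ 4)) :> R ->
  forall r s r' s' : nat, (r < m ^ 2)%N -> (s < m ^ 2)%N -> (r' < m ^ 2)%N -> (s' < m ^ 2)%N ->
  (r * ga + s * be = r' * ga + s' * be)%N -> r = r' /\ s = s'.
Proof.
move=> p1 q1 pq be0 ga0 m0 pl ql lm small.
have main (r s r' s' : nat) : (r < m ^ 2)%N -> (s' < m ^ 2)%N -> (s < s')%N ->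
    (r * ga + s * be = r' * ga + s' * be)%N -> False.
  move=> rm s'm ss' e; set i := (r - r')%N; set j := (s' - s)%N.
  have r'r : (r' < r)%N.
    rewrite ltnNge; apply/negP => rr'.
    have : (s * be < s' * be)%N by rewrite ltn_mul2r be0.
    have : (r * ga <= r' * ga)%N by rewrite leq_mul2r rr' orbT.
    by lia.
  have ij : (i * ga = j * be)%N by rewrite /i /j !mulnBl; lia.
  have i0 : (0 < i)%N by rewrite subn_gt0.
  have j0 : (0 < j)%N by rewrite subn_gt0.
  have im : (i < m ^ 2)%N by rewrite (leq_ltn_trans (leq_subr _ _)).
  have jm : (j < m ^ 2)%N by rewrite (leq_ltn_trans (leq_subr _ _)).
  have ne : (p ^ i != q ^ j)%N.
    apply: contraTneq pq => e1; have : coprime (p ^ i) (q ^ j) = coprime p q.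
      by rewrite coprime_pexpl // coprime_pexpr.
    move=> <-; rewrite e1 /coprime gcdnn -(expn0 q) eqn_exp2l // -lt0n.
    by rewrite j0.
  have p0r : (0 : R) < p%:R by rewrite ltr0n ltnW.
  have q0r : (0 : R) < q%:R by rewrite ltr0n ltnW.
  have mm : (m%:R ^+ 2 : R) * lam <= m%:R ^+ 4.
    have -> : (m%:R ^+ 4 : R) = m%:R ^+ 2 * m%:R ^+ 2 by rewrite -exprD.
    apply: ler_wpM2l; first exact: exprn_ge0.
    by apply: le_trans lm _; rewrite -natrX ler_nat -{1}(expn1 m) leq_pexp2l.
  have bnd (u k : nat) : (0 < u)%N -> ln u%:R <= lam -> (k < m ^ 2)%N ->
      (u ^ k)%:R <= expR (m%:R ^+ 4) :> R.
    move=> u0 ul km; have u0r : (0 : R) < u%:R by rewrite ltr0n.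
    rewrite -[leLHS]lnK ?posrE ?ltr0n ?expn_gt0 ?u0 // ler_expR natrX lnXn // -[ln _ *+ k]mulr_natl.
    apply: le_trans _ mm; apply: ler_pM => //; last by rewrite -natrX ler_nat ltnW.
    by apply: ln_ge0; rewrite ler1n.
  have := ln_dist_nat (B := expR (m%:R ^+ 4)) _ _ ne (bnd p i (ltnW p1) pl im) (bnd q j (ltnW q1) ql jm).
  rewrite !expn_gt0 !(ltnW p1) !(ltnW q1) => /(_ isT isT).
  rewrite !natrX !lnXn // -[ln _ *+ i]mulr_natl -[ln _ *+ j]mulr_natl -expRN => low.
  have ga0r : (0 : R) < ga%:R by rewrite ltr0n.
  have up : `|i%:R * ln p%:R - j%:R * ln q%:R| <= m%:R ^+ 2 * expR (- (2 * m%:R ^+ 4)) :> R.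
    have -> : i%:R * ln p%:R - j%:R * ln q%:R =
        j%:R / ga%:R * (be%:R * ln p%:R - ga%:R * ln q%:R) :> R.
      have e2 : i%:R * ga%:R = j%:R * be%:R :> R by rewrite -!natrM ij.
      have -> : i%:R = j%:R * be%:R / ga%:R :> R by rewrite -e2 mulfK ?gt_eqF.
      by field; rewrite gt_eqF.
    rewrite normrM; apply: ler_pM => //.
    rewrite ger0_norm ?divr_ge0 // ler_pdivrMr // -natrX -natrM ler_nat.
    by apply: leq_trans (ltnW jm) _; rewrite leq_pmulr.
  have : expR (m%:R ^+ 4) <= m%:R ^+ 2 :> R.
    rewrite -(ler_pM2r (expR_gt0 (- (2 * m%:R ^+ 4)))) -expRD.
    apply: le_trans up; apply: le_trans low; rewrite ler_expR; lra.
  apply/negP; rewrite -ltNge; apply: lt_le_trans (expR_ge1Dx _).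
  rewrite -!natrX ltr_pwDl // ler_nat leq_pexp2l //.
move=> r s r' s' rm sm r'm s'm e; have [ss'|ss'|ss'] := ltngtP s s'.
- by case: (main r s r' s').
- by case: (main r' s' r s).
split=> //; move: e; rewrite ss' => /addIn /eqP; rewrite eqn_mul2r (gtn_eqF ga0) => /eqP.
by [].
Qed.

Lemma expR_ge2x (R : realType) (t : R) : 4 <= t -> 2 * t <= expR t.
Proof.
move=> t4; have t0 : 0 <= t by lra.
have := expR_ge1Dxn 1 t0; rewrite (_ : 2`!%:R = 2 :> R) // expr2.
by apply: le_trans; nra.
Qed.

Lemma fact_le_expR (R : realType) (m : nat) : (0 < m)%N ->
  ((m ^ 4)`!)%:R <= expR (4 * m%:R * (m ^ 4)%:R) :> R.
Proof.
move=> m0; have m0r : (0 : R) < m%:R by rewrite ltr0n.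
have fact_le n : (n`! <= n ^ n)%N.
  elim: n => // n IH; rewrite factS expnS leq_mul2l /= (leq_trans IH) //.
  by case: n {IH} => // n; rewrite leq_exp2r.
apply: le_trans (_ : ((m ^ 4) ^ (m ^ 4))%:R <= _); first by rewrite ler_nat fact_le.
rewrite expRM_natr natrX lerXn2r ?nnegrE ?expR_ge0 //.
rewrite natrX expRM_natl lerXn2r ?nnegrE ?expR_ge0 //.
by apply: le_trans (expR_ge1Dx _); rewrite lerDr.
Qed.

(** Interpolation determinant. Take the functions x^k y^j with k < m^3 and j < m at the points
    x = r ga + s be, y = p^r q^s. The minor given by [nonzero_minor] is a nonzero integer. If
    be ln p and ga ln q were too close, y would be nearly exp(kap x), so that every column is close to
    a power series in x, and [det_interpolation_le] with rho = exp 1 would make the minor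
    smaller than 1. *)
Lemma two_log (R : realType) (p q be ga m : nat) (lam : R) :
  (1 < p)%N -> (1 < q)%N -> coprime p q -> (0 < be)%N -> (0 < ga)%N -> (0 < m)%N ->
  ln p%:R <= lam -> ln q%:R <= lam ->
  ln ((m ^ 2 + m) * ga + m ^ 2 * be)%N%:R + 6 * lam + 3 <= m%:R ->
  expR (- (2 * m%:R ^+ 4)) < `|be%:R * ln p%:R - ga%:R * ln q%:R| :> R.
Proof.
move=> p1 q1 pq be0 ga0 m0 pl ql; set X := ((m ^ 2 + m) * ga + m ^ 2 * be)%N => cond.
rewrite ltNge; apply/negP => small.
set P := ln p%:R in pl small; set Q := ln q%:R in ql small.
have X0 : (0 < X)%N by rewrite addn_gt0 muln_gt0 addn_gt0 expn_gt0 m0 ga0.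
have X0r : (0 : R) < X%:R by rewrite ltr0n.
pose Lx := ln X%:R : R; rewrite -/Lx in cond.
have Lx0 : 0 <= Lx by apply: ln_ge0; rewrite ler1n.
have P0 : 0 < P by apply: ln_gt0; rewrite ltr1n.
have Q0 : 0 < Q by apply: ln_gt0; rewrite ltr1n.
have lam0 : 0 < lam by apply: lt_le_trans pl.
have ga0r : (0 : R) < ga%:R by rewrite ltr0n.
have ga1r : (1 : R) <= ga%:R by rewrite ler1n.
set mr := m%:R in cond small.
have mr3 : (3 : R) <= mr by lra.
have mr0 : 0 < mr by lra.
have m3 : (3 <= m)%N by rewrite -(ler_nat R).
set Lam := be%:R * P - ga%:R * Q in small.
(* degree below m^3 in x and below m in y: m^4 functions against m^4 grid points *)
pose K := (m ^ 3).-1.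
have KS : K.+1 = (m ^ 3)%N by rewrite prednK // expn_gt0 m0.
have NE : (K.+1 * m = m ^ 4)%N by rewrite KS -expnSr.
have lt_K : (K * m < m ^ 2 * m ^ 2)%N.
  by rewrite -expnD -NE ltn_mul2r m0 ltnSn.
have lam_m : lam <= mr by lra.
have [f [fP nz_det]] := nonzero_minor p1 (ltnW q1) m0 lt_K
  (comb_inj p1 q1 pq be0 ga0 m0 pl ql lam_m small).
set N := (K.+1 * m)%N in f fP nz_det.
set B := (X in \det X) in nz_det.
pose A := map_mx intr B : 'M[R]_N.
have detA : 1 <= `|\det A|.
  by rewrite det_map_mx -intr_norm -[1]/(1%:~R) ler_int -gtz0_ge1 normr_gt0.
pose x (i : 'I_N) := ((f i).1 * ga + (f i).2 * be)%N.
pose y (i : 'I_N) : R := (f i).1%:R * P + (f i).2%:R * Q.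
(* ln y = kap x up to a multiple of the small linear form *)
pose kap := P / ga%:R.
pose H := (2 * mr ^+ 2 + mr) * lam + 1.
have mr2 : mr ^+ 2 = mr * mr by rewrite expr2.
have mr3E : mr ^+ 3 = mr * mr * mr by rewrite exprSr mr2.
have mr4E : mr ^+ 4 = mr * mr * mr * mr by rewrite exprSr mr3E.
have mr9 : 9 <= mr * mr by nra.
have mr27 : 27 <= mr * mr * mr by nra.
have mrH : mr * H + mr ^+ 3 <= mr ^+ 4.
  have lam_le : lam <= (mr - 3) / 6 by lra.
  have : (2 * mr ^+ 3 + mr ^+ 2) * lam <= (2 * mr ^+ 3 + mr ^+ 2) * ((mr - 3) / 6).
    by apply: ler_wpM2l => //; rewrite mr3E mr2; lra.
  by rewrite /H mr2 mr3E mr4E; nra.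
have small_m : mr ^+ 3 * `|Lam| <= expR (- (2 * mr ^+ 4) + mr ^+ 3) / 2.
  have e3 : 2 * mr ^+ 3 <= expR (mr ^+ 3).
    by apply: expR_ge2x; rewrite mr3E; lra.
  rewrite expRD mulrC -mulrA; apply: ler_pM => //; first by rewrite exprn_ge0 // ltW.
  by rewrite ler_pdivlMr // mulrC.
have small_1 : mr ^+ 3 * `|Lam| <= 1.
  apply: le_trans small_m _; rewrite ler_pdivrMr // mul1r.
  apply: le_trans (_ : 1 <= _); last by lra.
  have : mr ^+ 3 <= mr ^+ 4 by rewrite ler_weXn2l //; lra.
  have : 27 <= mr ^+ 3 by rewrite mr3E.
  by rewrite expR_le1; lra.
have XE : X%:R = (mr ^+ 2 + mr) * ga%:R + mr ^+ 2 * be%:R :> R.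
  by rewrite natrD !natrM natrD natrX.
have beP : be%:R * P = Lam + ga%:R * Q by rewrite /Lam subrK.
have Lam_le : mr ^+ 2 * (Lam / ga%:R) <= 1.
  apply: le_trans _ small_1; apply: le_trans (ler_norm _) _; rewrite normrM.
  apply: ler_pM => //; rewrite ?normrX ?(ger0_norm (ltW mr0)) ?exprn_ge0 ?(ltW mr0) //.
    by rewrite ler_weXn2l //; lra.
  rewrite normrM [`|_^-1|]ger0_norm ?invr_ge0 ?(ltW ga0r) //.
  by rewrite ler_pdivrMr // ler_peMr.
have kapX : kap * X%:R <= H.
  have -> : kap * X%:R = (mr ^+ 2 + mr) * P + mr ^+ 2 * Q + mr ^+ 2 * (Lam / ga%:R).
    by rewrite XE /Lam /kap; field; rewrite gt_eqF.
  rewrite /H; have : (mr ^+ 2 + mr) * P <= (mr ^+ 2 + mr) * lam.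
    by apply: ler_wpM2l => //; rewrite addr_ge0 ?exprn_ge0 // ltW.
  have : mr ^+ 2 * Q <= mr ^+ 2 * lam by apply: ler_wpM2l => //; rewrite exprn_ge0 ?ltW.
  by lra.
have kap0 : 0 < kap by rewrite divr_gt0.
have H0 : 0 <= H by rewrite /H mr2; nra.
have expB : expR (mr * H) * (mr ^+ 3 * `|Lam|) <= expR (- N%:R) / 2.
  apply: le_trans (ler_wpM2l (expR_ge0 _) small_m) _.
  rewrite mulrA -expRD; apply: ler_wpM2r; first by rewrite invr_ge0.
  rewrite ler_expR /N NE natrX -/mr; lra.
have xX i : (x i <= X)%N.
  have [r_lt s_lt] := fP i.
  by rewrite leq_add // leq_mul2r ltnW ?orbT.
have yE i : (p ^ (f i).1 * q ^ (f i).2)%:R = expR (y i).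
  by rewrite expRD natrM !natrX !expRM_natl !lnK // posrE ltr0n ltnW.
have AE i (c : 'I_N) : A i c = (x i)%:R ^+ (c %/ m) * expR ((c %% m)%:R * y i).
  rewrite /A /B !mxE -pmulrn natrM !natrX; congr (_ * _).
  by rewrite expRM_natl -yE.
have l_le (c : 'I_N) : (c %% m)%:R <= mr by rewrite ler_nat ltnW // ltn_mod.
have rs_le i : (f i).1%:R <= mr ^+ 2 + mr /\ (f i).2%:R <= mr ^+ 2.
  have [r_lt s_lt] := fP i; rewrite /mr -natrX -natrD; split.
    by rewrite ler_nat; exact: ltnW.
  by rewrite ler_nat; exact: ltnW.
have close i (c : 'I_N) : `|expR ((c %% m)%:R * y i) - expR ((c %% m)%:R * (kap * (x i)%:R))|
    <= expR (- N%:R) / 2.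
  apply: le_trans _ expB; apply: le_trans (expR_dist (B := mr * H) _ _) _.
  - apply: ler_pM => //; first by rewrite addr_ge0 // mulr_ge0 // ltW.
    have [r_le s_le] := rs_le i; rewrite /y.
    have : (f i).1%:R * P <= (mr ^+ 2 + mr) * lam by apply: ler_pM => //; exact: ltW.
    have : (f i).2%:R * Q <= mr ^+ 2 * lam by apply: ler_pM => //; exact: ltW.
    by rewrite /H; lra.
  - apply: ler_pM => //; first by rewrite mulr_ge0 // ltW.
    apply: le_trans kapX; apply: ler_wpM2l; first exact: ltW.
    by rewrite ler_nat xX.
  apply: ler_wpM2l; first exact: expR_ge0.
  have -> : (c %% m)%:R * y i - (c %% m)%:R * (kap * (x i)%:R) =
      - ((c %% m)%:R * (f i).2%:R / ga%:R * Lam).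
    rewrite /y /x /kap /Lam natrD !natrM; field; rewrite gt_eqF //.
  rewrite normrN normrM; apply: ler_wpM2r => //.
  rewrite ger0_norm ?divr_ge0 ?mulr_ge0 // ler_pdivrMr //.
  apply: le_trans (_ : mr ^+ 3 * 1 <= _); last first.
    by apply: ler_wpM2l => //; rewrite exprn_ge0 // ltW.
  by rewrite mulr1 exprS; apply: ler_pM => //; have [] := rs_le i.
have half0 : 0 < expR (- N%:R) / 2 :> R by rewrite divr_gt0 ?expR_gt0.
have [M tail] : exists M, forall i (c : 'I_N),
    `|expR ((c %% m)%:R * (kap * (x i)%:R)) -
      \sum_(mu < M) ((c %% m)%:R * (kap * (x i)%:R)) ^+ mu / mu`!%:R| <= expR (- N%:R) / 2.
  have h (u : 'I_N * 'I_N) := exp_partial_near ((u.2 %% m)%:R * (kap * (x u.1)%:R)) half0.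
  have [F FP] := fin_all_exists h.
  by exists (\max_u F u) => i c; apply: (FP (i, c)); apply: (leq_bigmax (i, c)).
pose z i : R := (x i)%:R / X%:R.
pose a (c : 'I_N) (mu : 'I_M) : R :=
  X%:R ^+ (c %/ m) * (((c %% m)%:R * (kap * X%:R)) ^+ mu / mu`!%:R).
pose E : 'M[R]_N := \matrix_(i, c) (A i c - \sum_mu a c mu * z i ^+ (c %/ m + mu)).
pose eps (c : 'I_N) : R := X%:R ^+ (c %/ m) * expR (- N%:R).
have sum_a i (c : 'I_N) : \sum_mu a c mu * z i ^+ (c %/ m + mu) =
    (x i)%:R ^+ (c %/ m) *
      \sum_(mu < M) ((c %% m)%:R * (kap * (x i)%:R)) ^+ mu / mu`!%:R.
  rewrite mulr_sumr; apply: eq_bigr => mu _.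
  have -> : (x i)%:R = X%:R * z i by rewrite mulrC divfK // gt_eqF.
  rewrite /a exprD !exprMn; ring.
have z01 i : 0 <= z i <= 1 by rewrite divr_ge0 //= ler_pdivrMr // mul1r ler_nat xX.
have E_le i c : `|E i c| <= eps c.
  rewrite mxE sum_a AE -mulrBr normrM ger0_norm ?exprn_ge0 //.
  apply: ler_pM; rewrite ?exprn_ge0 //; first by rewrite lerXn2r ?nnegrE // ler_nat xX.
  rewrite [leRHS](splitr (expR _)); apply: le_trans (lerD (close i c) (tail i c)).
  by apply: le_trans (ler_normD _ _); rewrite addrA subrK.
have e1 : (1 : R) <= expR 1 by rewrite -[leLHS]expR0 ler_expR.
have AE2 i c : A i c = \sum_mu a c mu * z i ^+ (c %/ m + mu) + E i c.
  by rewrite [E i c]mxE addrC subrK.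
have := det_interpolation_le (k := fun c : 'I_N => (c %/ m)%N) z01 e1 E_le AE2.
move=> /(le_trans (ler_wpM2r (exprn_ge0 _ (expR_ge0 _)) detA)); rewrite mul1r -expRM_natr mul1r.
have col c : \sum_mu `|a c mu| * expR 1 ^+ (c %/ m + mu) + eps c * expR 1 ^+ N <=
    expR (1 + (c %/ m)%:R * (Lx + 1) + 3 * (c %% m)%:R * H).
  set k := (c %/ m)%N; set l := (c %% m)%N.
  have lk0 : 0 <= l%:R * (kap * X%:R) by apply: mulr_ge0 => //; apply: mulr_ge0 => //; exact: ltW.
  have XkE : X%:R ^+ k = expR (k%:R * Lx) by rewrite expRM_natl lnK.
  have -> : eps c * expR 1 ^+ N = X%:R ^+ k.
    by rewrite /eps -mulrA -expRM_natr mul1r -expRD addNr expR0 mulr1.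
  have -> : \sum_mu `|a c mu| * expR 1 ^+ (k + mu) =
      expR (k%:R * (Lx + 1)) * \sum_(mu < M) (expR 1 * (l%:R * (kap * X%:R))) ^+ mu / mu`!%:R.
    rewrite mulr_sumr; apply: eq_bigr => mu _.
    have -> : expR (k%:R * (Lx + 1)) = X%:R ^+ k * expR 1 ^+ k.
      by rewrite mulrDr expRD -XkE expRM_natl.
    rewrite ger0_norm; last first.
      by apply: mulr_ge0; [exact: exprn_ge0 | apply: divr_ge0 => //; exact: exprn_ge0].
    by rewrite /a -/k -/l exprD !exprMn; ring.
  have lH : l%:R * (kap * X%:R) <= l%:R * H by apply: ler_wpM2l.
  have e3 := @expR1_le3 R.
  apply: le_trans (_ : 2 * expR (k%:R * (Lx + 1) + 3 * l%:R * H) <= _); last first.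
    rewrite -addrA [leRHS]expRD; apply: ler_wpM2r; rewrite ?expR_ge0 //.
    by have := expR_ge1Dx (1 : R); lra.
  rewrite [2 * _]mulr_natl mulr2n; apply: lerD; last first.
    rewrite XkE ler_expR mulrDr mulr1 -addrA lerDl addr_ge0 //.
    by rewrite !mulr_ge0.
  rewrite expRD; apply: ler_wpM2l; rewrite ?expR_ge0 //.
  apply: le_trans (exp_partial_le _ _) _; first by rewrite mulr_ge0 ?expR_ge0.
  rewrite ler_expR -mulrA; apply: ler_pM => //; exact: expR_ge0.
move=> up.
have : expR 'C(N, 2)%:R <= expR (4 * mr * N%:R + N%:R + m%:R * 'C(m ^ 3, 2)%:R * (Lx + 1) +
      3 * H * (m ^ 3)%:R * 'C(m, 2)%:R).
  apply: le_trans up _.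
  have le_prod : \prod_c (\sum_mu `|a c mu| * expR 1 ^+ (c %/ m + mu) + eps c * expR 1 ^+ N)
      <= expR (\sum_(c < N) (1 + (c %/ m)%:R * (Lx + 1) + 3 * (c %% m)%:R * H)).
    rewrite expR_sum; apply: ler_prod => c _; rewrite col andbT addr_ge0 //.
      by apply: sumr_ge0 => mu _; rewrite mulr_ge0 ?exprn_ge0 ?expR_ge0.
    by rewrite /eps !mulr_ge0 ?exprn_ge0 ?expR_ge0.
  have fact_le : (N`!)%:R <= expR (4 * mr * N%:R) :> R.
    by rewrite /N NE; exact: fact_le_expR.
  apply: le_trans (ler_pM _ _ fact_le le_prod) _ => //.
    apply: prodr_ge0 => c _; rewrite addr_ge0 //.
      by apply: sumr_ge0 => mu _; rewrite mulr_ge0 ?exprn_ge0 ?expR_ge0.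
    by rewrite /eps !mulr_ge0 ?exprn_ge0 ?expR_ge0.
  rewrite -expRD ler_expR -!addrA lerD2l !big_split /= sumr_const card_ord addrA.
  apply: lerD; first apply: lerD => //.
    by rewrite -mulr_suml -natr_sum sum_divn // natrM -KS.
  rewrite -mulr_suml -mulr_sumr -natr_sum sum_modn // natrM -KS.
  by rewrite le_eqVlt; apply/orP; left; apply/eqP; ring.
rewrite ler_expR.
have bin2R n : ('C(n, 2)%:R : R) = n%:R * (n%:R - 1) / 2.
  case: n => [|n]; first by rewrite !mul0r.
  have : ('C(n.+1, 2) * 2 = n.+1 * n)%N by rewrite mulnC -mul_bin_diag bin1.
  move/(congr1 (fun u => u%:R : R)); rewrite !natrM => e2.
  have -> : n.+1%:R - 1 = n%:R :> R by rewrite -natr1 addrK.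
  by rewrite -e2 mulfK // pnatr_eq0.
rewrite !bin2R /N NE !natrX -/mr -/mr => fin.
have {}fin : mr ^+ 4 - 1 <= 8 * mr + 2 + (mr ^+ 3 - 1) * (Lx + 1) + 3 * H * (mr - 1).
  have mr4 : 0 < mr ^+ 4 / 2 by rewrite divr_gt0 // exprn_gt0.
  rewrite -(ler_pM2l mr4); move: fin; rewrite mr4E mr3E; lra.
have c3 : mr ^+ 3 * (Lx + 6 * lam + 3) <= mr ^+ 4.
  by rewrite [mr ^+ 4]exprSr; apply: ler_wpM2l => //; rewrite exprn_ge0 // ltW.
have H3 : 3 * H * (mr - 1) <= 6 * mr ^+ 3 * lam + 3 * mr.
  have : 0 <= lam * (mr ^+ 2 + mr) by rewrite mulr_ge0 ?addr_ge0 ?exprn_ge0 ?ltW.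
  by rewrite /H mr3E mr2; lra.
have m11 : 2 * mr ^+ 3 >= 18 * mr by rewrite mr3E; nra.
lra.
Qed.

(** * The size of the primes of the ball size *)

Section LogSum.
Variable R : realType.

Lemma ln_le_sub1 (x : R) : 0 < x -> ln x <= x - 1.
Proof.
by move=> x0; have := @le_ln1Dx R (x - 1); rewrite [1 + _]addrC subrK; apply; lra.
Qed.

Lemma ln_nat_ge0 n : 0 <= ln (n%:R : R).
Proof. by case: n => [|n]; [rewrite ln0 | rewrite ln_ge0 // ler1n]. Qed.

Lemma sum_le_size (s : seq nat) (F : nat -> R) c : {in s, forall i, F i <= c} ->
  \sum_(i <- s) F i <= (size s)%:R * c.
Proof.
elim: s => [|x s IH] h; first by rewrite big_nil mul0r.
rewrite big_cons /= -natr1 mulrDl mul1r addrC lerD ?h ?inE ?eqxx // IH // => i si.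
by rewrite h // inE si orbT.
Qed.

Lemma inv_le_ln (k : nat) : (2 < k)%N -> (k%:R)^-1 <= (ln k%:R - ln (k - 2)%:R) / 2 :> R.
Proof.
move=> k2; have k0 : (0 : R) < k%:R by rewrite ltr0n; apply: ltn_trans k2.
have km0 : (0 : R) < (k - 2)%:R by rewrite ltr0n subn_gt0.
have := ln_le_sub1 (divr_gt0 km0 k0); rewrite ln_div ?posrE // natrB ?(ltnW k2) //.
rewrite mulrBl divff ?gt_eqF // => h; lra.
Qed.

(** Telescoping, since 1 / k <= (ln k - ln (k - 2)) / 2. *)
Lemma sum_inv_odd k (s : seq nat) : uniq s -> all odd s -> all (fun x => 4 < x <= 2 * k + 3)%N s ->
  \sum_(x <- s) (x%:R)^-1 <= (ln (2 * k + 3)%:R - ln 3) / 2 :> R.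
Proof.
elim: k s => [|k IH] s us os als.
  case: s us os als => [|x s] _ _ /=; first by rewrite big_nil subrr mul0r.
  by case/andP => /andP[h1 h2]; have := leq_trans h1 h2.
have step : ((2 * k.+1 + 3)%N%:R)^-1 <= (ln (2 * k.+1 + 3)%:R - ln (2 * k + 3)%:R) / 2 :> R.
  apply: le_trans (inv_le_ln _) _; first by lia.
  by rewrite (_ : (2 * k.+1 + 3 - 2 = 2 * k + 3)%N) //; lia.
have pos : (0 : R) <= ((2 * k.+1 + 3)%N%:R)^-1 by rewrite invr_ge0.
pose f := [pred x : nat | x == 2 * k.+1 + 3]%N.
have IH' : \sum_(x <- seq.filter (predC f) s) (x%:R)^-1 <= (ln (2 * k + 3)%:R - ln 3) / 2 :> R.
  apply: IH; rewrite ?filter_uniq //.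
    by apply/allP => x; rewrite mem_filter => /andP[_ /(allP os)].
  apply/allP => x; rewrite mem_filter /= => /andP[ne xs].
  by have := allP als x xs; have := allP os x xs; move: ne; clear; lia.
rewrite (bigID f) /=.
have le1 : \sum_(i <- s | i == (2 * k.+1 + 3)%N) (i%:R)^-1 <= ((2 * k.+1 + 3)%N%:R)^-1 :> R.
  rewrite -big_filter; have [sx|sx] := boolP ((2 * k.+1 + 3)%N \in s).
    by rewrite (filter_pred1_uniq us sx) big_seq1.
  rewrite (eq_in_filter (a2 := pred0)) ?filter_pred0 ?big_nil // => x xs /=.
  by apply/negbTE; apply: contraNneq sx => <-.
by rewrite big_filter /= in IH'; lra.
Qed.

Variables b s e : nat.
Hypothesis sb : (s ^ 2 <= (4 * e - 2) * b)%N.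
Hypothesis e0 : (0 < e)%N.
Hypothesis be : (e ^ 2 <= b)%N.
Let T := (b + 1 + s)%N.
Variable y : R.
Hypothesis Ty : ln T%:R <= y.
Hypothesis y3 : 3 <= y.
Local Notation beta p := (trunc_log p b).+1.
Local Notation S := (support b T).
Let q : R := Num.sqrt e%:R.

Lemma b_gt0 : (0 < b)%N.
Proof. by apply: leq_trans be; rewrite expn_gt0 e0. Qed.

Lemma supportP p : p \in S -> [/\ prime p, (1 < beta p)%N & (b < p ^ beta p <= T)%N].
Proof.
rewrite mem_filter mem_iota => /andP[/andP[pp pT] /= pb]; have p1 := prime_gt1 pp; split=> //.
  by rewrite ltnS trunc_log_gt0 p1 /=; move: pb p1; clear; lia.
by rewrite trunc_log_ltn.
Qed.

Lemma support_ln p : p \in S -> ln p%:R <= y / (beta p)%:R.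
Proof.
case/supportP => pp _ /andP[_ pT]; have p0 := prime_gt0 pp.
rewrite ler_pdivlMr ?ltr0n // mulr_natr -lnXn ?ltr0n // -natrX.
by apply: le_trans Ty; rewrite ler_ln ?posrE ?ltr0n ?ler_nat // /T; lia.
Qed.

Lemma prime_powers_inj (f : nat -> nat) (r : seq nat) : all prime r -> {in r, forall p, 0 < f p}%N ->
  uniq r -> uniq [seq (p ^ f p)%N | p <- r].
Proof.
move=> rp f0 ur; rewrite map_inj_in_uniq // => p p' pr p'r eq.
have : (p %| p' ^ f p')%N by rewrite -eq dvdn_exp // f0.
by rewrite Euclid_dvdX ?(allP rp) // => /andP[]; rewrite dvdn_prime2 ?(allP rp) // => /eqP.
Qed.

Lemma support_uniq (a : pred nat) : uniq (seq.filter a S).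
Proof. by rewrite !filter_uniq // iota_uniq. Qed.

Lemma prime_odd p : prime p -> p != 2 -> odd p.
Proof. by case/even_prime => [->|]. Qed.

Lemma y_ge0 : 0 <= y. Proof. by apply: le_trans y3; rewrite ler0n. Qed.

Lemma q_ge0 : 0 <= q. Proof. exact: sqrtr_ge0. Qed.

Lemma count_le (N k c : nat) : (k ^ 2 * N.-1 ^ 2 <= e)%N -> (0 < k)%N -> N%:R <= 1 + q / k%:R :> R.
Proof.
move=> h k0; have kR : (0 : R) < k%:R by rewrite ltr0n.
apply: le_trans (_ : 1 + N.-1%:R <= _); first by rewrite nat1r ler_nat; clear; lia.
rewrite lerD2l ler_pdivlMr // -(@ler_pXn2r _ 2) ?nnegrE ?q_ge0 ?mulr_ge0 //.
by rewrite sqr_sqrtr // -natrM -natrX ler_nat mulnC expnMn.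
Qed.

(** If p^beta lies in the interval and beta is even, then p^(beta/2) is an odd integer
    whose square does; there are at most 1 + sqrt e / 2 of these, and ln p <= y / 2. *)
Lemma support_even : \sum_(p <- S | (p != 2) && ~~ odd (beta p)) ln p%:R <= y * ((1 + q / 2) / 2).
Proof.
rewrite -big_filter; set r := seq.filter _ _.
have rS p : p \in r -> [/\ p \in S, p != 2 & ~~ odd (beta p)].
  by rewrite mem_filter => /andP[/andP[]].
apply: le_trans (sum_le_size (c := y / 2) _) _.
  move=> p /rS[pS _ _]; apply: le_trans (support_ln pS) _.
  have [_ b2 _] := supportP pS; have y0 := y_ge0.
  by apply: ler_wpM2l => //; rewrite lef_pV2 ?posrE ?ltr0n ?ler_nat.
have hp : all prime r by apply/allP => p /rS[/supportP[]].
have := @odd_squares_count b s e sb b_gt0 e0 [seq (p ^ (beta p)./2)%N | p <- r].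
rewrite size_map => cnt.
have /cnt{}cnt : uniq [seq (p ^ (beta p)./2)%N | p <- r].
  apply: prime_powers_inj => //; last exact: support_uniq.
  by move=> p /rS[/supportP[_ b2 _] _ _]; rewrite half_gt0.
have /cnt{}cnt : all odd [seq (p ^ (beta p)./2)%N | p <- r].
  apply/allP => _ /mapP[p pr ->]; have [pS p2 _] := rS p pr.
  by have [pp _ _] := supportP pS; rewrite oddX (prime_odd pp p2) orbT.
have /cnt{}cnt : all (fun x => b < x ^ 2 <= b + 1 + s)%N [seq (p ^ (beta p)./2)%N | p <- r].
  apply/allP => _ /mapP[p pr ->]; have [pS _ ev] := rS p pr.
  have [_ _ h] := supportP pS; rewrite -expnM.
  by have -> : ((beta p)./2 * 2 = beta p)%N by move: ev; clear; lia.
have : (size r)%:R <= 1 + q / 2%:R :> R by apply: (@count_le _ 2 0) => //; move: cnt; clear; lia.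
rewrite -subr_ge0 => /(mulr_ge0 y_ge0) h; lra.
Qed.

Lemma support_three : \sum_(p <- S | (p != 2) && (beta p == 3)) ln p%:R <= y * ((1 + q / 5) / 3).
Proof.
rewrite -big_filter; set r := seq.filter _ _.
have rS p : p \in r -> [/\ p \in S, p != 2 & beta p = 3].
  by rewrite mem_filter => /andP[/andP[? /eqP ?]].
apply: le_trans (sum_le_size (c := y / 3) _) _.
  by move=> p /rS[pS _ b3]; apply: le_trans (support_ln pS) _; rewrite b3.
have hp : all prime r by apply/allP => p /rS[/supportP[]].
have p3 p : p \in r -> (2 < p)%N.
  by move=> /rS[/supportP[pp _ _] p2 _]; rewrite ltn_neqAle eq_sym p2 prime_gt1.
have := @odd_cubes_count b s e sb b_gt0 r (support_uniq _) => cnt.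
have /cnt{}cnt : all odd r.
  apply/allP => p pr; have [/supportP[pp _ _] p2 _] := rS p pr.
  exact: prime_odd.
have /cnt{}cnt : all (fun x => 2 < x)%N r by apply/allP => p /p3.
have /cnt{}cnt : all (fun x => b < x ^ 3 <= b + 1 + s)%N r.
  by apply/allP => p /rS[pS _ b3]; have [_ _] := supportP pS; rewrite b3.
have : (size r)%:R <= 1 + q / 5%:R :> R by apply: (@count_le _ 5 0) => //; move: cnt; clear; lia.
rewrite -subr_ge0 => /(mulr_ge0 y_ge0) h; lra.
Qed.

(** For odd beta >= 5 each exponent is used by one prime only, whence a harmonic sum
    over odd numbers up to y. *)
Lemma support_high :
  \sum_(p <- S | [&& p != 2, odd (beta p) & (beta p != 3)]) ln p%:R <= y * (ln (y / 3) / 2).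
Proof.
rewrite -big_filter; set r := seq.filter _ _.
have rS p : p \in r -> [/\ p \in S, (2 < p)%N, odd p, odd (beta p) & (4 < beta p)%N].
  rewrite mem_filter => /andP[/and3P[p2 ob b3] pS]; have [pp b1 _] := supportP pS.
  have p3 : (2 < p)%N by rewrite ltn_neqAle eq_sym p2 prime_gt1.
  by split=> //; [exact: prime_odd | move: ob b1 b3; clear; lia].
apply: le_trans (_ : \sum_(p <- r) y / (beta p)%:R <= _).
  by rewrite big_seq [leRHS]big_seq; apply: ler_sum => p /rS[pS _ _ _ _]; exact: support_ln.
rewrite -mulr_sumr ler_wpM2l ?y_ge0 //.
rewrite -(big_map (fun p => beta p) xpredT (fun k => (k%:R)^-1)).
set bs := [seq beta p | p <- r].
have ub : uniq bs.
  rewrite map_inj_in_uniq ?support_uniq // => p p' pr p'r eq.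
  have [pS p2 op ob b4] := rS p pr; have [p'S p'2 op' ob' b4'] := rS p' p'r.
  have [_ _ /andP[h1 h2]] := supportP pS; have [_ _ /andP[h1' h2']] := supportP p'S.
  have key := @odd_power_unique b s e sb b_gt0 e0 be (beta p).
  have pp0 : (0 < p)%N by apply: ltn_trans p2.
  have pp0' : (0 < p')%N by apply: ltn_trans p'2.
  case: (ltngtP p p') => // lt.
    by exfalso; apply: (key p p') => //; [move: op op' lt; clear; lia | rewrite eq].
  by exfalso; apply: (key p' p) => //; [move: op op' lt; clear; lia | rewrite eq].
case Ebs : bs => [|k0 bs'].
  by rewrite big_nil divr_ge0 // ln_ge0 // ler_pdivlMr // mul1r.
rewrite -Ebs; have ex : exists k, k \in bs by exists k0; rewrite Ebs inE eqxx.
have bd k : k \in bs -> (k <= \max_(k <- bs) k)%N by move=> kb; rewrite (big_rem k kb) /= leq_maxl.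
have [k kb kmax] := ex_maxnP ex bd.
have ob : all odd bs by apply/allP => _ /mapP[p /rS[_ _ _ ? _] ->].
have gb : all (fun x => 4 < x)%N bs by apply/allP => _ /mapP[p /rS[_ _ _ _ ?] ->].
have k5 := allP gb k kb; have ok := allP ob k kb.
(* k is the largest exponent; 3 ^ k <= T bounds it by y *)
have kE : k = (2 * ((k - 3)./2) + 3)%N by move: k5 ok; clear; lia.
apply: le_trans (sum_inv_odd (k := (k - 3)./2) ub ob _) _.
  by apply/allP => x xb; rewrite (allP gb) //= -kE kmax.
have y0 : 0 < y by apply: lt_le_trans y3; rewrite ltr0n.
rewrite -kE ler_pM2r ?invr_gt0 // ln_div ?posrE ?lerD2r //.
rewrite ler_ln ?posrE ?ltr0n //; last by apply: leq_trans k5.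
have /mapP[p pr kp] := kb; have [pS p2 _ _ _] := rS p pr.
have := support_ln pS; rewrite -kp ler_pdivlMr ?ltr0n; last by apply: leq_trans k5.
apply: le_trans; rewrite -[leLHS]mul1r ler_wpM2r //.
have : expR 1 <= p%:R :> R by apply: le_trans (expR1_le3 R) _; rewrite ler_nat.
have p0 : 0 < p%:R :> R by rewrite ltr0n; apply: ltn_trans p2.
by move=> h; apply: le_trans (_ : ln (expR 1) <= _); [rewrite expRK | rewrite ler_ln ?posrE ?expR_gt0].
Qed.

(** Few primes have a power in the short interval: about sqrt e of them at most with
    an even exponent or exponent 3, and a logarithmic contribution from all higher exponents. *)
Lemma support_sum : \sum_(p <- S) ln p%:R <=
  ln 2 + y * ((1 + q / 2) / 2 + (1 + q / 5) / 3 + ln (y / 3) / 2).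
Proof.
rewrite (bigID (pred1 2)) /= lerD //.
  have uS := support_uniq predT; rewrite filter_predT in uS.
  rewrite -big_filter; have [sx|sx] := boolP (2 \in S).
    by rewrite (filter_pred1_uniq uS sx) big_seq1.
  rewrite (eq_in_filter (a2 := pred0)) ?filter_pred0 ?big_nil ?ln_nat_ge0 // => x xs /=.
  by apply/negbTE; apply: contraNneq sx => <-.
rewrite (bigID (fun p => odd (beta p))) /= (bigID (fun p => beta p == 3)) /=.
rewrite (eq_bigl (fun p => (p != 2) && (beta p == 3))) => [|p]; last first.
  by rewrite -andbA; congr andb; case: (beta p =P 3) => [[->]|]; rewrite ?andbF.
rewrite [X in _ + X + _](eq_bigl (fun p => [&& p != 2, odd (beta p) & (beta p != 3)])) => [|p]; last first.
  by rewrite -andbA.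
have := support_even; have := support_three; have := support_high; lra.
Qed.
End LogSum.

(** * The comparison of sizes *)

Section Analytic.
Variable R : realType.
Implicit Types x y q v B : R.

Lemma ln2_le : ln 2 <= 7 / 10 :> R.
Proof.
have h : 2 <= expR (7 / 10) :> R.
  apply: le_trans (exp_partial_le (x := 7 / 10) 4 _); last by lra.
  rewrite !big_ord_recr big_ord0 /= -[0`!]/1%N -[1`!]/1%N -[2`!]/2%N -[3`!]/6%N.
  by lra.
by rewrite -[leRHS]expRK ler_ln ?posrE ?expR_gt0.
Qed.

Lemma ln2_ge : 6 / 10 <= ln 2 :> R.
Proof.
have h : (85 / 100 : R) <= expR (- (15 / 100)) by apply: le_trans (expR_ge1Dx _); lra.
have h4 : (85 / 100 : R) ^+ 4 <= expR (- (6 / 10)).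
  rewrite (_ : - (6 / 10) = 4%:R * - (15 / 100)) ?expRM_natl; last by lra.
  by rewrite ler_pXn2r ?nnegrE ?expR_ge0 //; lra.
have h2 : (1 / 2 : R) <= expR (- (6 / 10)) by apply: le_trans h4; lra.
have e0 := expR_gt0 (6 / 10 : R).
have : expR (6 / 10) <= 2 :> R.
  have : expR (6 / 10) * expR (- (6 / 10)) = 1 :> R by rewrite -expRD subrr expR0.
  by nra.
by move=> h5; rewrite -[leLHS]expRK ler_ln ?posrE.
Qed.

(** Induction, using (n + 1) (ln (n + 1) - ln n) >= 1. *)
Lemma ln_fact_le n : (0 < n)%N -> ln (n`!)%:R <= (n%:R + 1) * ln n%:R - n%:R + 1 :> R.
Proof.
case: n => // n _; elim: n => [|n IH]; first by rewrite -[1`!]/1%N !ln1; lra.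
rewrite factS natrM lnM ?posrE ?ltr0n ?fact_gt0 //.
have a0 : (0 : R) < n.+1%:R by rewrite ltr0n.
have b0 : (0 : R) < n.+2%:R by rewrite ltr0n.
have := ln_le_sub1 (divr_gt0 a0 b0); rewrite ln_div ?posrE //.
move=> /(ler_wpM2l (ltW b0)).
have -> : n.+2%:R * (n.+1%:R / n.+2%:R - 1) = -1 :> R.
  by rewrite mulrBr mulrCA divff ?gt_eqF // -natr1; lra.
by move: IH; rewrite -[n.+2%:R]natr1; lra.
Qed.

Lemma ln_diff_le x y : 0 < x -> 0 < y -> ln y - ln x <= (y - x) / x.
Proof.
move=> x0 y0; have := ln_le_sub1 (divr_gt0 y0 x0); rewrite ln_div ?posrE //.
by rewrite mulrBl divff ?gt_eqF.
Qed.

(** The bound of [support_sum] divided by y, with q standing for sqrt e. *)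
Definition sigma (q y : R) := (1 + q / 2) / 2 + (1 + q / 5) / 3 + ln (y / 3) / 2.

(** Passing from v to B increases 2e ln(v - q) by at least e (y - y0), and y sigma(y)
    by at most (sigma(y) + 1/2)(y - y0). *)
Lemma analytic_mono e q v B : 0 <= e -> 0 < q -> q < v -> v <= B -> 1 < v + q ->
  let y := 2 * ln (B + q) in let y0 := 2 * ln (v + q) in
  sigma q y + 1 / 2 <= e ->
  2 * e * ln (v - q) - y0 * sigma q y0 <= 2 * e * ln (B - q) - y * sigma q y.
Proof.
move=> e0 q0 qv vB v1 y y0 se.
have y00 : 0 < y0 by rewrite mulr_gt0 // ln_gt0.
have yy : y0 <= y by rewrite ler_wpM2l // ler_ln ?posrE; lra.
have sg : 0 <= sigma q y - ln (y / 3) / 2 by rewrite /sigma; lra.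
have yp : 0 < y by apply: lt_le_trans yy.
have h1 : (y - y0) / 2 <= ln (B - q) - ln (v - q).
  have -> : (y - y0) / 2 = ln ((B + q) / (v + q)) by rewrite ln_div ?posrE /y /y0; lra.
  rewrite -ln_div ?posrE; [|lra|lra].
  have p1 : 0 < v + q by lra.
  have p2 : 0 < v - q by lra.
  rewrite ler_ln ?posrE ?divr_gt0 //; [|lra|lra].
  rewrite ler_pdivrMr // mulrAC ler_pdivlMr //; nra.
have h2 := ln_diff_le y00 yp; rewrite ler_pdivlMr // in h2.
have l3 : 0 < 3 :> R by lra.
have sE z : 0 < z -> sigma q z = (1 + q / 2) / 2 + (1 + q / 5) / 3 + (ln z - ln 3) / 2.
  by move=> z0; rewrite /sigma ln_div ?posrE.
rewrite sE // in se; rewrite !sE //.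
have h3 : e * ((y - y0) / 2) <= e * (ln (B - q) - ln (v - q)) by rewrite ler_wpM2l.
have h4 : 0 <= (y - y0) * (e - ((1 + q / 2) / 2 + (1 + q / 5) / 3 + (ln y - ln 3) / 2 + 1 / 2)).
  by rewrite mulr_ge0; lra.
by nra.
Qed.

Lemma ln_le_quarter q : 0 < q -> ln q <= 2 * ln 2 + q / 4 - 1.
Proof.
move=> q0; have q4 : 0 < q / 4 by lra.
have := ln_le_sub1 q4; rewrite ln_div ?posrE //.
have -> : ln 4 = ln 2 + ln 2 :> R by rewrite -lnM ?posrE //; congr (ln _); lra.
by lra.
Qed.

Lemma ln_shift x y : 0 < x -> 0 < y -> 1 - x / y <= ln y - ln x.
Proof.
move=> x0 y0; have := ln_diff_le y0 x0; rewrite mulrBl divff ?gt_eqF //; lra.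
Qed.

Lemma sigma_le q y0 : 0 < y0 -> sigma q y0 <= 5 / 6 + 19 / 60 * q - 15 / 100 + y0 / 12.
Proof.
move=> y00; have y2 : 0 < y0 / 6 by lra.
have h := ln_le_sub1 y2; rewrite /sigma (_ : y0 / 3 = 2 * (y0 / 6)); last by lra.
by rewrite [ln (2 * _)]lnM ?posrE //; have := ln2_le; lra.
Qed.

(** The leading terms 4 q^2 ln q cancel; what remains is 2 q^2 against 0.4 q^2 and terms
    linear in q. *)
Lemma numeric_large q (F : R) : 424 / 100 <= q -> F <= (q ^+ 2 + 1) * (2 * ln q) - q ^+ 2 + 1 ->
  let v := q ^+ 2 + 19 / 10 in let y0 := 2 * ln (v + q) in
  1 + ln 2 + 2 * F + y0 * sigma q y0 < 2 * q ^+ 2 * ln (v - q).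
Proof.
move=> hq hF /=; set v := q ^+ 2 + 19 / 10; set y0 := 2 * ln (v + q); have q0 : 0 < q by lra.
have lq := ln_le_quarter q0; have l2 := ln2_le.
have qq : q ^+ 2 = q * q by rewrite expr2.
have q2 : 0 < q ^+ 2 by rewrite exprn_gt0.
have vp : 0 < v - q by rewrite /v qq; nra.
have vs : 0 < v + q by rewrite /v qq; nra.
have ln2q : ln (q ^+ 2) = 2 * ln q by rewrite lnXn // mulr_natl.
have low : 2 * q ^+ 2 * ln (v - q) >= 4 * q ^+ 2 * ln q - 2 * q + 18 / 10.
  have h := ln_shift q2 vp; rewrite ln2q in h.
  have h2 : q ^+ 2 * (1 - q ^+ 2 / (v - q)) >= - q + 9 / 10.
    have -> : 1 - q ^+ 2 / (v - q) = (19 / 10 - q) / (v - q).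
      have nz : v - q != 0 by rewrite gt_eqF.
      have -> : 19 / 10 - q = (v - q) - q ^+ 2 by rewrite /v; lra.
      by rewrite [RHS]mulrBl divff.
    rewrite mulrA ler_pdivlMr // /v qq; nra.
  have := ler_wpM2l (ltW q2) h; lra.
have up : y0 <= q + 229 / 100.
  have h := ln_shift vs q2; rewrite ln2q in h.
  have h2 : (v + q) / q ^+ 2 <= 1 + 342 / 1000.
    by rewrite ler_pdivrMr // /v qq; nra.
  rewrite /y0; have := ln_diff_le q2 vs; rewrite ln2q mulrBl divff ?gt_eqF //; lra.
have y00 : 0 < y0 by rewrite mulr_gt0 // ln_gt0 // /v qq; nra.
have sg := sigma_le q y00.
have : y0 * sigma q y0 <= (q + 229 / 100) * (5 / 6 + 19 / 60 * q - 15 / 100 + (q + 229 / 100) / 12).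
  apply: le_trans (_ : y0 * (5 / 6 + 19 / 60 * q - 15 / 100 + (q + 229 / 100) / 12) <= _).
    by rewrite ler_pM2l //; lra.
  by rewrite ler_wpM2r //; lra.
have : 0 <= (q - 424 / 100) * (q - 424 / 100) by rewrite -expr2 sqr_ge0.
move: hF low; rewrite !qq; nra.
Qed.

Lemma numeric_13 q (F : R) : q ^+ 2 = 13 -> 0 < q -> F <= 14 * ln 13 - 12 ->
  let v := 385 / 10 in let y0 := 2 * ln (v + q) in
  1 + ln 2 + 2 * F + y0 * sigma q y0 < 26 * ln (v - q).
Proof.
move=> qq q0 hF /=; set v := 385 / 10; set y0 := 2 * ln (v + q); have [q1 q3] : 36 / 10 <= q /\ q <= 361 / 100 by split; nra.
have l2 := ln2_le; have l2' := ln2_ge.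
have pw k : ln (2 ^+ k) = k%:R * ln 2 :> R by rewrite lnXn // mulr_natl.
have low : 5 * ln 2 <= ln (v - q).
  by rewrite -pw ler_ln ?posrE /v; lra.
have l13 : ln 13 <= 4 * ln 2 :> R by rewrite -pw ler_ln ?posrE; lra.
have up : ln (v + q) <= 5 * ln 2 + 32 / 100.
  have p32 : 0 < (2 : R) ^+ 5 by rewrite exprn_gt0.
  have vq : 0 < v + q by rewrite /v; lra.
  by have := ln_diff_le p32 vq; rewrite pw /v; lra.
have y00 : 0 < y0 by rewrite mulr_gt0 // ln_gt0 // /v; lra.
have y1 : y0 <= 764 / 100 by rewrite /y0; lra.
have sg := sigma_le q y00.
have : y0 * sigma q y0 <= 764 / 100 * (247 / 100).
  apply: le_trans (_ : y0 * (247 / 100) <= _); last by rewrite ler_wpM2r //; lra.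
  by rewrite ler_pM2l //; lra.
by lra.
Qed.
End Analytic.

Section Big.
Variable R : realType.
Variables w b e s : nat.
Hypothesis F : feasible w b e.
Hypothesis he : e = 13%N \/ (17 < e)%N.
Hypothesis sb : (s ^ 2 <= (4 * e - 2) * b)%N.
Let T := (b + 1 + s)%N.
Hypothesis prod_le : ((w - e) ^ e * (b - e) ^ e <=
   T ^ e * (e`! ^ 2 * \prod_(p <- support b T) p))%N.
Local Notation q := (Num.sqrt e%:R : R).
Local Notation B := (Num.sqrt b%:R : R).
Let y : R := 2 * ln (B + q).

Lemma e_ge13 : (13 <= e)%N. Proof. by case: he => [->|] //; clear; lia. Qed.

Lemma q_sqr : q ^+ 2 = e%:R. Proof. by rewrite sqr_sqrtr. Qed.
Lemma B_sqr : B ^+ 2 = b%:R. Proof. by rewrite sqr_sqrtr. Qed.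

Lemma q_ge : 36 / 10 <= q.
Proof.
have h : (13%:R <= e%:R :> R) by rewrite ler_nat e_ge13.
have := q_sqr; have := sqrtr_ge0 (e%:R : R); rewrite expr2; move: h; nra.
Qed.

Lemma B_ge : q ^+ 2 + 19 / 10 <= B.
Proof.
have b2 : (e ^ 2 + 4 * e + 2 <= b)%N by apply: leq_trans (feas_large F) (feas_le F).
have h : (e%:R ^+ 2 + 4 * e%:R + 2 <= b%:R :> R) by rewrite -natrX -natrM -!natrD ler_nat.
have e13 : (13%:R <= e%:R :> R) by rewrite ler_nat e_ge13.
rewrite q_sqr -(@ler_pXn2r _ 2) ?nnegrE ?sqrtr_ge0 ?addr_ge0 //; last by lra.
by rewrite B_sqr; lra.
Qed.

Lemma q_lt_B : q < B.
Proof. by have := B_ge; have := q_ge; rewrite expr2; nra. Qed.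

Lemma e_sqr_le_b : (e ^ 2 <= b)%N.
Proof. by apply: leq_trans (leq_trans (feas_large F) (feas_le F)); rewrite -addnA leq_addr. Qed.

Lemma s_le : s%:R <= 2 * B * q.
Proof.
rewrite -(@ler_pXn2r _ 2) ?nnegrE ?mulr_ge0 ?sqrtr_ge0 //.
rewrite !exprMn B_sqr q_sqr -natrX; apply: le_trans (_ : ((4 * e - 2) * b)%:R <= _).
  by rewrite ler_nat.
have -> : 2 ^+ 2 * b%:R * e%:R = (4 * e * b)%:R :> R by rewrite !natrM -natrX; lra.
by rewrite ler_nat leq_mul2r leq_subr orbT.
Qed.

Lemma T_le : T%:R <= (B + q) ^+ 2.
Proof.
have e1 : 1 <= e%:R :> R by rewrite ler1n; apply: leq_trans e_ge13.
by rewrite sqrrD B_sqr q_sqr mulr2n /T !natrD; have := s_le; lra.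
Qed.

Lemma Bq_gt0 : 0 < B + q. Proof. by have := q_ge; have := q_lt_B; lra. Qed.

Lemma lnT_le : ln T%:R <= y.
Proof.
rewrite /y mulr_natl -lnXn ?Bq_gt0 // ler_ln ?posrE ?T_le ?exprn_gt0 ?Bq_gt0 //.
by rewrite ltr0n /T addn1.
Qed.

Lemma y_ge3 : 3 <= y.
Proof.
have h : 2 ^+ 3 <= B + q by have := B_ge; have := q_ge; rewrite expr2; nra.
have : ln (2 ^+ 3) <= ln (B + q) by rewrite ler_ln ?posrE ?exprn_gt0 // Bq_gt0.
by rewrite lnXn // -[ln 2 *+ 3]mulr_natl /y; have := ln2_ge R; lra.
Qed.

(** The logarithm of [feas_product]. Here b - e = (B - q)(B + q) and T <= (B + q)^2 for
    B = sqrt b and q = sqrt e, so the powers of B + q cancel; w - e >= (b - e) e / (e + 1)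
    costs the summand 1. *)
Lemma log_inequality : 2 * e%:R * ln (B - q) <=
  1 + ln 2 + 2 * ln (e`!)%:R + y * sigma q y.
Proof.
have e13 := e_ge13; have wb := feas_le F; have wl := feas_large F; have gap := feas_gap F.
have ew : (e < w)%N by move: wl e13; clear; nia.
have eb : (e < b)%N by apply: leq_trans wb.
have w0 : (0 : R) < (w - e)%:R by rewrite ltr0n subn_gt0.
have b0 : (0 : R) < (b - e)%:R by rewrite ltr0n subn_gt0.
have T0 : (0 : R) < T%:R by rewrite ltr0n /T addn1.
have f0 : (0 : R) < (e`!)%:R by rewrite ltr0n fact_gt0.
have er0 : (0 : R) < e%:R by rewrite ltr0n; apply: leq_trans e13.
have lnprod r : all (fun p => 0 < p)%N r -> ln (\prod_(p <- r) p)%:R = \sum_(p <- r) ln p%:R :> R.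
  elim: r => [|x r IH] /=; first by rewrite !big_nil ln1.
  case/andP=> x0 r0; rewrite !big_cons natrM lnM ?posrE ?ltr0n ?IH //.
  by rewrite big_seq prodn_cond_gt0 // => p /(allP r0).
have sp : all (fun p => 0 < p)%N (support b T).
  by apply/allP => p; rewrite mem_filter => /andP[/andP[/prime_gt0]].
have P0 : (0 : R) < (\prod_(p <- support b T) p)%:R.
  by rewrite ltr0n big_seq prodn_cond_gt0 // => p /(allP sp).
have l0 : (0 : R) < ((w - e) ^ e * (b - e) ^ e)%N%:R by rewrite natrM !natrX mulr_gt0 // exprn_gt0.
have r0 : (0 : R) < (T ^ e * (e`! ^ 2 * \prod_(p <- support b T) p))%N%:R.
  by rewrite !natrM !natrX !mulr_gt0 // exprn_gt0.
have := prod_le; rewrite -(ler_nat R) -(ler_ln l0 r0).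
rewrite !natrM !natrX !lnM ?posrE ?mulr_gt0 ?exprn_gt0 // !lnXn // (lnprod _ sp).
rewrite -![ln _ *+ _]mulr_natl => key.
have sig := support_sum sb (leq_trans (isT : (0 < 13)%N) e13) e_sqr_le_b lnT_le y_ge3.
rewrite -/(sigma q y) in sig.
have lb : ln (b - e)%:R = ln (B - q) + y / 2 :> R.
  have q1 := q_lt_B; have q2 := Bq_gt0.
  have -> : y / 2 = ln (B + q) by rewrite /y; lra.
  rewrite -lnM ?posrE //; last by lra.
  by congr (ln _); rewrite -subr_sqr B_sqr q_sqr natrB // ltnW.
have lw : e%:R * ln (b - e)%:R - 1 <= e%:R * ln (w - e)%:R :> R.
  have h1 : (b - e)%:R / (w - e)%:R <= 1 + e%:R^-1 :> R.
    have hn : (e * (b - e) <= (e + 1) * (w - e))%N by move: gap wb ew; clear; nia.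
    rewrite ler_pdivrMr // -(ler_pM2l er0) mulrA mulrDr mulr1 divff ?gt_eqF //.
    by move: hn; rewrite -(ler_nat R) !natrM natrD.
  have := ln_diff_le w0 b0; rewrite mulrBl divff ?gt_eqF // => h2.
  have h3 : e%:R * (ln (b - e)%:R - ln (w - e)%:R) <= e%:R * e%:R^-1 :> R.
    by rewrite ler_pM2l //; lra.
  by rewrite divff ?gt_eqF // in h3; lra.
have lT : e%:R * ln T%:R <= e%:R * y :> R by rewrite ler_pM2l // lnT_le.
rewrite lb in lw key; lra.
Qed.

(** Since both sides of [log_inequality] are monotone in b by [analytic_mono], it
    suffices to refute it at a lower bound for sqrt b: this is e + 1.9 in general, and 38.5
    for e = 13, where b >= 1483. *)
Lemma analytic_range : y <= 5 * (4 * e%:R) ^+ 4 -> False.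
Proof.
move=> yY; have q36 := q_ge; have q0 : 0 < q by lra.
have e13 := e_ge13; have er0 : (0 : R) <= e%:R by [].
have y3 := y_ge3.
have lq := ln_le_quarter q0; have l2 := ln2_le R.
have se : sigma q y + 1 / 2 <= e%:R.
  have Y0 : 0 < (4 * e%:R) ^+ 4 :> R by rewrite exprn_gt0 // mulr_gt0 // ltr0n; apply: leq_trans e13.
  have h1 : ln (y / 3) <= ln (5 / 3 * (4 * e%:R) ^+ 4).
    by rewrite ler_ln ?posrE; [lra | lra | rewrite mulr_gt0 //; lra].
  have h2 : ln (5 / 3) <= 2 / 3 :> R.
    have : 0 < 5 / 3 :> R by lra.
    by move/ln_le_sub1; lra.
  have h3 : ln ((4 * e%:R) ^+ 4) = 8 * ln 2 + 8 * ln q.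
    have -> : (4 * e%:R) ^+ 4 = (2 * q) ^+ 8 by rewrite -[e%:R in LHS]q_sqr; ring.
    by rewrite lnXn ?mulr_gt0 // lnM ?posrE // -[(_ + _) *+ 8]mulr_natl; lra.
  rewrite [ln (5 / 3 * _)]lnM ?posrE // in h1; last by lra.
  have qq : q * q <= e%:R :> R by rewrite -expr2 q_sqr.
  have q5 : 0 <= (q - 36 / 10) * (q - 36 / 10) by rewrite -expr2 sqr_ge0.
  by apply: le_trans qq; rewrite /sigma; lra.
have logi := log_inequality.
have fe : ln (e`!)%:R <= (q ^+ 2 + 1) * (2 * ln q) - q ^+ 2 + 1.
  have := ln_fact_le R (leq_trans (isT : (0 < 13)%N) e13).
  have -> : ln e%:R = 2 * ln q by rewrite -[e%:R in LHS]q_sqr lnXn // -[ln q *+ 2]mulr_natl.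
  by rewrite q_sqr.
case: he => [e13'|e18].
  have B385 : 385 / 10 <= B.
    have F13 := F; rewrite e13' in F13.
    have b14 : (1483 <= b)%N := leq_trans (feas_e13 F13) (feas_le F).
    have h : (1483%:R <= b%:R :> R) by rewrite ler_nat.
    by have := B_sqr; have := sqrtr_ge0 (b%:R : R); rewrite expr2; move: h; nra.
  have q13 : q ^+ 2 = 13 by rewrite q_sqr e13'.
  have qv : q < 385 / 10 by move: q13 q0; rewrite expr2; nra.
  have v1 : 1 < 385 / 10 + q by lra.
  have := analytic_mono er0 q0 qv B385 v1 se; rewrite -/y.
  have := numeric_13 q13 q0 (F := ln (e`!)%:R).
  have f13 : ln (e`!)%:R <= 14 * ln 13 - 12 :> R.
    by have := ln_fact_le R (isT : (0 < 13)%N); rewrite e13'; lra.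
  move/(_ f13) => /=; rewrite e13' in logi *; lra.
have q424 : 424 / 100 <= q.
  have h : (18%:R <= e%:R :> R) by rewrite ler_nat.
  by have := q_sqr; rewrite expr2; move: h q0; nra.
have vB := B_ge.
have qv : q < q ^+ 2 + 19 / 10 by rewrite expr2; nra.
have v1 : 1 < q ^+ 2 + 19 / 10 + q by rewrite expr2; nra.
have := analytic_mono er0 q0 qv vB v1 se; rewrite -/y.
have := numeric_large q424 fe => /=; rewrite q_sqr; lra.
Qed.
End Big.

(** * Very large codes *)

(** One prime comes from e + 1 and the other from twist e, which exceeds 6 and so has
    a common factor with Phi. *)
Lemma feas_two_primes w b e : feasible w b e -> e = 13%N \/ (17 < e)%N ->
  exists p p', [/\ prime p, prime p', (p %| ball_size w b e)%N, (p' %| ball_size w b e)%N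
    & [/\ (p <= e + 2)%N, (p' <= e + 2)%N & coprime p p']].
Proof.
move=> F he; have e13 : (13 <= e)%N by case: he => [->|] //; clear; lia.
set Phi := ball_size w b e; have d6 := feas_dvd_ball6 F; have d1 := feas_dvd_ball F.
have g7 : (6 < twist e)%N.
  by rewrite /twist; case: ifP => _; case: he => [->|] //; clear; lia.
have gcd1 : (1 < gcdn (twist e) Phi)%N.
  have g0 : (0 < gcdn (twist e) Phi)%N by rewrite gcdn_gt0 ball_size_gt0 orbT.
  rewrite ltn_neqAle g0 andbT eq_sym; apply/negP => co.
  rewrite -/Phi Gauss_dvdl // in d6.
  by have := dvdn_leq (isT : (0 < 6)%N) d6; rewrite leqNgt g7.
have e1 : (1 < e.+1)%N by rewrite ltnS; apply: leq_trans e13.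
exists (pdiv e.+1), (pdiv (gcdn (twist e) Phi)).
have pp := pdiv_prime e1; have pp' := pdiv_prime gcd1.
have p'd : (pdiv (gcdn (twist e) Phi) %| e.+2)%N.
  by apply: dvdn_trans (pdiv_dvd _) (dvdn_trans (dvdn_gcdl _ _) (twist_dvd e)).
split=> //.
- exact: dvdn_trans (pdiv_dvd _) d1.
- exact: dvdn_trans (pdiv_dvd _) (dvdn_gcdr _ _).
split.
- by rewrite addn2 (leq_trans (dvdn_leq _ (pdiv_dvd _))).
- by rewrite addn2 dvdn_leq.
rewrite prime_coprime // dvdn_prime2 //; apply/eqP => eqp.
have : (pdiv e.+1 %| e.+1 + 1)%N by rewrite addn1 eqp.
rewrite dvdn_addr ?pdiv_dvd // dvdn1 => /eqP p1.
by rewrite p1 in pp.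
Qed.

Section Upper.
Variable R : realType.
Variables w b e s : nat.
Hypothesis F : feasible w b e.
Hypothesis he : e = 13%N \/ (17 < e)%N.
Hypothesis sb : (s ^ 2 <= (4 * e - 2) * b)%N.
Let T := (b + 1 + s)%N.
Hypothesis carry : forall p, prime p -> (p %| ball_size w b e)%N ->
  (p ^ (trunc_log p b).+1 <= T)%N.
Local Notation q := (Num.sqrt e%:R : R).
Local Notation B := (Num.sqrt b%:R : R).
Let y : R := 2 * ln (B + q).
Local Notation beta p := (trunc_log p b).+1.

Lemma b_pos : (0 < b)%N.
Proof. by apply: leq_trans (e_sqr_le_b F); rewrite expn_gt0; have := e_ge13 he; case: e. Qed.

Lemma lnb_le : ln b%:R <= y.
Proof.
apply: le_trans (lnT_le R F he sb); rewrite ler_ln ?posrE ?ltr0n ?b_pos // ?ler_nat.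
  by rewrite -addnA leq_addr.
by rewrite addn1.
Qed.

Lemma beta_le p : prime p -> (beta p)%:R <= 2 * y.
Proof.
move=> pp; have p1 := prime_gt1 pp; have y3 := y_ge3 R F he; rewrite -/y in y3.
have h : (trunc_log p b)%:R * ln p%:R <= y :> R.
  rewrite mulr_natl -lnXn ?ltr0n ?prime_gt0 // -natrX; apply: le_trans lnb_le.
  rewrite ler_ln ?posrE ?ltr0n ?b_pos ?expn_gt0 ?prime_gt0 // ler_nat.
  by apply: trunc_logP; rewrite ?b_pos.
have l2 : 6 / 10 <= ln p%:R :> R.
  by apply: le_trans (ln2_ge R) _; rewrite ler_ln ?posrE ?ltr0n ?ler_nat // prime_gt0.
have t0 : (0 : R) <= (trunc_log p b)%:R by [].
have : (trunc_log p b)%:R * (6 / 10) <= (trunc_log p b)%:R * ln p%:R :> R by rewrite ler_wpM2l.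
by rewrite -natr1; lra.
Qed.

Lemma interval_ln p : prime p -> (p %| ball_size w b e)%N ->
  ln (b%:R : R) <= (beta p)%:R * ln (p%:R : R) <= ln (T%:R : R).
Proof.
move=> pp pP; have p0 := prime_gt0 pp; have pT := carry pp pP.
rewrite mulr_natl -lnXn ?ltr0n // -natrX.
have pb : (0 : R) < (p ^ beta p)%N%:R by rewrite ltr0n expn_gt0 p0.
have bb : (0 : R) < b%:R by rewrite ltr0n b_pos.
have TT : (0 : R) < T%:R by rewrite ltr0n /T addn1.
rewrite (ler_ln bb pb) (ler_ln pb TT) !ler_nat pT andbT ltnW //.
by rewrite trunc_log_ltn // prime_gt1.
Qed.

(** Both primes of [feas_two_primes] have a power in (b, T], so that the two logarithms differ
    by at most ln (T / b), about 2 sqrt (e / b). As b is at least of the order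
    exp (5 m^4) for some m >= 4e, this is below the bound of [two_log]. *)
Lemma upper_range : 5 * (4 * e%:R) ^+ 4 <= y -> False.
Proof.
move=> yY; have y3 := y_ge3 R F he; rewrite -/y in y3.
have e13 := e_ge13 he.
have [p [p' [pp pp' pP pP' [pe pe' co]]]] := feas_two_primes F he.
have y0 : 0 <= y by lra.
pose P := [pred m : nat | 5 * m%:R ^+ 4 <= y].
have exP : exists m, P m by exists (4 * e)%N; rewrite /P /= natrM.
have bdP m : P m -> (m <= Num.bound y)%N.
  rewrite /P /= => h; case: m h => // m h.
  rewrite -(ler_nat R); apply: ltW; apply: le_lt_trans (archi_boundP y0).
  apply: le_trans h; have m1 : 1 <= m.+1%:R :> R by rewrite ler1n.
  have : m.+1%:R <= m.+1%:R ^+ 4 :> R by rewrite -[leLHS]expr1 ler_weXn2l.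
  by lra.
(* the largest m with 5 m^4 <= y; then y <= 10 m^4 *)
have [m Pm mmax] := ex_maxnP exP bdP.
have m4e : (4 * e <= m)%N by apply: mmax; rewrite /P /= natrM.
have m52 : (52 <= m)%N by apply: leq_trans m4e; rewrite (leq_mul2l 4 13).
have mR : 52%:R <= m%:R :> R by rewrite ler_nat.
have ym : y < 5 * m.+1%:R ^+ 4.
  by rewrite ltNge; apply/negP => h; have := mmax m.+1 h; rewrite ltnn.
have m0 : (0 : R) < m%:R by lra.
have up : y <= 10 * m%:R ^+ 4.
  apply: (le_trans (ltW ym)).
  have : m.+1%:R ^+ 2 <= 14 / 10 * m%:R ^+ 2 :> R by rewrite -natr1; nra.
  have : 0 <= m.+1%:R ^+ 2 :> R by rewrite sqr_ge0.
  have -> : m.+1%:R ^+ 4 = m.+1%:R ^+ 2 * m.+1%:R ^+ 2 :> R by rewrite -exprD.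
  have -> : m%:R ^+ 4 = m%:R ^+ 2 * m%:R ^+ 2 :> R by rewrite -exprD.
  by nra.
set be := beta p; set ga := beta p'.
have bep := beta_le pp; have gap := beta_le pp'; rewrite -/be -/ga in bep gap.
pose lam : R := ln (e + 2)%:R.
have lamp r : prime r -> (r <= e + 2)%N -> ln r%:R <= lam.
  move=> pr re; have r0 := prime_gt0 pr.
  by rewrite ler_ln ?posrE ?ltr0n ?ler_nat // (leq_trans r0).
have lnm : ln m%:R <= 32 / 10 + m%:R / 64 :> R.
  have p64 : 0 < (2 : R) ^+ 6 by rewrite exprn_gt0.
  have := ln_diff_le p64 m0; rewrite lnXn // -[ln 2 *+ 6]mulr_natl.
  by have := ln2_le R; rewrite mulrBl divff ?gt_eqF //; lra.
have lam_le : lam <= ln m%:R - 6 / 10.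
  have h : ((e + 2) * 2 <= m)%N by move: m4e m52; clear; lia.
  have : ln ((e + 2) * 2)%N%:R <= ln m%:R :> R.
    by rewrite ler_ln ?posrE ?ltr0n ?ler_nat // ?muln_gt0 ?addn2 //; apply: leq_trans m52.
  rewrite natrM lnM ?posrE ?ltr0n ?addn2 //; have := ln2_ge R; rewrite /lam addn2; lra.
set X := ((m ^ 2 + m) * ga + m ^ 2 * be)%N.
have Xle : X%:R <= 2 ^+ 6 * m%:R ^+ 6 :> R.
  rewrite /X natrD !natrM natrD natrX.
  have m2 : m%:R <= m%:R ^+ 2 :> R by rewrite expr2; nra.
  have mm : 0 <= m%:R ^+ 2 :> R by rewrite sqr_ge0.
  have h1 : m%:R ^+ 2 * be%:R <= m%:R ^+ 2 * (2 * y) by rewrite ler_wpM2l.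
  have h2 : (m%:R ^+ 2 + m%:R) * ga%:R <= (2 * m%:R ^+ 2) * (2 * y).
    apply: ler_pM => //; [by rewrite addr_ge0 // ltW | lra].
  have h3 : m%:R ^+ 2 * y <= m%:R ^+ 2 * (10 * m%:R ^+ 4) by rewrite ler_wpM2l.
  have -> : m%:R ^+ 6 = m%:R ^+ 2 * m%:R ^+ 4 :> R by rewrite -exprD.
  have : 0 <= m%:R ^+ 2 * m%:R ^+ 4 :> R by rewrite mulr_ge0 // exprn_ge0 // ltW.
  by lra.
have X0 : (0 : R) < X%:R by rewrite ltr0n /X /ga /be; move: m52; clear; case: m => // m; rewrite !mulnS; lia.
have lnX : ln X%:R <= 6 * ln 2 + 6 * ln m%:R :> R.
  have r0 : 0 < 2 ^+ 6 * m%:R ^+ 6 :> R by rewrite mulr_gt0 // exprn_gt0.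
  apply: le_trans (_ : ln (2 ^+ 6 * m%:R ^+ 6) <= _); first by rewrite (ler_ln X0 r0).
  rewrite lnM ?posrE ?exprn_gt0 // !lnXn // -[ln 2 *+ 6]mulr_natl -[ln m%:R *+ 6]mulr_natl.
  exact: lexx.
have cond : ln X%:R + 6 * lam + 3 <= m%:R by have := ln2_le R; lra.
have mpos : (0 < m)%N by apply: leq_trans m52.
have := @two_log R p p' be ga m lam (prime_gt1 pp) (prime_gt1 pp') co isT isT mpos
  (lamp p pp pe) (lamp p' pp' pe') cond.
have /andP[i1 i2] := interval_ln pp pP; have /andP[i3 i4] := interval_ln pp' pP'.
rewrite -/be -/ga in i1 i2 i3 i4.
set D := `|_|; have Dle : D <= ln T%:R - ln b%:R by rewrite ler_norml; lra.
have q0 : 0 < q by have := q_ge R he; lra.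
have B0 : 0 < B by have := q_lt_B R F he; lra.
have T0 : (0 : R) < T%:R by rewrite ltr0n /T addn1.
have b0 : (0 : R) < b%:R by rewrite ltr0n b_pos.
have Bb : ln b%:R = 2 * ln B by rewrite -[b%:R in LHS](B_sqr R b) lnXn // -[ln _ *+ 2]mulr_natl.
have gap_le : ln T%:R - ln b%:R <= 3 * q / B.
  apply: le_trans (ln_diff_le b0 T0) _.
  have bB : b%:R = B * B :> R by rewrite -expr2 B_sqr.
  rewrite ler_pdivrMr // [X in _ <= _ * X]bB mulrA mulfVK ?gt_eqF // /T !natrD.
  have := s_le R sb; have := q_ge R he; have := q_lt_B R F he => h1 h2.
  have : 1 <= q * B by nra.
  by lra.
have yB : y <= 2 * (ln 2 + ln B).
  rewrite /y -lnM ?posrE // ler_pM2l // ler_ln ?posrE ?mulr_gt0 // ?addr_gt0 //.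
  by have := q_lt_B R F he; lra.
have small : 3 * q / B <= expR (- (2 * m%:R ^+ 4)).
  have l0 : 0 < 3 * q / B by rewrite divr_gt0 // mulr_gt0.
  rewrite -[leLHS]lnK ?posrE // ler_expR ln_div ?posrE ?mulr_gt0 // lnM ?posrE //.
  have l3 : ln 3 <= 2 :> R by have := @ln_le_sub1 R 3; lra.
  have lq : ln q <= q by have := ln_le_sub1 q0; lra.
  have qe : q <= m%:R.
    have : (e%:R <= m%:R :> R) by rewrite ler_nat; move: m4e; clear; lia.
    by have := q_sqr R e; have := q_ge R he; rewrite expr2; nra.
  have m4 : m%:R * 10 <= m%:R ^+ 4 :> R.
    have -> : m%:R ^+ 4 = m%:R * m%:R ^+ 3 :> R by rewrite -exprS.
    rewrite ler_pM2l //; apply: le_trans (_ : 52 ^+ 3 <= _); first by lra.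
    by rewrite ler_pXn2r ?nnegrE // ltW.
  by move: Pm; rewrite /P /= => Pm; have := ln2_le R; lra.
by lra.
Qed.
End Upper.

Local Close Scope ring_scope.

(** * The theorem *)

From mathcomp Require Import Rstruct.

Lemma feas_large_false w b e : e = 13 \/ 17 < e -> ~ feasible w b e.
Proof.
move=> he F; have e12 : 11 < e by case: he => [->|] //; clear; lia.
have e2 : 2 < e by apply: leq_trans e12.
have [s [sb carry prod]] := feas_product F e2 (feas_b F e12).
pose R : realType := Rdefinitions.R.
pose y : R := (2 * ln (Num.sqrt b%:R + Num.sqrt e%:R))%R.
have [yY|/Order.POrderTheory.ltW yY] := Order.TotalTheory.leP y (5 * (4 * e%:R) ^+ 4)%R.
  exact: (analytic_range F he sb prod yY).
exact: (upper_range F he sb carry yY).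
Qed.

Lemma code_radius n w e (C : {set {set 'I_n}}) : code_axiom w e C -> 2 < e -> e < w -> w <= n - w ->
  ~ (w = 2 * e + 1 /\ n - w = 2 * e + 1) -> e \in [:: 4; 9; 10; 12; 16].
Proof.
move=> codeC e2 ew wb nt; have F := code_feasible codeC e2 ew wb nt.
have ns := fun h => feas_small (e := e) h F.
have nl : ~ (e = 13 \/ 17 < e) by move=> h; exact: (feas_large_false h F).
have e18 : e <= 17 by rewrite leqNgt; apply/negP => h; apply: nl; right.
have e13 : e <> 13 by move=> h; apply: nl; left.
clear -e2 ns e18 e13.
by move: e ns e2 e18 e13; do 18?[case=> // | move=> e]; move=> ns *; try (by case: (ns isT)); exfalso.
Qed.

Theorem theorem7p2 (n w e : nat) (hw1 : 1 <= w) (hwn : w <= n - 1) (he : 1 <= e) :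
  (exists C : {set {set 'I_n}}, perfect_code w e C /\ ~ trivial_code w e C) ->
  e \in [:: 1; 2; 4; 9; 10; 12; 16].
Proof.
case=> C [/perfect_code_axiom codeC nt].
have wn : w <= n by clear -hwn; lia.
have [e2|e2] := leqP e 2; first by move: e e2 he {nt codeC} => [|[|[|]]].
have /norP[] : ~~ ((w <= e) || (n - w <= e)).
  by apply/negP => h; apply: nt; apply: Or32; apply: (code_card1 codeC wn h).
rewrite -!ltnNge => ew eb.
have nt' : ~ (w = 2 * e + 1 /\ n - w = 2 * e + 1).
  case=> wE bE; apply: nt; apply: Or33; have nE : n = 2 * w by clear -wE bE ew; lia.
  by split=> //; apply: (code_antipodal codeC he ew eb wE nE).
suff : e \in [:: 4; 9; 10; 12; 16] by rewrite !inE; do 5?[case/orP]; move=> /eqP ->.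
have [wb|bw] := leqP w (n - w); first exact: (code_radius codeC e2 ew wb nt').
have nbw : n - (n - w) = w by rewrite subKn.
apply: (code_radius (code_compl wn codeC) e2 eb); rewrite nbw; first exact: ltnW.
by move=> [bE wE]; apply: nt'.
Qed.
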